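(* There exists $n_0 \in \mathbb{N}$ such that the following holds for all $n,t \in \mathbb{N}$ with $n \geq n_0$ and $t \geq 2$. If $G_1, \dots, G_n$ are complete graphs, each on at most $n$ vertices, such that $|V(G_i) \cap V(G_j)| \leq t$ for all distinct $i,j \in [n]$, then $\chi\left(\bigcup_{i=1}^n G_i\right) \leq tn$. Moreover, for infinitely many $k \in \mathbb{N}$ the following holds: if $n = k^2+k+1$ and $t \leq k$, then there exist complete graphs $G_1,\dots,G_n$, each on at most $n$ vertices, with $|V(G_i)\cap V(G_j)| \leq t$ for all distinct $i,j\in[n]$, such that $\bigcup_{i=1}^n G_i$ has exactly $tn$ vertices and is a complete graph (in particular has chromatic number $tn$).
   Context: $[n]=\{1,\dots,n\}$. For graphs $G_1,\dots,G_n$, $\bigcup_{i=1}^n G_i$ denotes the graph with vertex set $\bigcup_i V(G_i)$ and edge set $\bigcup_i E(G_i)$. $\chi$ denotes the chromatic number. *)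

(* Defs.v *)
From mathcomp Require Import all_boot.
Set Implicit Arguments. Unset Strict Implicit. Unset Printing Implicit Defensive.

(* A finite simple graph on a vertex set U : {set T} with symmetric adjacency
   relation adj (only pairs of distinct vertices of U matter). *)

Definition colorable (T : finType) (U : {set T}) (adj : rel T) (k : nat) : bool :=
  [exists f : {ffun T -> 'I_k},
     [forall x in U, forall y in U, ((x != y) && adj x y) ==> (f x != f y)]].

Lemma colorable_exists (T : finType) (U : {set T}) (adj : rel T) :
  exists k, colorable U adj k.
Proof.
exists #|T|; apply/existsP; exists [ffun x => enum_rank x].
apply/forallP => x; apply/implyP => _; apply/forallP => y; apply/implyP => _.
apply/implyP => /andP [nxy _]; rewrite !ffunE.
by apply: contra nxy => /eqP /enum_rank_inj ->.
Qed.

Definition chromatic (T : finType) (U : {set T}) (adj : rel T) : nat :=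
  ex_minn (colorable_exists U adj).

(* G_i is the complete graph on vertex set V i (i : 'I_n).
   The union graph has vertex set \bigcup_i V i and xy is an edge iff
   x != y and x, y lie in a common V i. *)
Definition union_vertices (T : finType) (n : nat) (V : 'I_n -> {set T}) : {set T} :=
  \bigcup_(i < n) V i.

Definition union_adj (T : finType) (n : nat) (V : 'I_n -> {set T}) : rel T :=
  fun x y => (x != y) && [exists i : 'I_n, (x \in V i) && (y \in V i)].

Definition is_complete (T : finType) (U : {set T}) (adj : rel T) : Prop :=
  forall x y, x \in U -> y \in U -> x != y -> adj x y.

(* Main.v *)
(* Dually, the points of T are edges of a hypergraph on [n] with degrees at most n and
   codegrees at most t, to be coloured with K = tn colours so that edges which meet get
   different colours.  Greedy colouring in decreasing order of size can fail at an edge e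
   only if about K edges at least as large as e meet e; double counting shows that this is
   nearly extremal, and that there are then many disjoint pairs among those edges.  So one
   first gives a common colour to some disjoint pairs chosen at random, in such a way that
   every dangerous edge sees enough repeated colours, and then colours greedily.  For sizes
   of order sqrt n this is done once; when the hypergraph is close to a blown-up projective
   plane, only one size is dangerous and the savings are compared with the exact excess.
   Smaller sizes are treated by windows [b/2, b), where a random precolouring of a small
   part of each window provides the repeated colours for the next ones.  The edges of
   bounded size are finally coloured from their remaining colours by a weighted random
   greedy procedure.  All random choices are derandomised with exponential potentials.
   For sharpness, replace each point of the projective plane over F_p by t copies. *)
Require Import Defs.
From mathcomp Require Import all_boot.
From mathcomp Require Import all_order all_algebra.
From mathcomp Require Import Rstruct.
From mathcomp Require Import lra ring zify.
From Stdlib Require Rdefinitions Rtrigo_def Exp_prop Rpower.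
Set Implicit Arguments. Unset Strict Implicit. Unset Printing Implicit Defensive.
Import Order.TTheory GRing.Theory Num.Theory.
Local Open Scope ring_scope.

(** * Exponential potentials *)

(** With [K = t * n] colours every bound is tight at the blown-up projective plane: an edge of size
    [r] may meet up to about [K + K / (r - 1)] edges at least as large. A reserve of [sig * K]
    repeated colours covers this excess once [r] is a large constant; hence the windows stop at
    bounded size, and each reserve has to exist before the greedy colouring of the sizes that it
    serves. For [r] near the square root of [n] a linear reserve may be out of reach, since the
    number of disjoint pairs found is proportional to [slack]; but the excess is bounded by the same
    quantity divided by [r - 1]. For bounded sizes the lists are linear in [n] but may be short.
    What saves the random procedure there is [t >= 2]: a vertex lies in at most [n <= K / 2] edges,
    most of which keep nearly all colours, so the expected number of edges at a vertex choosing a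
    given colour starts below 2/3. The constants only need to be ordered
    [eps << sig << al2 << al << rho << kap]; powers of ten leave the comparisons to [lra]. *)

Ltac lra_above x :=
  (* Hypotheses more recent than [x] are dropped, so that [lra] works on the facts just moved into
     the goal and not on the whole context. *)
  repeat match goal with H : _ |- _ => tryif constr_eq H x then fail 1 else clear H end; lra.

Lemma real_exp : {F : archiRealFieldType & {e : F -> F |
  [/\ forall x y, e (x + y) = e x * e y, forall x, 0 < e x & forall x, 1 + x <= e x]}}.
Proof.
exists Rdefinitions.R; exists Rtrigo_def.exp; split.
- exact: Exp_prop.exp_plus.
- by move=> x; apply/RltbP; exact: Exp_prop.exp_pos.
- by move=> x; apply/RlebP; exact: Rpower.exp_ineq1_le.
Qed.

(* The opaque projections keep the concrete reals from being unfolded. *)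
Definition R : archiRealFieldType := projT1 real_exp.
Definition exp : R -> R := sval (projT2 real_exp).

Lemma expD (x y : R) : exp (x + y) = exp x * exp y.
Proof. by rewrite /exp; case: (svalP (projT2 real_exp)). Qed.

Lemma exp_gt0 (x : R) : 0 < exp x.
Proof. by rewrite /exp; case: (svalP (projT2 real_exp)). Qed.

Lemma exp_ge1D (x : R) : 1 + x <= exp x.
Proof. by rewrite /exp; case: (svalP (projT2 real_exp)). Qed.

Lemma exp0 : exp 0 = 1.
Proof.
by apply: (mulfI (lt0r_neq0 (exp_gt0 0))); rewrite -expD addr0 mulr1.
Qed.

Lemma expN (x : R) : exp (- x) = (exp x)^-1.
Proof.
apply: (mulIf (lt0r_neq0 (exp_gt0 x))).
by rewrite -expD addNr exp0 mulVf // lt0r_neq0 // exp_gt0.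
Qed.

Lemma expMn (x : R) (k : nat) : exp (k%:R * x) = exp x ^+ k.
Proof.
elim: k => [|k IH]; first by rewrite mul0r exp0 expr0.
by rewrite -natr1 mulrDl mul1r expD IH exprSr.
Qed.

Lemma ler_exp (x y : R) : x <= y -> exp x <= exp y.
Proof.
move=> xy; rewrite -(subrK x y) expD -[X in X <= _]mul1r.
rewrite ler_wpM2r // ?(ltW (exp_gt0 _)) //.
by apply: le_trans (exp_ge1D _); lra.
Qed.

Lemma exp_lt1 (x : R) : exp x < 1 -> x < 0.
Proof. by move=> h; rewrite ltNge; apply/negP => /ler_exp; rewrite exp0; lra. Qed.

(** From [1 - x <= exp (- x)] follows [(1 - x) * exp x <= 1], and [1 - x] times the right-hand side
    is [1 + x ^+ 2 * (1 - 2 * x)]. There is no lower bound on [x], so large favourable jumps need no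
    control. *)
Lemma exp_quad (x : R) : x <= 1 / 2 -> exp x <= 1 + x + 2 * x ^+ 2.
Proof.
move=> hx; have h := exp_ge1D (- x); have e0 := exp_gt0 x.
have e1 : exp (- x) * exp x = 1 by rewrite -expD addNr exp0.
have h2 : (1 - x) * exp x <= 1 by rewrite -[X in _ <= X]e1 ler_wpM2r // ltW.
have h3 : 0 <= x ^+ 2 * (1 - 2 * x) by rewrite mulr_ge0 ?sqr_ge0 //; lra.
have h1 : 0 < 1 - x by lra.
rewrite -(ler_pM2l h1); apply: le_trans h2 _.
have -> : (1 - x) * (1 + x + 2 * x ^+ 2) = 1 + x ^+ 2 * (1 - 2 * x) by ring.
by rewrite lerDl.
Qed.

(* One step of the method of conditional expectations: some outcome of positive
   probability does not increase the potential [Phi]. *)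
Lemma exists_le_mean (W : finType) (mu F : W -> R) (y : R) :
  (forall w, 0 <= mu w) -> \sum_w mu w = 1 -> \sum_w mu w * F w <= y ->
  exists2 w, 0 < mu w & F w <= y.
Proof.
move=> mu0 mu1 hF.
case: (boolP [exists w, (0 < mu w) && (F w <= y)]).
  by case/existsP => w /andP [h1 h2]; exists w.
rewrite negb_exists => /forallP hn.
have h0 : forall w, 0 <= mu w * (F w - y).
  move=> w; move: (hn w); rewrite negb_and -leNgt -ltNge.
  case/orP => h; last by rewrite mulr_ge0 // subr_ge0 ltW.
  have -> : mu w = 0 by apply/eqP; rewrite eq_le h mu0.
  by rewrite mul0r.
have hs : \sum_w mu w * (F w - y) <= 0.
  under eq_bigr => w _ do rewrite mulrBr.
  by rewrite sumrB -mulr_suml mu1 mul1r subr_le0.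
have hz : \sum_w mu w * (F w - y) = 0.
  by apply/eqP; rewrite eq_le hs sumr_ge0.
have hall := psumr_eq0P (fun w _ => h0 w) hz.
have mz : forall w, mu w = 0.
  move=> w; have /eqP := hall w isT; rewrite mulf_eq0 => /orP [/eqP //|].
  rewrite subr_eq0 => /eqP e; move: (hn w); rewrite e lexx andbT -leNgt.
  by move=> h; apply/eqP; rewrite eq_le h mu0.
by move: mu1; rewrite big1 // => /eqP; rewrite eq_sym oner_eq0.
Qed.

(** A Freedman-type estimate for one step: mean plus twice the second moment is a sufficient
    compensation for an increment bounded above by 1/2. *)
Lemma mgf_bound (W : finType) (mu D : W -> R) (a v : R) :
  (forall w, 0 <= mu w) -> \sum_w mu w = 1 -> (forall w, 0 < mu w -> D w <= 1 / 2) ->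
  \sum_w mu w * D w <= a -> \sum_w mu w * D w ^+ 2 <= v ->
  \sum_w mu w * exp (D w - (a + 2 * v)) <= 1.
Proof.
move=> mu0 mu1 hD ha hv.
have -> : \sum_w mu w * exp (D w - (a + 2 * v)) =
          (\sum_w mu w * exp (D w)) * exp (- (a + 2 * v)).
  by rewrite mulr_suml; apply: eq_bigr => w _; rewrite expD mulrA.
have h : \sum_w mu w * exp (D w) <= 1 + (a + 2 * v).
  have : \sum_w mu w * exp (D w) <= \sum_w (mu w + mu w * D w + 2 * (mu w * D w ^+ 2)).
    apply: ler_sum => w _; have := mu0 w; rewrite le_eqVlt => /orP [/eqP <-|hw].
      by rewrite !mul0r !mulr0 !addr0.
    have -> : mu w + mu w * D w + 2 * (mu w * D w ^+ 2) = mu w * (1 + D w + 2 * D w ^+ 2) by ring.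
    by rewrite ler_pM2l //; exact: exp_quad (hD w hw).
  rewrite !big_split /= -mulr_sumr mu1; lra.
have he := exp_ge1D (a + 2 * v); have e0 := exp_gt0 (- (a + 2 * v)).
have one_eq : (1 : R) = exp (a + 2 * v) * exp (- (a + 2 * v)) by rewrite -expD subrr exp0.
by rewrite [X in _ <= X]one_eq ler_wpM2r ?(ltW e0) // (le_trans h he).
Qed.

(** Scaled by [2 * b] an increment [z] lies in [[0, 1/2]], where the quadratic term of [exp_quad] is
    at most [z]. This doubles the mean, whence the factor 2 in upper-tail bounds. *)
Lemma mgf_up (W : finType) (mu D : W -> R) (b p : R) :
  (forall w, 0 <= mu w) -> \sum_w mu w = 1 -> 0 < b ->
  (forall w, 0 < mu w -> 0 <= D w <= b) -> \sum_w mu w * D w <= p ->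
  \sum_w mu w * exp (D w / (2 * b) - p / b) <= 1.
Proof.
move=> mu0 mu1 b0 hD hp.
have hb2 : 0 < 2 * b by lra.
have key w : mu w * exp (D w / (2 * b) - p / b) <= (mu w + mu w * D w / b) * exp (- (p / b)).
  rewrite expD mulrA ler_wpM2r ?(ltW (exp_gt0 _)) //.
  have := mu0 w; rewrite le_eqVlt => /orP [/eqP <-|hw]; first by rewrite !mul0r addr0.
  have /andP [d0 d1] := hD w hw.
  set z := D w / (2 * b).
  have z0 : 0 <= z by rewrite divr_ge0 // ltW.
  have z1 : z <= 1 / 2 by rewrite ler_pdivrMr //; lra.
  have -> : mu w + mu w * D w / b = mu w * (1 + 2 * z).
    by rewrite /z; field; rewrite lt0r_neq0.
  rewrite ler_pM2l //; apply: le_trans (exp_quad z1) _; rewrite expr2; nra.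
apply: le_trans (ler_sum _ (fun w _ => key w)) _.
rewrite -mulr_suml big_split /= mu1 -mulr_suml.
have h : 1 + (\sum_w mu w * D w) / b <= exp (p / b).
  by apply: le_trans (exp_ge1D _); rewrite lerD2l ler_pM2r ?invr_gt0.
have one_eq : (1 : R) = exp (p / b) * exp (- (p / b)) by rewrite -expD subrr exp0.
by rewrite [X in _ <= X]one_eq ler_wpM2r ?(ltW (exp_gt0 _)).
Qed.

(** Here the scaling is by [4 * b]: for [z] in [[0, 1/4]] the quadratic term costs at most half of
    [z], so half of the mean survives. *)
Lemma mgf_lo (W : finType) (mu D : W -> R) (b p : R) :
  (forall w, 0 <= mu w) -> \sum_w mu w = 1 -> 0 < b ->
  (forall w, 0 < mu w -> 0 <= D w <= b) -> p <= \sum_w mu w * D w ->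
  \sum_w mu w * exp (p / (8 * b) - D w / (4 * b)) <= 1.
Proof.
move=> mu0 mu1 b0 hD hp.
have hb4 : 0 < 4 * b by lra.
have key w : mu w * exp (p / (8 * b) - D w / (4 * b)) <=
             (mu w - mu w * D w / (8 * b)) * exp (p / (8 * b)).
  rewrite addrC expD mulrA ler_wpM2r ?(ltW (exp_gt0 _)) //.
  have := mu0 w; rewrite le_eqVlt => /orP [/eqP <-|hw]; first by rewrite !mul0r subr0.
  have /andP [d0 d1] := hD w hw.
  set z := D w / (4 * b).
  have z0 : 0 <= z by rewrite divr_ge0 // ltW.
  have z1 : z <= 1 / 4 by rewrite ler_pdivrMr //; lra.
  have -> : mu w - mu w * D w / (8 * b) = mu w * (1 - z / 2).
    by rewrite /z; field; rewrite lt0r_neq0.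
  have z2 : - z <= 1 / 2 by lra.
  rewrite ler_pM2l //; apply: le_trans (exp_quad z2) _; rewrite expr2; nra.
apply: le_trans (ler_sum _ (fun w _ => key w)) _.
rewrite -mulr_suml sumrB mu1 -mulr_suml.
have h : 1 - (\sum_w mu w * D w) / (8 * b) <= exp (- (p / (8 * b))).
  apply: le_trans (exp_ge1D _); rewrite lerD2l lerN2 ler_pM2r ?invr_gt0 //; lra.
have one_eq : (1 : R) = exp (- (p / (8 * b))) * exp (p / (8 * b)) by rewrite -expD addNr exp0.
by rewrite [X in _ <= X]one_eq ler_wpM2r ?(ltW (exp_gt0 _)).
Qed.

(** A sum of exponentials below 1 forces every exponent to be negative. Hence a step may assume that
    no deviation has occurred so far, which is how means and increments are bounded in all
    applications. *)
Lemma potential_run (S A : Type) (W Th : finType) (xs : seq A)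
    (good : seq A -> S -> Prop) (E : Th -> seq A -> S -> R)
    (mu : seq A -> A -> S -> W -> R) (nxt : A -> S -> W -> S) (s0 : S) :
  good [::] s0 -> \sum_th exp (E th [::] s0) < 1 ->
  (forall don a rest s, xs = don ++ a :: rest -> good don s ->
     (forall th, E th don s < 0) ->
     [/\ forall w, 0 <= mu don a s w, \sum_w mu don a s w = 1,
         forall w, 0 < mu don a s w -> good (rcons don a) (nxt a s w) &
         forall th, \sum_w mu don a s w *
            exp (E th (rcons don a) (nxt a s w) - E th don s) <= 1]) ->
  exists2 s, good xs s & forall th, E th xs s < 0.
Proof.
move=> g0 p0 step.
have neg don s : \sum_th exp (E th don s) < 1 -> forall th, E th don s < 0.
  move=> h th; apply: exp_lt1; apply: le_lt_trans h.
  rewrite (bigD1 th) //= lerDl sumr_ge0 // => i _; exact/ltW/exp_gt0.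
suff H : forall rest don s, xs = don ++ rest -> good don s ->
    \sum_th exp (E th don s) < 1 -> exists2 s, good xs s & \sum_th exp (E th xs s) < 1.
  have [s gs ps] := H xs [::] s0 erefl g0 p0.
  by exists s => //; exact: neg.
elim=> [|a rest IH] don s exs gs ps; first by rewrite cats0 in exs; subst don; exists s.
have [m0 m1 mg mE] := step don a rest s exs gs (neg _ _ ps).
have [|w w0 hw] := @exists_le_mean W (mu don a s)
    (fun w => \sum_th exp (E th (rcons don a) (nxt a s w)))
    (\sum_th exp (E th don s)) m0 m1.
  under eq_bigr => w _ do rewrite mulr_sumr.
  rewrite exchange_big /=; apply: ler_sum => th _.
  have -> : \sum_w mu don a s w * exp (E th (rcons don a) (nxt a s w)) =
     (\sum_w mu don a s w * exp (E th (rcons don a) (nxt a s w) - E th don s)) * exp (E th don s).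
    by rewrite mulr_suml; apply: eq_bigr => w _; rewrite -mulrA -expD subrK.
  by rewrite ler_piMl ?(ltW (exp_gt0 _)).
apply: (IH (rcons don a) (nxt a s w)); first by rewrite cat_rcons.
  exact: mg.
exact: le_lt_trans hw ps.
Qed.

Lemma nat_ge (x : R) : exists N : nat, forall n : nat, (N <= n)%N -> x <= n%:R.
Proof.
exists (Num.bound x) => n hn.
have h := archi_boundP (normr_ge0 x).
apply: le_trans (ler_norm x) _.
apply: le_trans (ltW (archi_boundP (normr_ge0 x))) _.
rewrite ler_nat; move: hn; rewrite /Num.bound normr_id; exact.
Qed.

(** Writing [exp (a * x)] as a [k]-th power with [k = 2 * (d + 1)] bounds it below by a multiple of
    [x ^+ k], hence of [n ^+ d.+1]. Union bounds over polynomially many events thus survive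
    deviations of order square root of [n]. *)
Lemma exp_beats_poly (a : R) (d : nat) : 0 < a ->
  exists N : nat, forall (n : nat) (x : R), (N <= n)%N -> 0 <= x -> n%:R <= x ^+ 2 ->
    n%:R ^+ d * exp (- (a * x)) < 1.
Proof.
move=> a0; pose k := (d.+1.*2)%N.
have k0 : 0 < k%:R :> R by rewrite ltr0n.
pose C := (a / k%:R) ^+ k.
have C0 : 0 < C by rewrite exprn_gt0 // divr_gt0.
have [N hN] := nat_ge (C^-1 + 1); exists N => n x hn x0 hx.
have {hN} hn1 := hN n hn.
have hn0 : 0 < n%:R :> R by apply: lt_le_trans hn1; rewrite addr_gt0 ?invr_gt0.
have hexp : C * n%:R ^+ d.+1 <= exp (a * x).
  have -> : a * x = k%:R * (a * x / k%:R) by field; rewrite lt0r_neq0.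
  rewrite expMn.
  apply: (@le_trans _ _ ((a * x / k%:R) ^+ k)); last first.
    have hz : 0 <= a * x / k%:R by rewrite divr_ge0 ?mulr_ge0 ?ler0n // ltW.
    apply: lerXn2r; rewrite ?nnegrE ?(ltW (exp_gt0 _)) //.
    by apply: le_trans (exp_ge1D _); rewrite lerDr.
  have -> : a * x / k%:R = (a / k%:R) * x by field; rewrite lt0r_neq0.
  rewrite exprMn ler_pM2l //.
  have -> : x ^+ k = (x ^+ 2) ^+ d.+1 by rewrite -exprM mul2n.
  by apply: lerXn2r; rewrite ?nnegrE ?sqr_ge0 ?ler0n.
rewrite expN ltr_pdivrMr ?exp_gt0 // mul1r; apply: lt_le_trans hexp.
rewrite exprS mulrA -[X in X < _]mul1r ltr_pM2r ?exprn_gt0 //.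
have : C * (C^-1 + 1) <= C * n%:R by rewrite ler_pM2l.
by rewrite mulrDr mulfV ?lt0r_neq0 // mulr1; lra.
Qed.

(** * Edges meeting in a hypergraph *)

Definition adj (n : nat) (X : finType) (ed : X -> {set 'I_n}) : rel X :=
  fun x y => (x != y) && (ed x :&: ed y != set0).

Lemma adj_sym (n : nat) (X : finType) (ed : X -> {set 'I_n}) x y : adj ed x y = adj ed y x.
Proof. by rewrite /adj eq_sym setIC. Qed.

Lemma adj_irr (n : nat) (X : finType) (ed : X -> {set 'I_n}) x : adj ed x x = false.
Proof. by rewrite /adj eqxx. Qed.

Lemma adjP (n : nat) (X : finType) (ed : X -> {set 'I_n}) x y :
  reflect (x != y /\ exists2 i, i \in ed x & i \in ed y) (adj ed x y).
Proof.
apply: (iffP andP) => [[h1 /set0Pn [i]]|[h1 [i h2 h3]]].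
  by rewrite inE => /andP [h2 h3]; split => //; exists i.
by split=> //; apply/set0Pn; exists i; rewrite inE h2.
Qed.

Lemma sum_if_eq (C : finType) (mu : C -> R) (c0 : C) (d0 d1 : R) :
  \sum_c mu c = 1 ->
  \sum_c mu c * (if c == c0 then d0 else d1) = mu c0 * d0 + (1 - mu c0) * d1.
Proof.
move=> h; rewrite (bigD1 c0) //= eqxx; congr (_ + _).
rewrite (eq_bigr (fun c => mu c * d1)) => [|c /negbTE ->] //.
by rewrite -mulr_suml -h [in RHS](bigD1 c0) //= addrAC subrr add0r.
Qed.

Lemma sqrt_nat (n : nat) : (0 < n)%N -> exists2 m : nat, (n <= m ^ 2)%N & (m ^ 2 <= 4 * n)%N.
Proof.
move=> n0; have ex : exists m, (n <= m ^ 2)%N by exists n; rewrite -{1}(expn1 n) leq_pexp2l.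
case: (ex_minnP ex) => m hm hmin; exists m => //.
case: m hm hmin => [|m] hm hmin; first by move: hm; rewrite exp0n // leqn0; case: n n0.
have : ~~ (n <= m ^ 2)%N by apply/negP => /hmin; rewrite ltnn.
rewrite -ltnNge => h; case: m hm hmin h => [|m] hm hmin h; first by lia.
move: h; rewrite !expnS !expn0; nia.
Qed.

Lemma card_bigcup_le (I T : finType) (D : {set I}) (F : I -> {set T}) :
  (#|\bigcup_(i in D) F i| <= \sum_(i in D) #|F i|)%N.
Proof.
elim/big_ind2: _ => [|A a B b hA hB|i _]; rewrite ?cards0 //.
by apply: leq_trans (leq_card_setU _ _).1 _; exact: leq_add.
Qed.

Lemma card_le_union (I T : finType) (A : {set T}) (D : {set I}) (F : I -> {set T}) (k : nat) :
  (forall x, x \in A -> exists2 i, i \in D & x \in F i) ->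
  (forall i, i \in D -> #|F i| <= k)%N -> (#|A| <= #|D| * k)%N.
Proof.
move=> h1 h2; apply: (@leq_trans #|\bigcup_(i in D) F i|).
  by apply/subset_leq_card/subsetP => x /h1 [i iD xi]; apply/bigcupP; exists i.
apply: leq_trans (card_bigcup_le _ _) _.
by rewrite -sum_nat_const; apply: leq_sum.
Qed.

(** * List colouring with edges of bounded size *)

Section WeightedGreedy.

Variables (n : nat) (X C : finType) (ed : X -> {set 'I_n}) (W : {set X}) (L : X -> {set C}).

(** [wt] is the unnormalised law from which an uncoloured edge will draw its colour. [load i c] sums
    the probabilities with which the edges through [i] coloured so far drew [c]; it is bookkeeping
    that bounds the growth of the weights. *)
Record wstate := WState {
  wt : X -> C -> R;
  load : 'I_n -> C -> R;
  wcol : X -> option C }.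

Definition wtot (s : wstate) x : R := \sum_c wt s x c.
Definition wpick (s : wstate) x c : R := wt s x c / wtot s x.

(** A neighbour loses the colour drawn and has its other weights scaled by [exp q], where [q] is the
    probability of that colour. As [(1 - q) * exp q] is between [1 - q ^+ 2] and 1, each weight
    keeps its mean up to second order. *)
Definition wnext x (s : wstate) (c : C) : wstate := {|
  wt := fun y c' => if adj ed x y then
          (if c' == c then 0 else wt s y c' * exp (wpick s x c')) else wt s y c';
  load := fun i c' => load s i c' + (if i \in ed x then wpick s x c' else 0);
  wcol := fun y => if y == x then Some c else wcol s y |}.

Definition winit : wstate := {|
  wt := fun x c => if c \in L x then (#|L x|%:R)^-1 else 0;
  load := fun _ _ => 0;
  wcol := fun _ => None |}.

Definition wdeg (don : seq X) (s : wstate) (i : 'I_n) (c : C) : R :=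
  \sum_(f in W | (i \in ed f) && (f \notin don)) wt s f c.

(** The third clause holds because each factor [exp q] gained by an edge is recorded in the load of
    a vertex shared with the edge just coloured. *)
Definition wgood (don : seq X) (s : wstate) : Prop :=
  [/\ forall x c, 0 <= wt s x c,
      forall x c, 0 < wt s x c -> c \in L x /\
        forall y, y \in don -> adj ed y x -> wcol s y <> Some c,
      forall x c, x \in W -> wt s x c <= exp (\sum_(i in ed x) load s i c) / #|L x|%:R,
      forall i c, 0 <= load s i c &
      (forall x, x \in don -> exists2 c, c \in L x & wcol s x = Some c) /\
      (forall x y, x \in don -> y \in don -> adj ed x y -> wcol s x <> wcol s y)].

Lemma wgood_init : wgood [::] winit.
Proof.
split=> //=.
- by move=> x c; case: ifP => // _; rewrite invr_ge0 ler0n.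
- by move=> x c; case: ifP => //; rewrite ltxx.
- move=> x c _; rewrite big1 // exp0 mul1r; case: ifP => // _.
  by rewrite invr_ge0 ler0n.
Qed.

Lemma wgood_next don a s c : a \notin don -> wgood don s -> 0 < wtot s a ->
  0 < wpick s a c -> wgood (rcons don a) (wnext a s c).
Proof.
move=> adon [p0 pL pb g0 [cd ca]] Q0 hc.
have pi0 c' : 0 <= wpick s a c' by rewrite divr_ge0 ?p0 // ltW.
have pac : 0 < wt s a c.
  by rewrite lt0r p0 andbT; apply: contraTneq hc => e; rewrite /wpick e mul0r ltxx.
have [cLa canb] := pL _ _ pac.
have ne y : y \in don -> (y == a) = false.
  by move=> yd; apply/negbTE; apply: contraNneq adon => <-.
split=> /=.
- move=> x c'; case: ifP => // _; case: ifP => // _.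
  by rewrite mulr_ge0 ?p0 // ltW // exp_gt0.
- move=> x c'; case: ifP => [ax|nax].
    case: ifP => [|/eqP ncc h]; first by rewrite ltxx.
    have h' : 0 < wt s x c'.
      by move: h; rewrite pmulr_lgt0 // exp_gt0.
    have [h1 h2] := pL _ _ h'; split=> // y; rewrite mem_rcons inE => /orP [/eqP ->|yd].
      by rewrite eqxx => _ [e]; apply: ncc.
    by rewrite ne //; exact: h2.
  move=> h; have [h1 h2] := pL _ _ h; split=> // y.
  rewrite mem_rcons inE => /orP [/eqP ->|yd]; first by rewrite nax.
  by rewrite ne //; exact: h2.
- move=> x c' xW; have hb := pb x c' xW.
  have sub : \sum_(i in ed x) load s i c' <=
             \sum_(i in ed x) (load s i c' + (if i \in ed a then wpick s a c' else 0)).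
    by apply: ler_sum => i _; rewrite lerDl; case: ifP.
  case: ifP => [ax|nax]; last first.
    by apply: le_trans hb _; rewrite ler_wpM2r ?invr_ge0 ?ler0n // ler_exp.
  case: ifP => _; first by rewrite divr_ge0 ?ler0n // ltW // exp_gt0.
  apply: (@le_trans _ _ (exp (\sum_(i in ed x) load s i c') / #|L x|%:R * exp (wpick s a c'))).
    by rewrite ler_wpM2r // ltW // exp_gt0.
  rewrite mulrAC -expD ler_wpM2r ?invr_ge0 ?ler0n // ler_exp //.
  rewrite big_split /= lerD2l.
  have [_ [i ia ix]] := adjP _ _ _ ax.
  rewrite (bigD1 i) //= ia lerDl sumr_ge0 // => j _; by case: ifP.
- by move=> i c'; rewrite addr_ge0 //; case: ifP.
- split.
    move=> x; rewrite mem_rcons inE => /orP [/eqP ->|xd].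
      by rewrite eqxx; exists c.
    by rewrite ne //; exact: cd.
  move=> x y; rewrite !mem_rcons !inE => /orP [/eqP ->|xd] /orP [/eqP ->|yd].
  + by rewrite adj_irr.
  + by rewrite eqxx ne // adj_sym => /(canb _ yd) h e; apply: h.
  + by rewrite eqxx ne // => /(canb _ xd) h e; apply: h.
  by rewrite !ne //; exact: ca.
Qed.

Lemma exp_sub1 (x : R) : 0 <= x <= 1 / 2 -> 0 <= exp x - 1 <= 2 * x.
Proof.
move=> /andP [h0 h1]; have := exp_quad h1; have := exp_ge1D x; rewrite expr2 => h2 h3.
apply/andP; split; nra.
Qed.

Lemma exp_mul1B_le (x : R) : (1 - x) * exp x <= 1.
Proof.
have h := exp_ge1D (- x); have e1 : exp (- x) * exp x = 1 by rewrite -expD addNr exp0.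
by rewrite -[X in _ <= X]e1 ler_wpM2r // ltW // exp_gt0.
Qed.

Lemma exp_mul1B_ge (x : R) : x <= 1 -> 1 - x ^+ 2 <= (1 - x) * exp x.
Proof.
move=> h; have -> : 1 - x ^+ 2 = (1 - x) * (1 + x) by ring.
by rewrite ler_wpM2l ?subr_ge0 // exp_ge1D.
Qed.

Section Step.
Variables (a : X) (s : wstate) (P : R).
Hypotheses (pick_sum : \sum_c wpick s a c = 1)
  (pick_b : forall c, 0 <= wpick s a c <= 2 * P) (P_small : P <= 1 / 4).

Let pick_half c : wpick s a c <= 1 / 2.
Proof. have /andP [_ h] := pick_b c; move: P_small h; lra. Qed.

(** A weight [w] loses at most [w * q ^+ 2] in mean; with [w <= P] and [q <= 2 * P] this sums to at
    most [2 * P ^+ 2], because the [q] sum to 1. *)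
Lemma wtot_mean y : adj ed a y -> (forall c, 0 <= wt s y c <= P) ->
  wtot s y - 2 * P ^+ 2 <= \sum_c wpick s a c * wtot (wnext a s c) y.
Proof.
move=> ay hp.
under [X in _ <= X]eq_bigr => c _ do rewrite /wtot /= ay mulr_sumr.
rewrite exchange_big /=.
have -> : \sum_j \sum_i wpick s a i * (if j == i then 0 else wt s y j * exp (wpick s a j)) =
   \sum_j (1 - wpick s a j) * (wt s y j * exp (wpick s a j)).
  apply: eq_bigr => j _; under eq_bigr => i _ do rewrite eq_sym.
  by rewrite sum_if_eq // mulr0 add0r.
have -> : 2 * P ^+ 2 = \sum_c P * (2 * P) * wpick s a c.
  by rewrite -mulr_sumr pick_sum; ring.
rewrite -sumrB; apply: ler_sum => c _.
have /andP [h1 h2] := hp c; have /andP [h3 h4] := pick_b c; have h5 := pick_half c.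
have h6 : wpick s a c <= 1 by lra.
have := exp_mul1B_ge h6; rewrite expr2 => h7.
have h8 : wt s y c * (1 - wpick s a c * wpick s a c) <=
    wt s y c * ((1 - wpick s a c) * exp (wpick s a c)) by rewrite ler_wpM2l.
have h9 : wt s y c * wpick s a c <= P * (2 * P) by rewrite ler_pM.
have h10 : wt s y c * wpick s a c * wpick s a c <= P * (2 * P) * wpick s a c.
  by rewrite ler_wpM2r.
nra.
Qed.

Lemma wtot_diff y c : adj ed a y -> (forall c, 0 <= wt s y c <= P) ->
  `|wtot (wnext a s c) y - wtot s y| <= 2 * P.
Proof.
move=> ay hp; rewrite /wtot /= ay -sumrB (bigD1 c) //= eqxx sub0r.
have /andP [h1 h2] := hp c.
have hs : 0 <= \sum_(i | i != c) ((if i == c then 0 else wt s y i * exp (wpick s a i)) - wt s y i) <= 2 * P.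
  rewrite (eq_bigr (fun i => wt s y i * (exp (wpick s a i) - 1))); last first.
    by move=> i /negbTE ->; rewrite mulrBr mulr1.
  have hi i : 0 <= wt s y i * (exp (wpick s a i) - 1) <= 2 * P * wpick s a i.
    have /andP [g1 g2] := hp i; have /andP [g3 g4] := pick_b i.
    have /andP [g5 g6] : 0 <= exp (wpick s a i) - 1 <= 2 * wpick s a i.
      by apply: exp_sub1; rewrite g3 pick_half.
    rewrite mulr_ge0 //= (le_trans (ler_pM g1 g5 g2 g6)) //; lra.
  apply/andP; split; first by apply: sumr_ge0 => i _; case/andP: (hi i).
  apply: (@le_trans _ _ (\sum_(i | i != c) 2 * P * wpick s a i)).
    by apply: ler_sum => i _; case/andP: (hi i).
  have h0 : 0 <= wpick s a c by case/andP: (pick_b c).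
  have hP : 0 <= P by lra.
  have e : 2 * P = 2 * P * \sum_c wpick s a c by rewrite pick_sum mulr1.
  rewrite -mulr_sumr [X in _ <= X]e; apply: ler_wpM2l; first by rewrite mulr_ge0.
  by rewrite [X in _ <= X](bigD1 c) //= lerDr.
move: hs => /andP [g1 g2]; rewrite ler_norml; apply/andP; split; lra.
Qed.

Lemma wdeg_next_out don i c c' : i \notin ed a ->
  wdeg (rcons don a) (wnext a s c) i c' - wdeg don s i c' =
  (\sum_(f in W | [&& i \in ed f, f \notin don & adj ed a f]) wt s f c') *
  (if c == c' then -1 else exp (wpick s a c') - 1).
Proof.
move=> ia.
have e1 : wdeg (rcons don a) (wnext a s c) i c' =
    \sum_(f in W | (i \in ed f) && (f \notin don)) wt (wnext a s c) f c'.
  apply: eq_bigl => f; rewrite mem_rcons inE negb_or.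
  by case: eqP => [->|]; rewrite ?(negbTE ia) //= !andbF.
rewrite e1 /wdeg -sumrB mulr_suml (bigID (adj ed a)) /=.
rewrite [X in _ + X]big1 ?addr0; last first.
  by move=> f /andP [_ /negbTE ->]; rewrite subrr.
apply: eq_big => [f|f /andP [_ ->]]; first by rewrite -!andbA.
rewrite [c' == c]eq_sym; case: eqP => _; ring.
Qed.

Lemma wdeg_next_in don i c c' : a \in W -> a \notin don -> i \in ed a -> uniq don ->
  wdeg (rcons don a) (wnext a s c) i c' =
  if c == c' then 0 else (wdeg don s i c' - wt s a c') * exp (wpick s a c').
Proof.
move=> aW ad ia _.
have -> : wdeg don s i c' - wt s a c' =
    \sum_(f in W | (i \in ed f) && (f \notin rcons don a)) wt s f c'.
  rewrite /wdeg (bigD1 a) /=; last by rewrite aW ia ad.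
  rewrite addrAC subrr add0r; apply: eq_bigl => f; rewrite mem_rcons inE negb_or.
  by rewrite -!andbA; do !bool_congr.
have hadj f : (f \in W) && ((i \in ed f) && (f \notin rcons don a)) -> adj ed a f.
  case/and3P => _ jf; rewrite mem_rcons inE negb_or => /andP [fa _].
  by apply/adjP; split; [rewrite eq_sym | exists i].
rewrite /wdeg; case: eqP => [<-|ne].
  by rewrite big1 // => f hf /=; rewrite (hadj f hf) eqxx.
rewrite mulr_suml; apply: eq_bigr => f hf /=; rewrite (hadj f hf).
by case: eqP => // e; case: ne.
Qed.

End Step.

End WeightedGreedy.

Lemma mgf_le0 (Om : finType) (mu D : Om -> R) : (forall w, 0 <= mu w) -> \sum_w mu w = 1 ->
  (forall w, 0 < mu w -> D w <= 0) -> \sum_w mu w * exp (D w) <= 1.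
Proof.
move=> mu0 mu1 h; rewrite -[X in _ <= X]mu1; apply: ler_sum => w _.
have := mu0 w; rewrite le_eqVlt => /orP [/eqP <-|hw]; first by rewrite mul0r.
by rewrite ler_piMr // -exp0 ler_exp // h.
Qed.

Lemma count_uniq_le (T : finType) (p : pred T) (s : seq T) (A : {set T}) :
  uniq s -> {subset s <= A} -> (count p s <= #|[set y in A | p y]|)%N.
Proof.
move=> us sA; rewrite -size_filter -(card_uniqP _) ?filter_uniq //.
by apply/subset_leq_card/subsetP => y; rewrite mem_filter inE => /andP [-> /sA ->].
Qed.

Section BoundedListColoring.

Variables (n Rm m : nat) (lam B : R) (X C : finType) (ed : X -> {set 'I_n})
  (W : {set X}) (L : X -> {set C}).
Hypothesis size_le : forall x, x \in W -> (#|ed x| <= Rm)%N.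
Hypothesis deg_le : forall i, (#|[set x in W | i \in ed x]| <= n)%N.
Hypothesis codeg_le : forall i j, i != j ->
  (#|[set x in W | (i \in ed x) && (j \in ed x)]| <= Rm)%N.
Hypothesis lam0 : 0 < lam.
Hypothesis list_ge : forall x, x \in W -> lam * n%:R <= #|L x|%:R.
Hypothesis cdeg_le : forall i c,
  \sum_(x in W | (i \in ed x) && (c \in L x)) (#|L x|%:R)^-1 <= 2 / 3 :> R.
Hypothesis B_def : B = exp (4 * Rm%:R) / lam.
Hypothesis n0 : (0 < n)%N.
Hypothesis m_lo : (n <= m ^ 2)%N.
Hypothesis m_hi : (m ^ 2 <= 4 * n)%N.
Hypothesis m1 : 1 <= m%:R :> R.
Hypothesis mB1 : 4000 * B ^+ 2 * Rm%:R <= m%:R.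
Hypothesis mB2 : 4800 * Rm%:R ^+ 5 * B ^+ 3 <= m%:R.
Hypothesis mB3 : 16 * B <= m%:R.
Hypothesis mB4 : 8 * Rm%:R ^+ 2 * B <= m%:R.
Hypothesis nB : 200 * B <= n%:R.
Hypothesis start : (#|X|%:R + n%:R * #|C|%:R) * exp (- (m%:R / 50)) < 1.

(** An upper bound for every weight at all times: loads stay below 4, an edge has at most [Rm]
    vertices and its list at least [lam * n] colours. *)
Let P : R := B / n%:R.
Let J : R := Rm%:R ^+ 2 * P.
(** [k1] and [k2] are the compensations per relevant step in the sense of [mgf_bound]: mean plus
    twice the second moment. *)
Let k1 : R := 10 * m%:R ^+ 2 * P ^+ 2.
Let k2 : R := 12 * m%:R ^+ 2 * J ^+ 2 * P.

Let rel i y := (i \notin ed y) && [exists f in W, (i \in ed f) && adj ed y f].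

(** The scale [m] is about the square root of [n]: single steps then move the potential by less than
    1/2, while a starting value of at most [- m / 50] beats the number of indices. Adding a fifth of
    the load to the degree lets one potential control both. Outside [W] the value is a harmless
    negative constant. *)
Let pot (th : X + 'I_n * C) (don : seq X) (s : wstate n X C) : R :=
  match th with
  | inl x => if x \in W then m%:R * (19 / 20 - wtot s x) - k1 * (count (adj ed x) don)%:R
             else - (m%:R / 20)
  | inr (i, c) => m%:R * (wdeg ed W don s i c + load s i c / 5 - 2 / 3 - 1 / 50)
             - k2 * (count (rel i) don)%:R
  end.

Let nR0 : 0 < n%:R :> R. Proof. by rewrite ltr0n. Qed.
Let B0 : 0 < B. Proof. by rewrite B_def divr_gt0 ?exp_gt0. Qed.
Let P0 : 0 < P. Proof. by rewrite divr_gt0. Qed.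
Let J0 : 0 <= J. Proof. by rewrite mulr_ge0 ?exprn_ge0 ?ler0n ?ltW. Qed.
Let m0 : 0 < m%:R :> R. Proof. exact: lt_le_trans m1. Qed.
Let mm_hi : m%:R ^+ 2 <= 4 * n%:R :> R.
Proof. by rewrite -natrX -natrM ler_nat. Qed.
Let PnE : P * n%:R = B. Proof. by rewrite divfK // lt0r_neq0. Qed.
Let P200 : P <= 1 / 200.
Proof. by rewrite ler_pdivrMr //; move: nB; lra. Qed.
Let P14 : P <= 1 / 4.
Proof. move: P200; lra. Qed.

Let nbr_card x : x \in W -> (#|[set y in W | adj ed x y]| <= Rm * n)%N.
Proof.
move=> xW; apply: (@leq_trans (#|ed x| * n)); last by rewrite leq_mul2r size_le ?orbT.
apply: (card_le_union (F := fun i => [set y in W | i \in ed y])) => [y|i _]; last exact: deg_le.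
by rewrite inE => /andP [yW /adjP [_ [i ix iy]]]; exists i => //; rewrite inE yW.
Qed.

Let rel_card i : (#|[set y in W | rel i y]| <= n * (Rm * n))%N.
Proof.
apply: (@leq_trans (#|[set x in W | i \in ed x]| * (Rm * n))); last first.
  by apply: leq_mul.
apply: (card_le_union (F := fun x => [set y in W | adj ed x y])) => [y|x].
  rewrite inE => /andP [yW /andP [_ /exists_inP [f fW /andP [fi fy]]]].
  by exists f; rewrite inE ?fW ?fi // yW adj_sym.
by rewrite inE => /andP [xW _]; exact: nbr_card.
Qed.

(** [k1] is of order [1 / n] and an edge has at most [Rm * n] neighbours, so all compensations
    together stay below a small share of [m]. In [k2_bound] the orders are [1 / n ^+ 2] and
    [n ^+ 2]. *)
Let k1_bound don x : uniq don -> {subset don <= W} -> x \in W ->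
  k1 * (count (adj ed x) don)%:R <= m%:R / 100.
Proof.
move=> ud dW xW.
have hc : (count (adj ed x) don)%:R <= Rm%:R * n%:R :> R.
  by rewrite -natrM ler_nat (leq_trans (count_uniq_le _ ud dW)) // nbr_card.
have h1 : k1 <= 40 * n%:R * P ^+ 2.
  by rewrite /k1 ler_wpM2r ?exprn_ge0 ?(ltW P0) //; move: mm_hi; lra.
have P2 : 0 <= P ^+ 2 by rewrite sqr_ge0.
apply: (@le_trans _ _ (40 * n%:R * P ^+ 2 * (Rm%:R * n%:R))).
  have k10 : 0 <= k1.
    by apply: mulr_ge0 (sqr_ge0 _); apply: mulr_ge0 (sqr_ge0 _); exact: ler0n.
  by apply: ler_pM; rewrite ?ler0n.
have -> : 40 * n%:R * P ^+ 2 * (Rm%:R * n%:R) = 40 * (P * n%:R) ^+ 2 * Rm%:R by ring.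
rewrite PnE; move: mB1; lra.
Qed.

Let k2_bound don i : uniq don -> {subset don <= W} ->
  k2 * (count (rel i) don)%:R <= m%:R / 100.
Proof.
move=> ud dW.
have hc : (count (rel i) don)%:R <= n%:R * (Rm%:R * n%:R) :> R.
  by rewrite -!natrM ler_nat (leq_trans (count_uniq_le _ ud dW)) // rel_card.
have J2 : 0 <= J ^+ 2 * P by rewrite mulr_ge0 ?sqr_ge0 ?(ltW P0).
have h1 : k2 <= 48 * n%:R * (J ^+ 2 * P).
  by rewrite /k2 -mulrA ler_wpM2r //; move: mm_hi; lra.
apply: (@le_trans _ _ (48 * n%:R * (J ^+ 2 * P) * (n%:R * (Rm%:R * n%:R)))).
  have k20 : 0 <= k2.
    apply: mulr_ge0 (ltW P0); apply: mulr_ge0 (sqr_ge0 _).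
    by apply: mulr_ge0 (sqr_ge0 _); exact: ler0n.
  by apply: ler_pM; rewrite ?ler0n.
have -> : 48 * n%:R * (J ^+ 2 * P) * (n%:R * (Rm%:R * n%:R)) =
   48 * (P * n%:R) ^+ 3 * Rm%:R ^+ 5 by rewrite /J; ring.
rewrite PnE; move: mB2; lra.
Qed.

Let inv_bounds don s : uniq don -> {subset don <= W} -> wgood ed W L don s ->
  (forall th, pot th don s < 0) ->
  [/\ forall x, x \in W -> 94 / 100 <= wtot s x,
      forall i c, wdeg ed W don s i c + load s i c / 5 <= 7 / 10 &
      forall x c, x \in W -> wt s x c <= P].
Proof.
move=> ud dW [p0 pL pb g0 _] hE.
have hT i c : wdeg ed W don s i c + load s i c / 5 <= 7 / 10.
  have := hE (inr (i, c)); rewrite /pot => h; have := k2_bound i ud dW => h'.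
  set z := wdeg _ _ _ _ _ _ + _ in h *.
  have : m%:R * (z - 2 / 3 - 1 / 50) < m%:R * (1 / 100) by lra.
  rewrite ltr_pM2l //; lra.
split=> //.
  move=> x xW; have := hE (inl x); rewrite /pot xW => h; have := k1_bound ud dW xW => h'.
  have : m%:R * (19 / 20 - wtot s x) < m%:R * (1 / 100) by lra.
  rewrite ltr_pM2l //; lra.
move=> x c xW; apply: le_trans (pb x c xW) _.
(* The degree is nonnegative, so a fifth of the load is at most 7/10. *)
have hl i c' : load s i c' <= 4.
  have : 0 <= wdeg ed W don s i c' by apply: sumr_ge0.
  move: (hT i c'); lra.
have hs : \sum_(i in ed x) load s i c <= 4 * Rm%:R.
  apply: (@le_trans _ _ (\sum_(i in ed x) 4)); first by apply: ler_sum.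
  by rewrite sumr_const -[4 *+ #|_|]mulr_natr ler_wpM2l // ler_nat size_le.
have hL : 0 < lam * n%:R by rewrite mulr_gt0.
rewrite /P B_def -mulrA -invfM; apply: ler_pM.
- exact/ltW/exp_gt0.
- by rewrite invr_ge0 ler0n.
- exact: ler_exp.
by rewrite lef_pV2 ?posrE ?list_ge // (lt_le_trans hL) ?list_ge.
Qed.

Let pick_facts don s a : uniq don -> {subset don <= W} -> wgood ed W L don s ->
  (forall th, pot th don s < 0) -> a \in W ->
  [/\ 0 < wtot s a, \sum_c wpick s a c = 1 & forall c, 0 <= wpick s a c <= 2 * P].
Proof.
move=> ud dW gs hE aW; have [hQ _ hp] := inv_bounds ud dW gs hE.
have Q0 : 0 < wtot s a by move: (hQ a aW); lra.
split=> //; first by rewrite -mulr_suml mulfV // lt0r_neq0.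
move=> c; have [p0 _ _ _ _] := gs.
rewrite divr_ge0 ?p0 ?(ltW Q0) //= ler_pdivrMr //.
have := hp a c aW; have := hQ a aW; move: P0; nra.
Qed.

Let step_tot don s a x : a \in W -> a \notin don -> uniq don -> {subset don <= W} ->
  wgood ed W L don s -> (forall th, pot th don s < 0) ->
  \sum_c wpick s a c *
    exp (pot (inl x) (rcons don a) (wnext ed a s c) - pot (inl x) don s) <= 1.
Proof.
move=> aW ad ud dW gs hE; have [Q0 pick1 pickb] := pick_facts ud dW gs hE aW.
have [hQ _ hp] := inv_bounds ud dW gs hE.
have pick0 c : 0 <= wpick s a c by case/andP: (pickb c).
rewrite /pot; case: ifP => [xW|_]; last first.
  by apply: mgf_le0 => // c _; rewrite subrr.
have [p0 _ _ _ _] := gs.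
case: (boolP (adj ed a x)) => [ax|nax]; last first.
  apply: mgf_le0 => // c _; rewrite -cats1 count_cat /= addn0 [adj ed x a]adj_sym (negbTE nax) addn0.
  by rewrite /wtot /= (negbTE nax) subrr.
have hpx c : 0 <= wt s x c <= P by rewrite p0 hp.
pose D c := - (m%:R * (wtot (wnext ed a s c) x - wtot s x)).
have -> : \sum_c wpick s a c *
   exp (m%:R * (19 / 20 - wtot (wnext ed a s c) x) - k1 * (count (adj ed x) (rcons don a))%:R -
   (m%:R * (19 / 20 - wtot s x) - k1 * (count (adj ed x) don)%:R)) =
   \sum_c wpick s a c * exp (D c - (2 * m%:R ^+ 2 * P ^+ 2 + 2 * (4 * m%:R ^+ 2 * P ^+ 2))).
  apply: eq_bigr => c _; congr (_ * exp _).
  rewrite -cats1 count_cat /= addn0 [adj ed x a]adj_sym ax natrD /D /k1 /=; ring.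
have m2P : m%:R * (2 * P) <= 1 / 2.
  have : m%:R * (4 * P) <= 1; last lra.
  rewrite /P !mulrA ler_pdivrMr // mul1r.
  have : m%:R * (16 * B) <= m%:R ^+ 2 by rewrite expr2 ler_pM2l.
  move: mm_hi; lra.
have hd c := wtot_diff pick1 pickb P14 c ax hpx.
apply: mgf_bound => //.
- move=> c _; apply: le_trans m2P; rewrite /D -mulrN ler_pM2l //.
  by apply: le_trans (hd c); rewrite lerNl; case/ler_normlP: (lexx `|wtot (wnext ed a s c) x - wtot s x|); lra.
- have -> : \sum_c wpick s a c * D c = - (m%:R * (\sum_c wpick s a c * wtot (wnext ed a s c) x - wtot s x)).
    have e : wtot s x = \sum_c wpick s a c * wtot s x by rewrite -mulr_suml pick1 mul1r.
    rewrite [X in _ - X]e -sumrB mulr_sumr -sumrN.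
    by apply: eq_bigr => c _; rewrite /D; ring.
  have h := wtot_mean pick1 pickb P14 ax hpx.
  have : m%:R * (2 * P ^+ 2) <= 2 * m%:R ^+ 2 * P ^+ 2.
    have -> : 2 * m%:R ^+ 2 * P ^+ 2 = m%:R * (2 * P ^+ 2) * m%:R by ring.
    apply: ler_peMr => //; apply: mulr_ge0; first exact: ler0n.
    by apply: mulr_ge0 (sqr_ge0 _); exact: ler0n.
  apply: le_trans; rewrite -mulrN ler_pM2l //; lra.
- have e (z : R) : z = \sum_c wpick s a c * z by rewrite -mulr_suml pick1 mul1r.
  rewrite [X in _ <= X]e; apply: ler_sum => c _.
  rewrite ler_wpM2l // /D sqrrN exprMn -mulrA [4 * _]mulrCA ler_wpM2l ?sqr_ge0 //.
  rewrite -real_normK ?num_real //.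
  have -> : 4 * P ^+ 2 = (2 * P) ^+ 2 by ring.
  apply: lerXn2r; rewrite ?nnegrE ?normr_ge0 ?hd //.
  by apply: mulr_ge0 (ltW P0); exact: ler0n.
Qed.

Let step_deg don s a i c' : a \in W -> a \notin don -> uniq don -> {subset don <= W} ->
  wgood ed W L don s -> (forall th, pot th don s < 0) ->
  \sum_c wpick s a c *
    exp (pot (inr (i, c')) (rcons don a) (wnext ed a s c) - pot (inr (i, c')) don s) <= 1.
Proof.
move=> aW ad ud dW gs hE; have [Q0 pick1 pickb] := pick_facts ud dW gs hE aW.
have [hQ hT hp] := inv_bounds ud dW gs hE.
have pick0 c : 0 <= wpick s a c by case/andP: (pickb c).
have [p0 _ _ g0 _] := gs.
have pih c : wpick s a c <= 1 / 2 by have /andP [_ h] := pickb c; move: P14 h; lra.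
have /andP [es0 es1] : 0 <= exp (wpick s a c') - 1 <= 2 * wpick s a c'.
  by apply: exp_sub1; rewrite pick0 pih.
case: (boolP (i \in ed a)) => [ia|nia].
  apply: mgf_le0 => // c _.
  have -> : pot (inr (i, c')) (rcons don a) (wnext ed a s c) - pot (inr (i, c')) don s =
     m%:R * (wdeg ed W (rcons don a) (wnext ed a s c) i c' + wpick s a c' / 5 - wdeg ed W don s i c').
    have ra : rel i a = false by rewrite /rel ia.
    rewrite /pot -cats1 count_cat /= ra ia !addn0; ring.
  rewrite pmulr_rle0 // wdeg_next_in //.
  set w := wdeg _ _ _ _ _ _; set q := wpick s a c' in es0 es1 *.
  have hw : w <= 7 / 10 by have := hT i c'; rewrite -/w; have := g0 i c'; lra.
  have q0 : 0 <= q := pick0 c'.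
  have ea : wt s a c' = q * wtot s a by rewrite /q /wpick divfK // lt0r_neq0.
  have hwa : wt s a c' <= w.
    rewrite /w /wdeg (bigD1 a) /=; last by rewrite aW ia ad.
    by rewrite lerDl sumr_ge0.
  (* Colouring [a] takes its weight, at least [94/100 * q], away from the degree at [i], while the
     scaling of the rest adds only about [7/10 * q]. The difference exceeds [q / 5], the growth of
     the load term. *)
  have hqa : 94 / 100 * q <= wt s a c' by rewrite ea mulrC ler_wpM2l // hQ.
  have qs : q <= 1 / 100.
    by have /andP [_] := pickb c'; rewrite -/q; move: P200; lra.
  case: ifP => _; first by lra.
  have h1 : (w - wt s a c') * exp q <= (w - wt s a c') * (1 + q + 2 * q ^+ 2).
    by rewrite ler_wpM2l ?subr_ge0 //; apply: exp_quad; lra.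
  have h2 : 2 * q ^+ 2 <= q / 50 by rewrite expr2; nra.
  have h3 : (w - wt s a c') * (1 + q + 2 * q ^+ 2) <= (w - wt s a c') * (1 + q + q / 50).
    by rewrite ler_wpM2l ?subr_ge0 // lerD2l.
  nra.
rewrite /pot; pose sA := \sum_(f in W | [&& i \in ed f, f \notin don & adj ed a f]) wt s f c'.
have sA0 : 0 <= sA by apply: sumr_ge0.
(* An edge through [i] that meets [a] passes through [i] and one of at most [Rm] vertices of [a];
   each such pair of vertices lies in at most [Rm] edges, each of weight at most [P]. *)
have sAJ : sA <= J.
  rewrite /sA; apply: (@le_trans _ _ (\sum_(f in [set f in W | (i \in ed f) && adj ed a f]) P)).
    rewrite [X in _ <= X](eq_bigl (fun f => (f \in W) && ((i \in ed f) && adj ed a f))); last first.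
      by move=> f; rewrite inE.
    rewrite [X in _ <= X](bigID (fun f => f \in don)) /= addrC.
    rewrite [X in X + _](eq_bigl (fun f => (f \in W) && [&& i \in ed f, f \notin don & adj ed a f])).
      apply: ler_wpDr; first by apply: sumr_ge0 => f _; exact: ltW.
      by apply: ler_sum => f /andP [fW _]; exact: hp.
    by move=> f; rewrite -!andbA; do !bool_congr; rewrite andbC.
  rewrite sumr_const -[P *+ _]mulr_natl /J ler_wpM2r ?(ltW P0) // -natrX ler_nat.
  apply: (@leq_trans (#|ed a| * Rm)); last by rewrite expnS expn1 leq_mul // size_le.
  apply: (card_le_union (F := fun j => [set f in W | (i \in ed f) && (j \in ed f)])) => [f|j ja].
    rewrite inE => /and3P [fW fi /adjP [_ [j ja jf]]].
    by exists j => //; rewrite inE fW fi.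
  by apply: codeg_le; apply: contraNneq nia => ->.
have eW c : wdeg ed W (rcons don a) (wnext ed a s c) i c' =
   wdeg ed W don s i c' + sA * (if c == c' then -1 else exp (wpick s a c') - 1).
  by apply/eqP; rewrite addrC -subr_eq; apply/eqP; exact: wdeg_next_out.
case: (boolP (rel i a)) => [ra|nra]; last first.
  have sA00 : sA = 0.
    rewrite /sA big1 // => f /and4P [fW fi _ af]; case/negP: nra.
    by rewrite /rel nia; apply/exists_inP; exists f => //; rewrite fi af.
  apply: mgf_le0 => // c _; rewrite eW sA00 mul0r addr0 /= (negbTE nia) addr0.
  by rewrite -cats1 count_cat /= (negbTE nra) !addn0 subrr.
pose D c := m%:R * sA * (if c == c' then -1 else exp (wpick s a c') - 1).
have k2E : k2 = 0 + 2 * (6 * m%:R ^+ 2 * J ^+ 2 * P) by rewrite /k2; ring.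
have -> : \sum_c wpick s a c *
   exp (m%:R * (wdeg ed W (rcons don a) (wnext ed a s c) i c' +
       load (wnext ed a s c) i c' / 5 - 2 / 3 - 1 / 50) - k2 * (count (rel i) (rcons don a))%:R -
   (m%:R * (wdeg ed W don s i c' + load s i c' / 5 - 2 / 3 - 1 / 50) - k2 * (count (rel i) don)%:R)) =
   \sum_c wpick s a c * exp (D c - (0 + 2 * (6 * m%:R ^+ 2 * J ^+ 2 * P))).
  apply: eq_bigr => c _; congr (_ * exp _).
  rewrite -k2E eW -cats1 count_cat /= addn0 ra natrD (negbTE nia) /D /=; ring.
have mJ : m%:R * J <= 1 / 2.
  have -> : m%:R * J = (m%:R * (Rm%:R ^+ 2 * B)) / n%:R by rewrite /J /P; ring.
  rewrite ler_pdivrMr //.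
  have : m%:R * (8 * Rm%:R ^+ 2 * B) <= m%:R ^+ 2 by rewrite expr2 ler_pM2l.
  move: mm_hi; lra.
have msA : 0 <= m%:R * sA <= 1 / 2.
  by rewrite mulr_ge0 ?ler0n //= (le_trans _ mJ) // ler_pM2l.
have msA2 : (m%:R * sA) ^+ 2 <= m%:R ^+ 2 * J ^+ 2.
  by rewrite exprMn ler_wpM2l ?sqr_ge0 //; apply: lerXn2r; rewrite ?nnegrE.
have q0 := pick0 c'; have qh := pih c'; have /andP [_ q2] := pickb c'.
set q := wpick s a c' in es0 es1 q0 qh q2 D *.
have hsum2 (z : R) : \sum_c wpick s a c * (if c == c' then -1 else z) = - q + (1 - q) * z.
  by rewrite sum_if_eq // mulrN1.
apply: mgf_bound => //.
- move=> c _; rewrite /D; case: ifP => _; move: msA => /andP [h1 h2]; nra.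
- have -> : \sum_c wpick s a c * D c =
     m%:R * sA * (\sum_c wpick s a c * (if c == c' then -1 else exp q - 1)).
    by rewrite mulr_sumr; apply: eq_bigr => c _; rewrite /D mulrCA.
  (* The mean change is proportional to [(1 - q) * exp q - 1], which is not positive. *)
  rewrite hsum2; have := exp_mul1B_le q; case/andP: msA => h1 _ h2.
  by rewrite mulr_ge0_le0 //; lra.
have -> : \sum_c wpick s a c * D c ^+ 2 =
   (m%:R * sA) ^+ 2 * (\sum_c wpick s a c * (if c == c' then 1 else (exp q - 1) ^+ 2)).
  rewrite mulr_sumr; apply: eq_bigr => c _; rewrite /D exprMn mulrCA; congr (_ * (_ * _)).
  by case: ifP => _; rewrite ?sqrrN ?expr1n.
rewrite sum_if_eq // mulr1.
have hz : q + (1 - q) * (exp q - 1) ^+ 2 <= 6 * P.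
  have h4 : (exp q - 1) ^+ 2 <= (2 * q) ^+ 2.
    by apply: lerXn2r; rewrite ?nnegrE // mulr_ge0.
  have h5 : (2 * q) ^+ 2 <= 2 * q.
    have h : 0 <= q * (1 - 2 * q) by rewrite mulr_ge0 //; lra.
    have -> : (2 * q) ^+ 2 = 2 * q - 2 * (q * (1 - 2 * q)) by ring.
    lra.
  have h6 : (1 - q) * (exp q - 1) ^+ 2 <= (exp q - 1) ^+ 2 by rewrite ler_piMl ?sqr_ge0 //; lra.
  lra.
have -> : 6 * m%:R ^+ 2 * J ^+ 2 * P = (m%:R ^+ 2 * J ^+ 2) * (6 * P) by ring.
apply: ler_pM => //; first exact: sqr_ge0.
rewrite -/q; apply: addr_ge0 => //; apply: mulr_ge0 (sqr_ge0 _); lra.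
Qed.

Lemma bounded_list_coloring_aux : exists phi : X -> option C,
  (forall x, x \in W -> exists2 c, c \in L x & phi x = Some c) /\
  (forall x y, x \in W -> y \in W -> adj ed x y -> phi x <> phi y).
Proof.
have [||don a rest s exs gs hE|s [_ _ _ _ [h1 h2]] _] :=
  @potential_run (wstate n X C) X C (X + 'I_n * C)%type (enum W) (wgood ed W L) pot
     (fun don a s => wpick s a) (fun a s c => wnext ed a s c) (winit n L).
- exact: wgood_init.
- apply: le_lt_trans start.
  have -> : (#|X|%:R + n%:R * #|C|%:R) * exp (- (m%:R / 50)) =
     \sum_(th : X + 'I_n * C) exp (- (m%:R / 50)).
    rewrite sumr_const -[RHS]mulr_natl; congr (_ * _).
    by rewrite card_sum card_prod card_ord natrD natrM.
  apply: ler_sum => th _; apply: ler_exp; case: th => [x|[i c]] /=.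
    case: ifP => [xW|_]; last by move: m0; lra.
    have hL : 0 < #|L x|%:R :> R by apply: lt_le_trans (list_ge xW); rewrite mulr_gt0.
    have -> : wtot (winit n L) x = 1.
      rewrite /wtot /= -big_mkcond /= sumr_const -[LHS]mulr_natr mulVf //.
      exact: lt0r_neq0.
    move: m0; lra.
  have h : wdeg ed W [::] (winit n L) i c <= 2 / 3.
    apply: le_trans (cdeg_le i c); rewrite /wdeg /= -big_mkcondr /=.
    by rewrite le_eqVlt; apply/orP; left; apply/eqP/eq_bigl => x; rewrite andbT andbA.
  have -> : m%:R * (wdeg ed W [::] (winit n L) i c + load (winit n L) i c / 5 - 2 / 3 - 1 / 50) - k2 * 0 =
     m%:R * (wdeg ed W [::] (winit n L) i c - 2 / 3) - m%:R / 50 by rewrite /=; field.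
  by rewrite lerBlDr addNr pmulr_rle0 // subr_le0.
- have us : uniq (don ++ a :: rest) by rewrite -exs enum_uniq.
  have dW : {subset don <= W}.
    by move=> x xd; rewrite -mem_enum exs mem_cat xd.
  have aW : a \in W by rewrite -mem_enum exs mem_cat inE eqxx orbT.
  move: us; rewrite cat_uniq /= negb_or => /and3P [ud /andP [ad _] _].
  have [Q0 pick1 pickb] := pick_facts ud dW gs hE aW.
  split=> //.
  + by move=> c; case/andP: (pickb c).
  + by move=> c; exact: wgood_next.
  case=> [x|[i c']]; [exact: step_tot | exact: step_deg].
exists (wcol s); split=> [x xW|x y xW yW]; first by apply: h1; rewrite mem_enum.
by apply: h2; rewrite mem_enum.
Qed.

End BoundedListColoring.

(** The sum in the last hypothesis is the expected number of edges at [i] drawing [c] under uniform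
    choice. It has to start far enough below 1 that the fifth of the load and the fluctuations still
    fit. *)
Lemma bounded_list_coloring (Rm : nat) (lam : R) : 0 < lam ->
  exists N : nat, forall (n : nat) (X C : finType) (ed : X -> {set 'I_n})
    (W : {set X}) (L : X -> {set C}), (N <= n)%N ->
  (#|X| <= n * n)%N -> (#|C| <= Rm * n)%N ->
  (forall x, x \in W -> (#|ed x| <= Rm)%N) ->
  (forall i, (#|[set x in W | i \in ed x]| <= n)%N) ->
  (forall i j, i != j -> (#|[set x in W | (i \in ed x) && (j \in ed x)]| <= Rm)%N) ->
  (forall x, x \in W -> lam * n%:R <= #|L x|%:R) ->
  (forall i c, \sum_(x in W | (i \in ed x) && (c \in L x)) (#|L x|%:R)^-1 <= 2 / 3 :> R) ->
  exists phi : X -> option C,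
    (forall x, x \in W -> exists2 c, c \in L x & phi x = Some c) /\
    (forall x y, x \in W -> y \in W -> adj ed x y -> phi x <> phi y).
Proof.
move=> lam0; set B := exp (4 * Rm%:R) / lam.
set M := 4000 * B ^+ 2 * Rm%:R + 4800 * Rm%:R ^+ 5 * B ^+ 3 + 16 * B + 8 * Rm%:R ^+ 2 * B + 1.
have B0 : 0 < B by rewrite divr_gt0 ?exp_gt0.
have [N1 h1] := nat_ge (M ^+ 2); have [N2 h2] := nat_ge (200 * B).
have [N3 h3] := @exp_beats_poly (1 / 50) 3 ltac:(lra).
exists (N1 + N2 + N3 + Rm + 2)%N => n X C ed W L hn hX hC g1 g2 g3 g4 g5.
have [n0 n1 n2 n3 n4] : [/\ (0 < n)%N, (N1 <= n)%N, (N2 <= n)%N, (N3 <= n)%N & (1 + Rm <= n)%N].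
  by clear -hn; split; lia.
have [m m_lo m_hi] := sqrt_nat n0.
have mr : n%:R <= m%:R ^+ 2 :> R by rewrite -natrX ler_nat.
have t1 : 0 <= 4000 * B ^+ 2 * Rm%:R 
  by apply: mulr_ge0 (ler0n _ _); apply: mulr_ge0 (sqr_ge0 _); exact: ler0n.
have t2 : 0 <= 4800 * Rm%:R ^+ 5 * B ^+ 3.
  by apply: mulr_ge0 (exprn_ge0 _ (ltW B0)); apply: mulr_ge0; rewrite ?exprn_ge0 ?ler0n.
have t3 : 0 <= 8 * Rm%:R ^+ 2 * B 
  by apply: mulr_ge0 (ltW B0); apply: mulr_ge0 (sqr_ge0 _); exact: ler0n.
have mM : M <= m%:R.
  have hM : M ^+ 2 <= m%:R ^+ 2 by apply: le_trans mr; apply: h1.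
  rewrite -(@ler_pXn2r _ 2) ?nnegrE //; move: t1 t2 t3 B0; rewrite /M; move: (4000 * B ^+ 2 * _) (4800 * _ * B ^+ 3) (8 * _ * B) => x1 x2 x3; clear => *; lra.
have st : (#|X|%:R + n%:R * #|C|%:R) * exp (- (m%:R / 50)) < 1.
  have hm : n%:R ^+ 3 * exp (- (1 / 50 * m%:R)) < 1 by apply: h3.
  apply: le_lt_trans hm.
  have -> : m%:R / 50 = 1 / 50 * m%:R :> R by ring.
  rewrite ler_wpM2r ?(ltW (exp_gt0 _)) // -natrX -natrM -natrD ler_nat.
  have : (#|X| + n * #|C| <= n * n + n * (Rm * n))%N by apply: leq_add => //; apply: leq_mul.
  move=> h; apply: (leq_trans h).
  have -> : (n ^ 3 = n * n * n)%N by rewrite !expnS expn0 muln1 mulnA.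
  have -> : (n * n + n * (Rm * n) = n * n * (1 + Rm))%N by ring.
  by rewrite leq_mul2l n4 orbT.
have [b1 b2 b3 b4 b5] : [/\ 1 <= m%:R :> R, 4000 * B ^+ 2 * Rm%:R <= m%:R,
    4800 * Rm%:R ^+ 5 * B ^+ 3 <= m%:R, 16 * B <= m%:R & 8 * Rm%:R ^+ 2 * B <= m%:R].
  by move: mM t1 t2 t3 B0; rewrite /M; move: (4000 * B ^+ 2 * _) (4800 * _ * B ^+ 3) (8 * _ * B) => x1 x2 x3; clear => *; split; lra.
apply: (@bounded_list_coloring_aux n Rm m lam B X C ed W L) => //.
by apply: h2.
Qed.

(** * Random precolouring of a window *)

(* Chernoff bounds for monotone counters along a derandomised process: upper
   counters stay below twice their mean, lower counters above half of it. *)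
Lemma counter_run (S A : Type) (Om U V : finType) (xs : seq A)
    (good : seq A -> S -> Prop) (mu : seq A -> A -> S -> Om -> R) (nxt : A -> S -> Om -> S)
    (s0 : S) (d : R) (fU : U -> S -> R) (bU : U -> R) (pU : U -> A -> R)
    (fV : V -> S -> R) (bV : V -> R) (pV : V -> A -> R) :
  good [::] s0 -> (#|U|%:R + #|V|%:R) * exp (- d) < 1 ->
  (forall u, 0 < bU u) -> (forall v, 0 < bV v) ->
  (forall don a rest s, xs = don ++ a :: rest -> good don s ->
     (forall u, fU u s <= fU u s0 + 2 * (\sum_(x <- don) pU u x) + 2 * bU u * d) ->
     (forall v, fV v s0 + (\sum_(x <- don) pV v x) / 2 - 4 * bV v * d <= fV v s) ->
     [/\ forall w, 0 <= mu don a s w, \sum_w mu don a s w = 1,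
         forall w, 0 < mu don a s w -> good (rcons don a) (nxt a s w),
         (forall u, (forall w, 0 < mu don a s w -> 0 <= fU u (nxt a s w) - fU u s <= bU u) /\
           \sum_w mu don a s w * (fU u (nxt a s w) - fU u s) <= pU u a) &
         (forall v, (forall w, 0 < mu don a s w -> 0 <= fV v (nxt a s w) - fV v s <= bV v) /\
           pV v a <= \sum_w mu don a s w * (fV v (nxt a s w) - fV v s))]) ->
  exists s, [/\ good xs s,
     forall u, fU u s <= fU u s0 + 2 * (\sum_(x <- xs) pU u x) + 2 * bU u * d &
     forall v, fV v s0 + (\sum_(x <- xs) pV v x) / 2 - 4 * bV v * d <= fV v s].
Proof.
move=> g0 hd bU0 bV0 step.
pose E (th : U + V) (don : seq A) (s : S) : R := match th with
  | inl u => (fU u s - fU u s0) / (2 * bU u) - (\sum_(x <- don) pU u x) / bU u - d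
  | inr v => (\sum_(x <- don) pV v x) / (8 * bV v) - (fV v s - fV v s0) / (4 * bV v) - d end.
have EU u don s : E (inl u) don s < 0 ->
    fU u s <= fU u s0 + 2 * (\sum_(x <- don) pU u x) + 2 * bU u * d.
  rewrite /E; set x := fU u s - _; set y := \sum_(x <- don) _ => h.
  have b0 := bU0 u; have b2 : 0 < 2 * bU u by lra.
  have : (x / (2 * bU u) - y / bU u - d) * (2 * bU u) < 0 by rewrite pmulr_llt0.
  have -> : (x / (2 * bU u) - y / bU u - d) * (2 * bU u) = x - 2 * y - 2 * bU u * d.
    by field; rewrite lt0r_neq0.
  rewrite /x; lra.
have EV v don s : E (inr v) don s < 0 ->
    fV v s0 + (\sum_(x <- don) pV v x) / 2 - 4 * bV v * d <= fV v s.
  rewrite /E; set x := fV v s - _; set y := \sum_(x <- don) _ => h.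
  have b0 := bV0 v; have b2 : 0 < 4 * bV v by lra.
  have : (y / (8 * bV v) - x / (4 * bV v) - d) * (4 * bV v) < 0 by rewrite pmulr_llt0.
  have -> : (y / (8 * bV v) - x / (4 * bV v) - d) * (4 * bV v) = y / 2 - x - 4 * bV v * d.
    by field; rewrite lt0r_neq0.
  rewrite /x; lra.
have [||don a rest s exs gs hE|s gs hE] :=
  @potential_run S A Om (U + V)%type xs good E mu nxt s0.
- exact: g0.
- apply: le_lt_trans hd.
  have -> : (#|U|%:R + #|V|%:R) * exp (- d) = \sum_(th : U + V) exp (- d).
    by rewrite sumr_const -[RHS]mulr_natl card_sum natrD.
  apply: ler_sum => th _; apply: ler_exp; case: th => u; rewrite /E big_nil subrr !mul0r; lra.
- have [||m0 m1 mg mU mV] := step don a rest s exs gs.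
  + by move=> u; exact: EU.
  + by move=> v; exact: EV.
  split=> // -[u|v].
  + have [h1 h2] := mU u; have := mgf_up m0 m1 (bU0 u) h1 h2.
    congr (_ <= _); apply: eq_bigr => w _; congr (_ * exp _).
    rewrite /E -cats1 big_cat /= big_seq1; field; exact/lt0r_neq0.
  + have [h1 h2] := mV v; have := mgf_lo m0 m1 (bV0 v) h1 h2.
    congr (_ <= _); apply: eq_bigr => w _; congr (_ * exp _).
    rewrite /E -cats1 big_cat /= big_seq1; field; exact/lt0r_neq0.
exists s; split=> // [u|v]; [exact: EU (hE _) | exact: EV (hE _)].
Qed.

Lemma sum_option (C : finType) (F : option C -> R) : \sum_w F w = F None + \sum_c F (Some c).
Proof.
rewrite (bigD1 None) //=; congr (_ + _).
rewrite (eq_bigl (fun w => w \in [set Some c | c in [set: C]])).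
  by rewrite big_imset /=; [apply: eq_bigl => c; rewrite inE | move=> x y _ _ []].
case=> [c|]; rewrite ?eqxx /=; last by apply/esym/imsetP; case.
by apply/esym/imsetP; exists c.
Qed.

Section Activation.

Variables (X C : finType) (e : rel X) (W : {set X}) (L : X -> {set C}).
Hypothesis e_sym : symmetric e.
Hypothesis e_irr : irreflexive e.

Definition nb v : {set X} := [set w in W | e v w].
Definition cs (phi : X -> option C) v : {set C} := [set c | [exists w in nb v, phi w == Some c]].
Definition dm (phi : X -> option C) (Z : {set X}) : {set X} := [set x in Z | phi x != None].
Definition upd (phi : X -> option C) a c : X -> option C := fun y => if y == a then Some c else phi y.

Definition pick (al : R) (a : X) (w : option C) : R :=
  match w with None => 1 - al | Some c => if c \in L a then al / #|L a|%:R else 0 end.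
(** A conflicting colour is discarded and not redrawn, so the law of the draw does not depend on the
    colouring built so far. *)
Definition pnext (a : X) (phi : X -> option C) (w : option C) : X -> option C :=
  match w with
  | None => phi
  | Some c => if (phi a == None) && (c \notin cs phi a) then upd phi a c else phi end.

Definition pproper (phi : X -> option C) : Prop :=
  (forall x c, phi x = Some c -> x \in W /\ c \in L x) /\
  (forall x y, e x y -> phi x <> None -> phi x <> phi y).

Definition pgood (base : X -> option C) (don : seq X) (phi : X -> option C) : Prop :=
  [/\ forall x c, base x = Some c -> phi x = Some c,
      forall x, base x = None -> x \notin don -> phi x = None & pproper phi].

Lemma csP phi v c : reflect (exists2 w, w \in nb v & phi w = Some c) (c \in cs phi v).
Proof.
rewrite inE; apply: (iffP exists_inP) => [[w h /eqP h']|[w h h']]; exists w => //.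
exact/eqP.
Qed.

Lemma card_cs phi v : (#|cs phi v| <= #|dm phi (nb v)|)%N.
Proof.
apply: (@leq_trans #|phi @: dm phi (nb v)|); last exact: leq_imset_card.
have sinj : injective (@Some C) by move=> x y [].
rewrite -(card_imset (cs phi v) sinj); apply/subset_leq_card/subsetP => z.
case/imsetP => c /csP [w wv pw] ->; apply/imsetP; exists w => //.
by rewrite inE wv pw.
Qed.

Lemma pnext_good al base don a phi w : a \in W -> a \notin don -> pgood base don phi ->
  0 < pick al a w -> pgood base (rcons don a) (pnext a phi w).
Proof.
move=> aW ad [h1 h2 [h3 h4]]; case: w => [c|] /=; last first.
  by move=> _; split=> // x bx; rewrite mem_rcons inE negb_or => /andP [_]; exact: h2.
case: ifP => cL; rewrite ?ltxx // => _.
case: ifP => [/andP [/eqP pa hc]|_]; last first.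
  by split=> // x bx; rewrite mem_rcons inE negb_or => /andP [_]; exact: h2.
split.
- move=> x c' bx; rewrite /upd; case: eqP => [ex|_]; last exact: h1.
  by move: (h1 _ _ bx); rewrite ex pa.
- move=> x bx; rewrite mem_rcons inE negb_or /upd => /andP [/negbTE -> ]; exact: h2.
split=> [x c'|x y exy].
  by rewrite /upd; case: eqP => [-> [<-]|_]; [split | exact: h3].
rewrite /upd; case: (x =P a) => [ex|nx]; case: (y =P a) => [ey|ny].
- by move: exy; rewrite ex ey e_irr.
- move=> _ py; case/negP: hc; apply/csP; exists y; last by [].
  rewrite inE -{1}ex exy andbT; exact: (h3 _ _ (esym py)).1.
- move=> _ px; case/negP: hc; apply/csP; exists x; last by [].
  rewrite inE e_sym -{1}ey exy andbT; exact: (h3 _ _ px).1.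
exact: h4.
Qed.

Lemma pick_ge0 al a w : 0 <= al <= 1 -> 0 <= pick al a w.
Proof.
case: w => [c|] /= /andP [h1 h2]; last by rewrite subr_ge0.
by case: ifP => // _; rewrite divr_ge0 // ler0n.
Qed.

Lemma pick_mean al a (F : option C -> R) : F None = 0 ->
  \sum_w pick al a w * F w = \sum_(c in L a) al / #|L a|%:R * F (Some c).
Proof.
move=> h; rewrite sum_option h mulr0 add0r [RHS]big_mkcond /=.
by apply: eq_bigr => c _; case: ifP => _; rewrite ?mul0r.
Qed.

Lemma pick_sum al a : (0 < #|L a|)%N -> \sum_w pick al a w = 1.
Proof.
move=> h; rewrite sum_option /= -big_mkcond /= sumr_const -[_ *+ #|_|]mulr_natr divfK ?subrK //.
by rewrite pnatr_eq0 -lt0n.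
Qed.

Lemma cs_upd phi a c v : a \in W -> phi a = None ->
  cs (upd phi a c) v = if e v a then c |: cs phi v else cs phi v.
Proof.
move=> aW pa; apply/setP => c'; apply/csP/idP => [[w]|].
  rewrite /upd inE => /andP [wW vw]; case: eqP => [ew [<-]|_ pw].
    by rewrite -ew vw !inE eqxx.
  have h : c' \in cs phi v by apply/csP; exists w => //; rewrite inE wW.
  by case: ifP => _ //; rewrite inE h orbT.
case: ifP => [va|nva].
  rewrite inE => /orP [/set1P ->|/csP [w wv pw]].
    by exists a; rewrite ?inE ?aW // /upd eqxx.
  by exists w => //; rewrite /upd; case: eqP pw => // ->; rewrite pa.
case/csP => w wv pw; exists w => //.
by rewrite /upd; case: eqP pw => // ->; rewrite pa.
Qed.

Lemma dm_upd phi a c Z : phi a = None ->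
  #|dm (upd phi a c) Z| = (#|dm phi Z| + (a \in Z))%N.
Proof.
move=> pa; case: (boolP (a \in Z)) => aZ.
  have -> : dm (upd phi a c) Z = a |: dm phi Z.
    by apply/setP => x; rewrite !inE /upd; case: (x =P a) => [->|] //=; rewrite aZ.
  by rewrite cardsU1 inE pa eqxx andbF addnC.
rewrite addn0; apply: eq_card => x; rewrite !inE /upd; case: (x =P a) => // ->.
by rewrite (negbTE aZ).
Qed.

Section OneStep.
Variables (al : R) (a : X) (phi : X -> option C).
Hypotheses (al01 : 0 <= al <= 1) (aW : a \in W) (La : (0 < #|L a|)%N) (pa : phi a = None).

Let al0 : 0 <= al. Proof. by case/andP: al01. Qed.
Let La0 : 0 < #|L a|%:R :> R. Proof. by rewrite ltr0n. Qed.

Lemma mean_le (F : option C -> R) (p : C -> R) : F None = 0 ->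
  (forall c, c \in L a -> F (Some c) <= p c) ->
  \sum_w pick al a w * F w <= al / #|L a|%:R * \sum_(c in L a) p c.
Proof.
move=> h1 h2; rewrite pick_mean // mulr_sumr; apply: ler_sum => c cL.
by rewrite ler_wpM2l ?h2 // divr_ge0 // ltW.
Qed.

Lemma mean_ge (F : option C -> R) (p : C -> R) : F None = 0 ->
  (forall c, c \in L a -> p c <= F (Some c)) ->
  al / #|L a|%:R * \sum_(c in L a) p c <= \sum_w pick al a w * F w.
Proof.
move=> h1 h2; rewrite pick_mean // mulr_sumr; apply: ler_sum => c cL.
by rewrite ler_wpM2l ?h2 // divr_ge0 // ltW.
Qed.

Lemma dm_step Z :
  (forall w, (0 : R) <= #|dm (pnext a phi w) Z|%:R - #|dm phi Z|%:R <= (1 : R)) /\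
  \sum_w pick al a w * (#|dm (pnext a phi w) Z|%:R - #|dm phi Z|%:R) <= al * (a \in Z)%:R.
Proof.
have h c : (0 : R) <= #|dm (pnext a phi (Some c)) Z|%:R - #|dm phi Z|%:R <= ((a \in Z)%:R : R).
  rewrite /=; case: ifP => _; last by rewrite subrr lexx ler0n.
  by rewrite dm_upd // natrD addrAC subrr add0r lexx ler0n.
split.
  case=> [c|] /=; last by rewrite subrr lexx ler01.
  have /andP [h1 h2] := h c; apply/andP; split=> //; apply: le_trans h2 _.
  by case: (a \in Z); rewrite ?lexx ?ler01.
apply: le_trans (mean_le (p := fun _ => (a \in Z)%:R) _ _) _; rewrite ?subrr //.
  by move=> c _; case/andP: (h c).
have -> : \sum_(c in L a) ((a \in Z)%:R : R) = #|L a|%:R * (a \in Z)%:R by rewrite sumr_const mulr_natl.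
by rewrite mulrA divfK ?lt0r_neq0.
Qed.

(** A new common colour arises in two ways: [a] is a neighbour of both, with probability at most
    [al], or [a] is a neighbour of one and happens to draw a colour seen by the other, with
    probability at most [be]. *)
Lemma meet_step v f (be : R) : (forall x, x \in [set v; f] -> al * #|cs phi x|%:R <= be * #|L a|%:R) ->
  0 <= be ->
  (forall w, (0 : R) <= #|cs (pnext a phi w) v :&: cs (pnext a phi w) f|%:R
                - #|cs phi v :&: cs phi f|%:R <= (1 : R)) /\
  \sum_w pick al a w * (#|cs (pnext a phi w) v :&: cs (pnext a phi w) f|%:R
                - #|cs phi v :&: cs phi f|%:R) <=
    al * (a \in nb v :&: nb f)%:R + be * (a \in nb v :|: nb f)%:R.
Proof.
move=> hb be0.
pose p c : R := if e v a && e f a then 1 else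
   (e v a && (c \in cs phi f))%:R + (e f a && (c \in cs phi v))%:R.
have le1 (A B : {set C}) c : (#|A :&: B| <= #|(c |: A) :&: (c |: B)|)%N /\
    (#|(c |: A) :&: (c |: B)| <= #|A :&: B| + 1)%N.
  rewrite -setUIr; split; first by apply/subset_leq_card/subsetUr.
  by rewrite cardsU1 addnC leq_add2l leq_b1.
have le2 (A B : {set C}) c : (#|A :&: B| <= #|(c |: A) :&: B|)%N /\
    (#|(c |: A) :&: B| <= #|A :&: B| + (c \in B))%N.
  rewrite setIUl; split; first by apply/subset_leq_card/subsetUr.
  apply: leq_trans (leq_card_setU _ _).1 _; rewrite addnC leq_add2l.
  case: (boolP (c \in B)) => cB; first by rewrite (leq_trans (subset_leq_card (subsetIl _ _))) ?cards1.
  by rewrite leqn0 cards_eq0; apply/eqP/setP => z; rewrite !inE; apply/andP => [[/eqP ->]]; exact/negP.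
have h c : (0 : R) <= #|cs (pnext a phi (Some c)) v :&: cs (pnext a phi (Some c)) f|%:R
                - #|cs phi v :&: cs phi f|%:R <= p c /\ (0 <= p c) /\
     #|cs (pnext a phi (Some c)) v :&: cs (pnext a phi (Some c)) f|%:R
                - #|cs phi v :&: cs phi f|%:R <= (1 : R).
  have p0 : 0 <= p c by rewrite /p; case: ifP => // _; rewrite addr_ge0 ?ler0n.
  have nd (x y k : nat) : (x <= y)%N -> (y <= x + k)%N -> 0 <= (y%:R - x%:R : R) <= k%:R.
    by move=> h1 h2; rewrite subr_ge0 ler_nat h1 lerBlDr -natrD ler_nat addnC h2.
  have b1 (b : bool) : (b%:R : R) <= 1 by case: b; rewrite ?lexx ?ler01.
  rewrite /=; case: ifP => _; last by rewrite subrr p0 lexx; split=> //; split=> //; rewrite subrr ler01.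
  rewrite !cs_upd // /p; case: (e v a); case: (e f a) => /=; rewrite ?addr0 ?add0r.
  - have [h1 h2] := le1 (cs phi v) (cs phi f) c.
    by have /andP [-> h3] := nd _ _ _ h1 h2; split=> //; split=> //; exact: ler01.
  - have [h1 h2] := le2 (cs phi v) (cs phi f) c.
    have /andP [-> h3] := nd _ _ _ h1 h2; split=> //; split; first exact: ler0n.
    exact: le_trans h3 (b1 _).
  - have [h1 h2] := le2 (cs phi f) (cs phi v) c.
    rewrite [cs phi v :&: (c |: _)]setIC [cs phi v :&: _]setIC.
    have /andP [-> h3] := nd _ _ _ h1 h2; split=> //; split; first exact: ler0n.
    exact: le_trans h3 (b1 _).
  by rewrite subrr lexx; split=> //; split=> //; rewrite subrr ler01.
split.
  case=> [c|] /=; last by rewrite subrr lexx ler01.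
  by have [/andP [h1 _] [_ h2]] := h c; rewrite h1.
apply: le_trans (mean_le (p := p) _ _) _; rewrite ?subrr //.
  by move=> c _; case: (h c) => /andP [].
have hcs x : x \in [set v; f] -> al / #|L a|%:R * \sum_(c in L a) (c \in cs phi x)%:R <= be.
  move=> hx; rewrite mulrAC ler_pdivrMr //; apply: le_trans (hb x hx).
  rewrite ler_wpM2l // -natr_sum ler_nat -sum1_card big_mkcond [X in (_ <= X)%N]big_mkcond /=.
  by apply: leq_sum => c _; case: (c \in L a); case: (c \in cs phi x).
have hv := hcs v ltac:(by rewrite !inE eqxx); have hf := hcs f ltac:(by rewrite !inE eqxx orbT).
rewrite /p !inE aW; case: (e v a); case: (e f a) => /=; rewrite ?mulr1 ?mulr0 ?addr0 ?add0r.
- by rewrite sumr_const divfK ?lt0r_neq0 // lerDl.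
- apply: le_trans hf; apply: ler_wpM2l; first by rewrite divr_ge0 // ltW.
  by apply: ler_sum => c _; rewrite ?addr0 ?add0r.
- apply: le_trans hv; apply: ler_wpM2l; first by rewrite divr_ge0 // ltW.
  by apply: ler_sum => c _; rewrite ?addr0 ?add0r.
by rewrite big1 ?mulr0 // => c _; rewrite ?addr0.
Qed.

(** A draw [c] at a neighbour [a] adds [u c] unless [c] is already seen at [v] or blocked at [a];
    each excluded colour costs at most [M]. *)
Lemma gain_step v (u : C -> R) (M : R) : 0 <= M -> (forall c, 0 <= u c <= M) ->
  (forall w, 0 <= \sum_(c in cs (pnext a phi w) v) u c - \sum_(c in cs phi v) u c <= M) /\
  (if a \in nb v then
     al / #|L a|%:R * (\sum_(c in L a) u c - M * (#|cs phi v|%:R + #|cs phi a|%:R)) else 0) <=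
  \sum_w pick al a w * (\sum_(c in cs (pnext a phi w) v) u c - \sum_(c in cs phi v) u c).
Proof.
move=> M0 hu.
have nbE : (a \in nb v) = e v a by rewrite inE aW.
have h c : \sum_(x in cs (pnext a phi (Some c)) v) u x - \sum_(x in cs phi v) u x =
   if [&& a \in nb v, c \notin cs phi a & c \notin cs phi v] then u c else 0.
  rewrite /= pa eqxx /=; case: (boolP (c \in cs phi a)) => hc /=; first by rewrite subrr andbF.
  rewrite cs_upd // nbE; case: (e v a) => /=; last by rewrite subrr.
  case: (boolP (c \in cs phi v)) => hv /=; first by rewrite (setUidPr _) ?sub1set // subrr.
  by rewrite big_setU1 //= addrK.
split.
  case=> [c|]; last by rewrite /= subrr lexx.
  by rewrite h; case: ifP => _ //; rewrite lexx.
case: ifP => anb; last first.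
  rewrite pick_mean ?subrr // big1 // => c _; by rewrite h anb mulr0.
apply: le_trans (mean_ge (p := fun c => u c - M * ((c \in cs phi v)%:R + (c \in cs phi a)%:R)) _ _); last 2 first.
- by rewrite /= subrr.
- move=> c _; rewrite h anb /=; have /andP [h1 h2] := hu c.
  case: (c \in cs phi a); case: (c \in cs phi v) => /=; rewrite ?addr0 ?add0r ?mulr1 ?mulr0 ?subr0 //; lra.
apply: ler_wpM2l; first by rewrite divr_ge0 // ltW.
rewrite sumrB lerD2l lerN2 -mulr_sumr ler_wpM2l // big_split /=.
have hc x : \sum_(c in L a) ((c \in cs phi x)%:R : R) <= #|cs phi x|%:R.
  rewrite -natr_sum ler_nat -sum1_card big_mkcond [X in (_ <= X)%N]big_mkcond /=.
  by apply: leq_sum => c _; case: (c \in L a); case: (c \in cs phi x).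
by rewrite lerD.
Qed.

(** With [C1] the colours that [v] saw under [base], these are the neighbours of [v] that repeat
    such a colour later. *)
Definition hits (base : X -> option C) (C1 : {set C}) v (psi : X -> option C) : {set X} :=
  [set w in nb v | (base w == None) && (if psi w is Some c then c \in C1 else false)].

Lemma hits_step base C1 v :
  (forall w, (0 : R) <= #|hits base C1 v (pnext a phi w)|%:R - #|hits base C1 v phi|%:R <= (1 : R)) /\
  (if (a \in nb v) && (base a == None) then
     al / #|L a|%:R * (#|L a :&: C1|%:R - #|cs phi a :&: C1|%:R) else 0) <=
  \sum_w pick al a w * (#|hits base C1 v (pnext a phi w)|%:R - #|hits base C1 v phi|%:R).
Proof.
have na : a \notin hits base C1 v phi by rewrite inE pa !andbF.
have h c : #|hits base C1 v (pnext a phi (Some c))|%:R - #|hits base C1 v phi|%:R =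
   ([&& (a \in nb v) && (base a == None), c \notin cs phi a & c \in C1])%:R :> R.
  rewrite /= pa eqxx /=; case: (boolP (c \in cs phi a)) => hc /=; first by rewrite subrr andbF.
  case: (boolP [&& (a \in nb v) && (base a == None) & c \in C1]) => hh /=.
    have -> : hits base C1 v (upd phi a c) = a |: hits base C1 v phi.
      apply/setP => x; rewrite !inE /upd; case: (x =P a) => [->|] //=.
      by case/andP: hh => /andP [+ ->] ->; rewrite inE => ->.
    by rewrite cardsU1 na natrD addrK.
  have -> : hits base C1 v (upd phi a c) = hits base C1 v phi.
    apply/setP => x; rewrite !inE /upd; case: (x =P a) => [->|] //=.
    by rewrite pa !andbF; apply/negbTE; apply: contra hh; rewrite inE => /and3P [-> -> ->].
  by rewrite subrr.
split.
  case=> [c|]; last by rewrite /= subrr lexx ler01.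
  by rewrite h; case: [&& _, _ & _]; rewrite ?lexx ?ler01.
case: ifP => anb; last first.
  by rewrite pick_mean ?subrr // big1 // => c _; rewrite h anb mulr0.
apply: le_trans (mean_ge (p := fun c => (c \in C1)%:R - ((c \in cs phi a) && (c \in C1))%:R) _ _); last 2 first.
- by rewrite /= subrr.
- by move=> c _; rewrite h anb /=; case: (c \in cs phi a); case: (c \in C1); rewrite /= ?subrr ?subr0.
apply: ler_wpM2l; first by rewrite divr_ge0 // ltW.
rewrite sumrB; apply: lerB.
  rewrite -natr_sum ler_nat -sum1_card big_mkcond [X in (_ <= X)%N]big_mkcond /=.
  by apply: leq_sum => c _; rewrite inE; case: (c \in L a); case: (c \in C1).
rewrite -natr_sum ler_nat -sum1_card big_mkcond [X in (_ <= X)%N]big_mkcond /=.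
by apply: leq_sum => c _; rewrite in_setI; case: (c \in L a); case: (c \in C1); case: (c \in cs phi a).
Qed.

End OneStep.

Lemma sum_ind_le (don : seq X) (Z : {set X}) (r : R) : 0 <= r -> uniq don ->
  \sum_(x <- don) r * (x \in Z)%:R <= r * #|Z|%:R.
Proof.
move=> r0 ud; rewrite -mulr_sumr ler_wpM2l // big_uniq //= -natr_sum ler_nat -sum1_card.
rewrite big_mkcond [X in (_ <= X)%N]big_mkcond /=; apply: leq_sum => x _.
by case: (x \in don); case: (x \in Z).
Qed.

(** Activation probability of the first pass; [al2] is that of the second, and [eps * K] is the
    deviation allowed in both. *)
Definition al : R := (1 / 10) ^+ 7.
Definition al2 : R := (1 / 10) ^+ 13.
Definition eps : R := (1 / 10) ^+ 24.

Lemma al_01 : 0 <= al <= 1.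
Proof. by rewrite /al exprn_ge0 ?exprn_ile1 //; lra. Qed.

Lemma al2_01 : 0 <= al2 <= 1.
Proof. by rewrite /al2 exprn_ge0 ?exprn_ile1 //; lra. Qed.

(** * The two passes of the precolouring *)

Section TwoPasses.

Variables (J : finType) (Z : J -> {set X}) (I : {set X}) (K : R).
Hypothesis K0 : 0 < K.
Hypothesis CK : #|C|%:R <= K.
Hypothesis WI : W \subset I.
Hypothesis L_ge : forall a, a \in W -> K / 10 <= #|L a|%:R.
Hypothesis nb_le : forall v, v \in I -> #|nb v|%:R <= 3 * K.
Hypothesis few : (#|{: (J + X) + X * X}|%:R + #|X|%:R) * exp (- (eps * K)) < 1.

Let La0 a : a \in W -> (0 < #|L a|)%N.
Proof.
move=> aW; rewrite lt0n -(pnatr_eq0 R); apply: lt0r_neq0.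
by apply: lt_le_trans (L_ge aW); rewrite divr_gt0.
Qed.

(** This is [70 * al ^+ 2]: a vertex sees at most [A = 7 * al * K] colours after one pass, and lists
    have at least [K / 10]. *)
Let be : R := (70 / 10 ^+ 14).

(** Up to the activation probability, the expected number of neighbours of [v] that draw [c]. Summed
    over the colours seen after the first pass, it governs the number of repetitions made by the
    second. *)
Definition uw v c : R := \sum_(f in nb v | c \in L f) (#|L f|%:R)^-1.

Lemma uw_bound v c : v \in I -> 0 <= uw v c <= 30.
Proof.
move=> vI; apply/andP; split.
  by apply: sumr_ge0 => f _; rewrite invr_ge0 ler0n.
apply: (@le_trans _ _ (\sum_(f in nb v) 10 / K)).
  rewrite /uw big_mkcondr; apply: ler_sum => f; rewrite inE => /andP [fW _].
  have h0 : 0 < K / 10 by rewrite divr_gt0.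
  case: ifP => _; last by rewrite divr_ge0 // ltW.
  have -> : 10 / K = (K / 10)^-1 by rewrite invf_div.
  by rewrite lef_pV2 ?posrE ?L_ge // (lt_le_trans h0) // L_ge.
rewrite sumr_const -[_ *+ _]mulr_natl mulrA ler_pdivrMr // mulrC.
have := nb_le vI; lra.
Qed.

Lemma sum_uw v (D : {set C}) : \sum_(c in D) uw v c = \sum_(f in nb v) #|L f :&: D|%:R / #|L f|%:R.
Proof.
rewrite /uw; under eq_bigr => c _ do rewrite big_mkcondr.
rewrite exchange_big /=; apply: eq_bigr => f _.
rewrite -big_mkcondr /= sumr_const -[LHS]mulr_natl; congr (_%:R * _).
by apply: eq_card => c; rewrite !inE andbC.
Qed.

(** The right-hand side is the sum of the squares of [uw v c], whose sum over the at most [K]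
    colours is the number of neighbours; the rest is Cauchy-Schwarz. *)
Lemma sum_uw_sq v : v \in I -> #|nb v|%:R ^+ 2 / K <=
  \sum_(a in nb v) (\sum_(c in L a) uw v c) / #|L a|%:R.
Proof.
move=> vI.
have -> : \sum_(a in nb v) (\sum_(c in L a) uw v c) / #|L a|%:R = \sum_c uw v c ^+ 2.
  under eq_bigr => a _ do rewrite mulr_suml big_mkcond.
  rewrite exchange_big /=; apply: eq_bigr => c _.
  by rewrite expr2 {2}/uw mulr_sumr big_mkcondr.
have tot : \sum_c uw v c = #|nb v|%:R.
  have -> : \sum_c uw v c = \sum_(c in [set: C]) uw v c by apply: eq_bigl => c; rewrite inE.
  rewrite sum_uw -sum1_card natr_sum; apply: eq_bigr => f; rewrite inE => /andP [fW _].
  by rewrite setIT divff // pnatr_eq0 -lt0n La0.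
set N : R := #|nb v|%:R in tot *.
have h : 0 <= \sum_c (uw v c - N / K) ^+ 2 by apply: sumr_ge0 => c _; exact: sqr_ge0.
have e1 : \sum_c (uw v c - N / K) ^+ 2 =
   \sum_c uw v c ^+ 2 - 2 * (N / K) * N + #|C|%:R * (N / K) ^+ 2.
  have -> : 2 * (N / K) * N = \sum_c 2 * (N / K) * uw v c by rewrite -mulr_sumr tot.
  have -> : #|C|%:R * (N / K) ^+ 2 = \sum_(c : C) (N / K) ^+ 2.
    by rewrite sumr_const mulr_natl.
  rewrite -sumrB -big_split /=; apply: eq_bigr => c _; ring.
have h2 : #|C|%:R * (N / K) ^+ 2 <= K * (N / K) ^+ 2 by rewrite ler_wpM2r ?sqr_ge0.
have e2 : K * (N / K) ^+ 2 = N ^+ 2 / K by field; rewrite lt0r_neq0.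
have e3 : 2 * (N / K) * N = 2 * (N ^+ 2 / K) by ring.
rewrite e1 e3 in h; rewrite e2 in h2; move: h h2; lra.
Qed.

Let d : R := eps * K.
Let d0 : 0 <= d. Proof. by rewrite mulr_ge0 ?exprn_ge0 ?ltW //; lra. Qed.
Let A : R := 7 * al * K.

Definition blank : X -> option C := fun _ => None.

Lemma blank_cs v : cs blank v = set0.
Proof. by apply/setP => c; rewrite in_set0; apply/csP => [[w _]]. Qed.

Lemma blank_dm Y : dm blank Y = set0.
Proof. by apply/setP => c; rewrite !inE andbF. Qed.

Lemma pgood_blank don : pgood blank don blank.
Proof. by []. Qed.

Let pO (p : X * X) (a : X) : R := if (p.1 \in I) && (p.2 \in I) then
  al * (a \in nb p.1 :&: nb p.2)%:R + be * (a \in nb p.1 :|: nb p.2)%:R else 0.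
Let fO (p : X * X) (phi : X -> option C) : R := if (p.1 \in I) && (p.2 \in I) then
  #|cs phi p.1 :&: cs phi p.2|%:R else 0.

Let dm_small don phi v : uniq don -> v \in I ->
  #|dm phi (nb v)|%:R <= 2 * (\sum_(x <- don) al * (x \in nb v)%:R) + 2 * d ->
  #|dm phi (nb v)|%:R <= A.
Proof.
move=> ud vI h; have h1 := sum_ind_le (nb v) (proj1 (andP al_01)) ud.
have h2 : al * #|nb v|%:R <= al * (3 * K) by rewrite ler_wpM2l ?nb_le // (proj1 (andP al_01)).
apply: (le_trans h); move: h1 h2 K0; rewrite /A /d /eps /al; lra.
Qed.

(** The last bound says that the colours seen by [v] carry [uw]-weight linear in [K]. The bound on
    common colours keeps the second pass from being blocked: a neighbour [f] must not already see
    the colours that it should repeat for [v]. *)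
Lemma pass_one : exists phi : X -> option C,
  [/\ pgood blank (enum W) phi,
      forall j, #|dm phi (Z j)|%:R <= 2 * al * #|Z j|%:R + 2 * d,
      forall v, v \in I -> #|dm phi (nb v)|%:R <= A,
      forall v f, v \in I -> f \in I -> #|cs phi v :&: cs phi f|%:R <=
         2 * al * #|nb v :&: nb f|%:R + 2 * be * #|nb v :|: nb f|%:R + 2 * d &
      forall v, v \in I ->
        al / 2 * (#|nb v|%:R ^+ 2 / K - 4300 * al * #|nb v|%:R) - 120 * d <= \sum_(c in cs phi v) uw v c].
Proof.
pose fU (u : (J + X) + X * X) (phi : X -> option C) : R := match u with
  | inl (inl j) => #|dm phi (Z j)|%:R | inl (inr v) => #|dm phi (nb v)|%:R | inr p => fO p phi end.
pose pU (u : (J + X) + X * X) (a : X) : R := match u with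
  | inl (inl j) => al * (a \in Z j)%:R | inl (inr v) => al * (a \in nb v)%:R | inr p => pO p a end.
pose fV v (phi : X -> option C) : R := if v \in I then \sum_(c in cs phi v) uw v c else 0.
pose pV v a : R := if (v \in I) && (a \in nb v) then
   al * ((\sum_(c in L a) uw v c) / #|L a|%:R - 4300 * al) else 0.
have [||u|v|don a rest phi exs gs hU hV|phi [gs hU hV]] :=
  @counter_run (X -> option C) X (option C) ((J + X) + X * X)%type X (enum W)
    (pgood blank) (fun don a phi w => pick al a w) (fun a phi w => pnext a phi w) blank d
    fU (fun _ => 1) pU fV (fun _ => 30) pV.
- exact: pgood_blank.
- exact: few.
- exact: ltr01.
- by lra.
- have us : uniq (don ++ a :: rest) by rewrite -exs enum_uniq.
  have aW : a \in W by rewrite -mem_enum exs mem_cat inE eqxx orbT.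
  move: us; rewrite cat_uniq /= negb_or => /and3P [ud /andP [ad _] _].
  have pa : phi a = None by case: gs => _ h _; exact: h.
  have La := La0 aW; have Lar : 0 < #|L a|%:R :> R by rewrite ltr0n.
  have aI : a \in I := subsetP WI a aW.
  have hdm v : v \in I -> #|dm phi (nb v)|%:R <= A.
    move=> vI; apply: (dm_small ud vI); have := hU (inl (inr v)).
    by rewrite /fU /pU blank_dm cards0 add0r mulr1.
  have hcs v : v \in I -> #|cs phi v|%:R <= A.
    by move=> vI; apply: le_trans (hdm v vI); rewrite ler_nat card_cs.
  split.
  + by move=> w; apply: pick_ge0; exact: al_01.
  + exact: pick_sum.
  + by move=> w; exact: pnext_good.
  + case=> [[j|v]|[v f]].
    * by have [h1 h2] := dm_step al_01 La pa (Z j); split=> // w _; exact: h1.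
    * by have [h1 h2] := dm_step al_01 La pa (nb v); split=> // w _; exact: h1.
    * rewrite /fU /pU /fO /pO /=; case: ifP => [/andP [vI fI]|_]; last first.
        split=> [w _|]; first by rewrite subrr lexx ler01.
        by rewrite big1 // => w _; rewrite subrr mulr0.
      have [||h1 h2] := @meet_step al a phi al_01 aW La pa v f be.
      - move=> x xvf; have xI : x \in I by move: xvf => /set2P [] ->.
        have h := hcs x xI; have h' := L_ge aW.
        apply: (@le_trans _ _ (al * A)); first by rewrite ler_wpM2l // (proj1 (andP al_01)).
        apply: (@le_trans _ _ (be * (K / 10))); last by rewrite ler_wpM2l // /be; lra.
        by rewrite /A /be /al; move: K0; lra.
      - by rewrite /be; lra.
      by split=> // w _; exact: h1.
  + move=> v; rewrite /fV /pV; case: (boolP (v \in I)) => vI /=; last first.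
      split=> [w _|]; first by rewrite subrr lexx; lra.
      by rewrite big1 // => w _; rewrite subrr mulr0.
    have [||h1 h2] := @gain_step al a phi al_01 aW pa v (uw v) 30.
    * by lra.
    * by move=> c; exact: uw_bound.
    split=> [w _|]; first exact: h1.
    apply: le_trans h2; case: ifP => // _.
    have hv := hcs v vI; have ha := hcs a aI; have h' := L_ge aW.
    rewrite -mulrA ler_wpM2l ?(proj1 (andP al_01)) // [X in _ <= X]mulrC mulrBl lerD2l lerN2.
    rewrite ler_pdivrMr //.
    (* [30 * 2 * A] is [420 * al * K], hence [4200 * al] relative to a list of size [K / 10]; 4300
       leaves room. *)
    apply: (@le_trans _ _ (30 * (A + A))); first by rewrite ler_wpM2l ?lerD //; lra.
    apply: (@le_trans _ _ (4300 * al * (K / 10))).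
      by rewrite /A /al; move: K0; lra.
    by rewrite ler_wpM2l // /al; lra.
have ue : uniq (enum W) := enum_uniq _.
have al0 := proj1 (andP al_01).
exists phi; split=> //.
- move=> j; have := hU (inl (inl j)); rewrite /fU /pU blank_dm cards0 add0r mulr1.
  have := sum_ind_le (Z j) al0 ue; lra.
- move=> v vI; apply: (dm_small ue vI); have := hU (inl (inr v)).
  by rewrite /fU /pU blank_dm cards0 add0r mulr1.
- move=> v f vI fI; have := hU (inr (v, f)); rewrite /fU /pU /fO /pO vI fI /=.
  rewrite !blank_cs set0I cards0 add0r mulr1 big_split /=.
  have h1 := sum_ind_le (nb v :&: nb f) al0 ue.
  have h2 : \sum_(x <- enum W) be * (x \in nb v :|: nb f)%:R <= be * #|nb v :|: nb f|%:R.
    by apply: sum_ind_le => //; rewrite /be; lra.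
  move: h1 h2; lra.
move=> v vI; have := hV v; rewrite /fV /pV vI blank_cs big_set0 add0r /=.
apply: le_trans.
have -> : \sum_(x <- enum W) (if x \in nb v then al * ((\sum_(c in L x) uw v c) / #|L x|%:R - 4300 * al) else 0) =
   al * (\sum_(a in nb v) (\sum_(c in L a) uw v c) / #|L a|%:R - 4300 * al * #|nb v|%:R).
  rewrite big_enum /= -big_mkcondr /=.
  rewrite (eq_bigl (fun a => a \in nb v)); last first.
    by move=> x; rewrite !inE; case: (x \in W).
  by rewrite -mulr_sumr sumrB sumr_const mulr_natr.
have h := sum_uw_sq vI.
have -> : al * (\sum_(a in nb v) (\sum_(c in L a) uw v c) / #|L a|%:R - 4300 * al * #|nb v|%:R) / 2 =
   al / 2 * (\sum_(a in nb v) (\sum_(c in L a) uw v c) / #|L a|%:R - 4300 * al * #|nb v|%:R) by ring.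
have h2 : al / 2 * (#|nb v|%:R ^+ 2 / K - 4300 * al * #|nb v|%:R) <=
   al / 2 * (\sum_(a in nb v) (\sum_(c in L a) uw v c) / #|L a|%:R - 4300 * al * #|nb v|%:R).
  by rewrite ler_wpM2l ?divr_ge0 // lerD2r.
have -> : 4 * 30 * d = 120 * d by ring.
by rewrite lerD2r.
Qed.

Lemma card_cs_new base don phi v : pgood base don phi ->
  #|cs phi v :\: cs base v|%:R <= #|dm phi (nb v)|%:R - #|dm base (nb v)|%:R :> R.
Proof.
case=> hb _ _.
have sub : dm base (nb v) \subset dm phi (nb v).
  apply/subsetP => x; rewrite inE [in X in _ -> X]inE => /andP [-> h] /=.
  by case ex: (base x) h => [c|] // _; rewrite (hb _ _ ex).
have h : (#|cs phi v :\: cs base v| <= #|dm phi (nb v) :\: dm base (nb v)|)%N.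
  apply: (@leq_trans #|phi @: (dm phi (nb v) :\: dm base (nb v))|); last exact: leq_imset_card.
  have sinj : injective (@Some C) by move=> x y [].
  rewrite -(card_imset _ sinj); apply/subset_leq_card/subsetP => z.
  case/imsetP => c; rewrite in_setD => /andP [nb' /csP [w wv pw]] ->; apply/imsetP; exists w => //.
  rewrite in_setD [w \in dm phi _]inE wv pw andbT inE wv /= negbK.
  apply/eqP; case ew: (base w) => [c'|] //; case/negP: nb'; apply/csP; exists w => //.
  by move: (hb _ _ ew); rewrite ew pw.
have h3 : #|dm phi (nb v)|%:R - #|dm base (nb v)|%:R = #|dm phi (nb v) :\: dm base (nb v)|%:R :> R.
  by rewrite -(cardsID (dm base (nb v)) (dm phi (nb v))) (setIidPr sub) natrD addrAC subrr add0r.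
by rewrite h3 ler_nat.
Qed.

(** Neighbours sharing many neighbours with [v] may see most of the colours that [v] sees, so they
    cannot be counted on to repeat them. *)
Definition crowded v : {set X} := [set a in nb v | 7 / 10 ^+ 5 * K < #|nb v :&: nb a|%:R].

(** Two passes are used so that the colours to be repeated are fixed when the repetitions are drawn:
    members of [D] are coloured in the second pass, their partners in the first. *)
Lemma activation : exists phi : X -> option C,
  [/\ pproper phi,
      forall j, #|dm phi (Z j)|%:R <= (2 * al + 2 * al2) * #|Z j|%:R + 4 * d &
      forall v, v \in I -> 2 / 5 * K <= #|nb v|%:R -> #|crowded v|%:R <= 7 / 10 ^+ 5 * K ->
        exists D : {set X}, [/\ D \subset nb v, (1 / 10) ^+ 22 * K <= #|D|%:R &
          forall w, w \in D -> exists w', [/\ w' \in nb v, w' \notin D, phi w <> None & phi w' = phi w]]].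
Proof.
have [phi1 [g1 hZ hA hO hT]] := pass_one.
have al0 := proj1 (andP al_01); have al20 := proj1 (andP al2_01).
(* Bounds the blocked fraction of a list of size [K / 10]. The common colours after pass one number
   at most about [2 * al * 7 / 10 ^+ 5 * K + 12 * be * K]; the second pass and the deviations add a
   small amount. *)
pose q : R := 24 / 10 ^+ 11.
pose ok v a := [&& v \in I, a \in nb v, phi1 a == None & a \notin crowded v].
pose fU (u : J + X) (phi : X -> option C) : R := match u with
  | inl j => #|dm phi (Z j)|%:R | inr v => #|dm phi (nb v)|%:R end.
pose pU (u : J + X) (a : X) : R := match u with
  | inl j => al2 * (a \in Z j)%:R | inr v => al2 * (a \in nb v)%:R end.
pose fV v (phi : X -> option C) : R := #|hits phi1 (cs phi1 v) v phi|%:R.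
pose pV v a : R := if ok v a then al2 * (#|L a :&: cs phi1 v|%:R / #|L a|%:R - q) else 0.
have L10 a : a \in W -> 0 < #|L a|%:R :> R by move=> aW; rewrite ltr0n La0.
have [||u|v|don a rest phi exs gs hU hV|phi [gs hU hV]] :=
  @counter_run (X -> option C) X (option C) (J + X)%type X (enum W)
    (pgood phi1) (fun don a phi w => pick al2 a w) (fun a phi w => pnext a phi w) phi1 d
    fU (fun _ => 1) pU fV (fun _ => 1) pV.
- by split=> //; case: g1.
- apply: le_lt_trans few; rewrite ler_wpM2r ?(ltW (exp_gt0 _)) // lerD2r ler_nat.
  by rewrite [X in (_ <= X)%N]card_sum leq_addr.
- exact: ltr01.
- exact: ltr01.
- have us : uniq (don ++ a :: rest) by rewrite -exs enum_uniq.
  have aW : a \in W by rewrite -mem_enum exs mem_cat inE eqxx orbT.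
  move: us; rewrite cat_uniq /= negb_or => /and3P [ud /andP [ad _] _].
  have La := La0 aW; have Lar := L10 a aW; have aI : a \in I := subsetP WI a aW.
  have hp w : 0 <= pick al2 a w by apply: pick_ge0; exact: al2_01.
  have hs : \sum_w pick al2 a w = 1 by exact: pick_sum.
  case pa : (phi a) => [c0|]; last first.
    split=> //.
    + by move=> w; exact: pnext_good.
    + case=> [j|v].
      * by have [h1 h2] := dm_step al2_01 La pa (Z j); split=> // w _; exact: h1.
      * by have [h1 h2] := dm_step al2_01 La pa (nb v); split=> // w _; exact: h1.
    move=> v; have [h1 h2] := hits_step al2_01 pa phi1 (cs phi1 v) v.
    split=> [w _|]; first exact: h1.
    rewrite /pV; case: ifP => [hok|_]; last first.
      by apply: sumr_ge0 => w _; rewrite mulr_ge0 //; case/andP: (h1 w).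
    apply: le_trans h2; case/and4P: hok => vI anb -> ncr; rewrite anb /=.
    have ncr' : #|nb v :&: nb a|%:R <= 7 / 10 ^+ 5 * K.
      by move: ncr; rewrite inE anb /= -leNgt.
    have hm : #|cs phi a :&: cs phi1 v|%:R <= q * (K / 10).
      have h3 : #|cs phi a :&: cs phi1 v|%:R <=
          #|cs phi1 v :&: cs phi1 a|%:R + #|cs phi a :\: cs phi1 a|%:R :> R.
        rewrite -natrD ler_nat; apply: leq_trans (leq_card_setU _ _).1.
        apply/subset_leq_card/subsetP => c; rewrite in_setI in_setU in_setI in_setD.
        by case: (c \in cs phi1 a); case: (c \in cs phi a); case: (c \in cs phi1 v).
      have h4 := card_cs_new a gs; have h5 := hO v a vI aI.
      have h6 := hU (inr a); rewrite /fU /pU mulr1 in h6.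
      have h7 := sum_ind_le (nb a) al20 ud.
      have h8 : al2 * #|nb a|%:R <= al2 * (3 * K) by rewrite ler_wpM2l ?nb_le.
      have h9 : #|nb v :|: nb a|%:R <= 6 * K.
        have : #|nb v :|: nb a|%:R <= #|nb v|%:R + #|nb a|%:R :> R.
          by rewrite -natrD ler_nat (leq_card_setU _ _).1.
        have := nb_le vI; have := nb_le aI; lra_above dm_small.
      have h10 : 2 * al * #|nb v :&: nb a|%:R <= 2 * al * (7 / 10 ^+ 5 * K).
        by rewrite ler_wpM2l // mulr_ge0.
      have h11 : 2 * be * #|nb v :|: nb a|%:R <= 2 * be * (6 * K).
        by rewrite ler_wpM2l // /be; lra_above dm_small.
      move: h3 h4 h5 h6 h7 h8 h10 h11 K0; rewrite /q /d /eps /be /al /al2.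
      set x1 := #|cs phi a :&: _|%:R; set x2 := #|cs phi1 v :&: cs phi1 a|%:R.
      set x3 := #|cs phi a :\: _|%:R; set x4 := #|dm phi _|%:R; set x5 := #|dm phi1 _|%:R.
      set x6 := #|nb v :&: nb a|%:R; set x7 := #|nb v :|: nb a|%:R; set x8 := #|nb a|%:R.
      set x9 := \sum_(x <- don) _; lra_above dm_small.
    rewrite -mulrA ler_wpM2l // [X in _ <= X]mulrC mulrBl lerD2l lerN2 ler_pdivrMr //.
    by apply: (le_trans hm); rewrite ler_wpM2l ?L_ge // /q; lra_above dm_small.
  have nx w : pnext a phi w = phi by case: w => [c|] //=; rewrite pa.
  (* A vertex that is coloured before its turn in the second pass owes its colour to the first. *)
  have aphi : phi1 a <> None.
    move=> h; case: gs => _ /(_ a h ad); by rewrite pa.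
  split=> //.
  + move=> w _; rewrite nx; case: gs => h1 h2 h3; split=> // x bx.
    by rewrite mem_rcons inE negb_or => /andP [_]; exact: h2.
  + move=> u; split=> [w _|]; first by rewrite nx subrr lexx ler01.
    rewrite big1 => [|w _]; last by rewrite nx subrr mulr0.
    by case: u => j /=; rewrite mulr_ge0.
  + move=> v; split=> [w _|]; first by rewrite nx subrr lexx ler01.
    rewrite big1 => [|w _]; last by rewrite nx subrr mulr0.
    by rewrite /pV /ok; case: (phi1 a =P None) => [/aphi //|]; rewrite !andbF.
have ue : uniq (enum W) := enum_uniq _.
exists phi; split.
- by case: gs.
- move=> j; have := hU (inl j); have := hZ j; rewrite /fU /pU mulr1.
  have := sum_ind_le (Z j) al20 ue; lra.
move=> v vI hN hcr.
exists (hits phi1 (cs phi1 v) v phi); split.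
- by apply/subsetP => w; rewrite inE; case/andP.
- have := hV v; rewrite /fV.
  have -> : hits phi1 (cs phi1 v) v phi1 = set0.
    by apply/setP => w; rewrite !inE; case: (phi1 w) => [c|] /=; rewrite ?andbF.
  rewrite cards0 add0r; apply: le_trans.
  have h70 a : a \in W -> #|L a :&: cs phi1 v|%:R / #|L a|%:R <= 70 * al.
    move=> aW; rewrite ler_pdivrMr ?L10 //.
    have h1 : #|L a :&: cs phi1 v|%:R <= A.
      apply: le_trans (hA v vI); rewrite ler_nat; apply: leq_trans (card_cs _ _).
      exact/subset_leq_card/subsetIr.
    apply: (le_trans h1); apply: (@le_trans _ _ (70 * al * (K / 10))).
      by rewrite /A; lra.
    by rewrite ler_wpM2l ?L_ge // mulr_ge0.
  (* Neighbours outside [B] can be hit. Those in [B] are charged the full share [70 * al] that a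
     list can have in common with the colours seen at [v]. *)
  pose B := dm phi1 (nb v) :|: crowded v.
  have hB : #|B|%:R <= A + 7 / 10 ^+ 5 * K.
    have h1 : #|B|%:R <= #|dm phi1 (nb v)|%:R + #|crowded v|%:R :> R.
      by rewrite -natrD ler_nat (leq_card_setU _ _).1.
    by apply: (le_trans h1); rewrite lerD ?hA.
  have hsum : al2 * (\sum_(c in cs phi1 v) uw v c - 70 * al * #|B|%:R - q * #|nb v|%:R) <=
     \sum_(x <- enum W) pV v x.
    rewrite big_enum /= (bigID (fun a => a \in nb v)) /=.
    rewrite [X in _ <= _ + X]big1 ?addr0; last first.
      by move=> a /andP [_ /negbTE h]; rewrite /pV /ok h /= !andbF.
    rewrite (eq_bigl (fun a => a \in nb v)); last by move=> a; rewrite !inE; case: (a \in W).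
    rewrite sum_uw.
    have -> : 70 * al * #|B|%:R = \sum_(a in nb v) (if a \in B then 70 * al else 0).
      rewrite -big_mkcondr /= sumr_const mulr_natr; congr (_ *+ _); apply: eq_card => a.
      rewrite -[RHS]/((a \in nb v) && (a \in B)); case: (boolP (a \in B)); rewrite ?andbF // andbT.
      by rewrite in_setU => /orP []; rewrite inE => /andP [].
    have -> : q * #|nb v|%:R = \sum_(a in nb v) q by rewrite sumr_const mulr_natr.
    rewrite -!sumrB mulr_sumr; apply: ler_sum => a anb.
    have aW : a \in W by move: anb; rewrite inE => /andP [].
    rewrite /pV; case: (boolP (ok v a)) => hok.
      have -> : (a \in B) = false.
        apply/negbTE; case/and4P: hok => _ _ /eqP h1 h2.
        by rewrite in_setU negb_or h2 andbT inE h1 andbF.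
      by rewrite subr0.
    have -> : (a \in B).
      apply: contraNT hok; rewrite in_setU negb_or => /andP [h1 h2].
      rewrite /ok vI anb h2 andbT /=; apply: contraNT h1 => h.
      by rewrite inE anb h.
    apply: mulr_ge0_le0 => //; by have := h70 a aW; rewrite /q; lra_above dm_small.
  have hT' := hT v vI; have hub := nb_le vI.
  have hN2 : 2 / 5 * #|nb v|%:R <= #|nb v|%:R ^+ 2 / K.
    rewrite ler_pdivlMr // expr2; have : 0 <= #|nb v|%:R :> R by exact: ler0n.
    move: hN; set N := #|nb v|%:R; nra.
  have h3 : al / 2 * (2 / 5 * #|nb v|%:R - 4300 * al * #|nb v|%:R) <= al / 2 *
     (#|nb v|%:R ^+ 2 / K - 4300 * al * #|nb v|%:R).
    by rewrite ler_wpM2l ?divr_ge0 // lerD2r.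
  have h4 : al * #|B|%:R <= al * (A + 7 / 10 ^+ 5 * K) by rewrite ler_wpM2l.
  have h5 : al2 * (6 / 10 ^+ 9 * K) <= \sum_(x <- enum W) pV v x.
    apply: le_trans hsum; rewrite ler_wpM2l //.
    move: hN2 hT' hub h3 h4 hN K0; rewrite /A /d /eps /q /al.
    set T := \sum_(c in _) _; set N := #|nb v|%:R; set N2 := _ / K; set b := #|B|%:R; lra_above dm_small.
  move: h5 K0; rewrite /al2 /d /eps; set T := \sum_(x <- _) _; lra_above dm_small.
move=> w; rewrite inE => /and3P [wv /eqP w1]; case ew: (phi w) => [c|] //.
case/csP => w' w'v e'; exists w'; split=> //.
  by rewrite inE e' andbF.
by case: gs => h _ _; rewrite (h _ _ e').
Qed.

End TwoPasses.

End Activation.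

(** * Random non-adjacent pairs *)

Section RandomPairs.

Variables (X C : finType) (e : rel X) (X0 : {set X}) (I J : finType).
Variables (F : I -> {set X}) (Z : J -> {set X}) (N d : R) (cl : seq C).
Hypothesis e_sym : symmetric e.
Hypothesis e_irr : irreflexive e.
Hypothesis N0 : 0 < N.
Hypothesis X0N : #|X0|%:R <= N.
Hypothesis F_sub : forall v, F v \subset X0.
Hypothesis d0 : 0 <= d.

Definition nonadj v : {set X * X} :=
  [set p | [&& p.1 \in F v, p.2 \in F v, p.1 != p.2 & ~~ e p.1 p.2]].

Hypothesis cl_uniq : uniq cl.
Hypothesis cl_small : 32 * (size cl)%:R <= N.
Hypothesis q_big : forall v, (8 * #|F v|%:R + 2) * d <= #|nonadj v|%:R / 4.
Hypothesis few : (#|{: J + I}|%:R + #|I|%:R) * exp (- d) < 1.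

(* [psec] sends the second member of a chosen pair to the first one. *)
Record pstate := PState { pcol : X -> option C; psec : X -> option X }.

(** An ordered pair of [X0] is drawn with probability [1 / N ^+ 2]; since [X0] may be smaller than
    [N], the missing mass goes to [None]. *)
Definition pmu (w : option (X * X)) : R :=
  match w with
  | Some p => if (p.1 \in X0) && (p.2 \in X0) then (N ^+ 2)^-1 else 0
  | None => 1 - #|X0|%:R ^+ 2 / N ^+ 2 end.

Definition psucc (s : pstate) (p : X * X) : bool :=
  [&& p.1 != p.2, ~~ e p.1 p.2, pcol s p.1 == None & pcol s p.2 == None].

Definition pstep (c : C) (s : pstate) (w : option (X * X)) : pstate :=
  match w with
  | Some p => if psucc s p then
      {| pcol := fun x => if (x == p.1) || (x == p.2) then Some c else pcol s x;
         psec := fun x => if x == p.2 then Some p.1 else psec s x |} else s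
  | None => s end.

Definition pinit : pstate := {| pcol := fun _ => None; psec := fun _ => None |}.

(** Only second members are collected, and the first member of the pair must lie in [F v] as well.
    First members have no [psec], so removing these sets loses no colour. *)
Definition gain v (s : pstate) : {set X} :=
  [set x in F v | if psec s x is Some y then y \in F v else false].
Definition removed v (s : pstate) : {set X * X} :=
  [set p in nonadj v | (pcol s p.1 != None) || (pcol s p.2 != None)].

Definition ppgood (don : seq C) (s : pstate) : Prop :=
  [/\ forall x c, pcol s x = Some c -> x \in X0 /\ c \in don,
      forall x y, e x y -> pcol s x <> None -> pcol s x <> pcol s y,
      forall x y, psec s x = Some y ->
        [/\ pcol s x <> None, pcol s y = pcol s x & psec s y = None],
      forall x, pcol s x = None -> psec s x = None &
      (#|[set x | pcol s x != None]| <= 2 * size don)%N].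

Lemma pmu_ge0 w : 0 <= pmu w.
Proof.
case: w => [p|] /=; first by case: ifP => // _; rewrite invr_ge0 sqr_ge0.
rewrite subr_ge0 ler_pdivrMr ?exprn_gt0 // mul1r.
by apply: lerXn2r; rewrite ?nnegrE ?ler0n // ltW.
Qed.

Lemma sum_pairs (h : X -> X -> R) :
  \sum_(p : X * X) (if (p.1 \in X0) && (p.2 \in X0) then h p.1 p.2 else 0) =
  \sum_(f in X0) \sum_(g in X0) h f g.
Proof.
rewrite -(pair_bigA _ (fun f g => if (f \in X0) && (g \in X0) then h f g else 0)) /=.
rewrite [RHS]big_mkcond; apply: eq_bigr => f _; case: (f \in X0) => /=; last by rewrite big1.
by rewrite [RHS]big_mkcond.
Qed.

Lemma pmu_sum : \sum_w pmu w = 1.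
Proof.
rewrite sum_option /= (sum_pairs (fun _ _ => (N ^+ 2)^-1)).
rewrite sumr_const sumr_const -mulrnA -[_ *+ (_ * _)]mulr_natl natrM -expr2.
by rewrite subrK.
Qed.

Lemma pmu_mean_le (G : option (X * X) -> R) (h : X -> R) : G None = 0 ->
  (forall x, 0 <= h x) -> (forall f g, G (Some (f, g)) <= h f + h g) ->
  \sum_w pmu w * G w <= 2 * (\sum_(f in X0) h f) / N.
Proof.
move=> h0 hp hG; rewrite sum_option h0 mulr0 add0r.
set H := \sum_(f in X0) h f.
have H0 : 0 <= H by apply: sumr_ge0.
apply: (@le_trans _ _ (\sum_(p : X * X)
   (if (p.1 \in X0) && (p.2 \in X0) then (N ^+ 2)^-1 * (h p.1 + h p.2) else 0))).
  apply: ler_sum => -[f g] _ /=; case: ifP => _; last by rewrite mul0r.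
  by rewrite ler_wpM2l ?hG // invr_ge0 sqr_ge0.
rewrite (sum_pairs (fun f g => (N ^+ 2)^-1 * (h f + h g))).
have -> : \sum_(f in X0) \sum_(g in X0) (N ^+ 2)^-1 * (h f + h g) = (N ^+ 2)^-1 * (2 * #|X0|%:R * H).
  under eq_bigr => f _ do rewrite -mulr_sumr big_split /= sumr_const -/H.
  rewrite -mulr_sumr big_split /= sumr_const; congr (_ * _).
  have -> : \sum_(i in X0) h i *+ #|X0| = H *+ #|X0| by rewrite -sumrMnl.
  by rewrite -mulr_natl; ring.
have -> : 2 * H / N = (N ^+ 2)^-1 * (2 * N * H) by field; rewrite lt0r_neq0.
by rewrite ler_wpM2l ?invr_ge0 ?sqr_ge0 // ler_wpM2r // ler_wpM2l.
Qed.

Lemma pmu_mean_ge (G : option (X * X) -> R) (A : {set X * X}) : G None = 0 ->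
  (forall p, p \in A -> p.1 \in X0 /\ p.2 \in X0) -> (forall p, 0 <= G (Some p)) ->
  (forall p, p \in A -> 1 <= G (Some p)) -> #|A|%:R / N ^+ 2 <= \sum_w pmu w * G w.
Proof.
move=> h0 hA hG hG1; rewrite sum_option h0 mulr0 add0r.
rewrite -sum1_card natr_sum mulr_suml big_mkcond /=; apply: ler_sum => p _.
have i0 : 0 <= (N ^+ 2)^-1 by rewrite invr_ge0 sqr_ge0.
case: ifP => pA; last by rewrite mulr_ge0 //; case: ifP.
have [-> ->] := hA p pA; rewrite /= mul1r -[X in X <= _]mulr1 ler_wpM2l ?hG1 //.
Qed.

Lemma pstep_good don c s w : c \notin don -> ppgood don s -> 0 < pmu w ->
  ppgood (rcons don c) (pstep c s w).
Proof.
move=> cd gs; have [h1 h2 h3 h4 h5] := gs.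
have triv : ppgood (rcons don c) s.
  split=> //; last by rewrite size_rcons; apply: leq_trans h5 _; rewrite leq_mul2l leqnSn.
  by move=> x c' px; have [a b] := h1 _ _ px; rewrite mem_rcons inE b orbT.
case: w => [[f g]|] //=; case: ifP; last by rewrite ltxx.
move=> /andP [fX gX] _; case: ifP => // /and4P [/= fg nfg /eqP pf /eqP pg].
have fresh x : pcol s x <> Some c.
  by move=> px; case/negP: cd; exact: (h1 _ _ px).2.
split=> /=.
- move=> x c'; rewrite mem_rcons inE; case: ifP => [/orP [/eqP ->|/eqP ->] [<-]|_ px].
  + by rewrite eqxx.
  + by rewrite eqxx.
  by have [a b] := h1 _ _ px; rewrite b orbT.
- move=> x y exy; case: ifP => hx; case: ifP => hy.
  + move: exy; case/orP: hx => /eqP ->; case/orP: hy => /eqP ->; rewrite ?e_irr //.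
      by rewrite (negbTE nfg).
    by rewrite e_sym (negbTE nfg).
  + by move=> _ /esym; exact: fresh.
  + by move=> _; exact: fresh.
  exact: h2.
- move=> x y; case: (x =P g) => [->|xg].
    by case=> <-; rewrite orbT eqxx /= (negbTE fg) h4.
  move=> sx; have [a b c'] := h3 _ _ sx.
  have xf : (x == f) = false by apply/eqP => ex; case: a; rewrite ex.
  have yf : (y == f) = false by apply/eqP => ey; apply: a; rewrite -b ey.
  have yg : (y == g) = false by apply/eqP => ey; apply: a; rewrite -b ey.
  by rewrite xf yf yg.
- move=> x; case: ifP => // /norP [_ /negbTE ->]; exact: h4.
rewrite size_rcons mulnS; apply: (@leq_trans (#|[set f; g]| + #|[set x | pcol s x != None]|)).
  apply: leq_trans (leq_card_setU _ _).1; apply/subset_leq_card/subsetP => x.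
  by rewrite !inE; case: ifP.
by rewrite leq_add // cards2; case: (f == g).
Qed.

Lemma dm_pstep c s w Y :
  (0 : R) <= #|dm (pcol (pstep c s w)) Y|%:R - #|dm (pcol s) Y|%:R <= (2 : R) /\
  forall f g, w = Some (f, g) ->
    #|dm (pcol (pstep c s w)) Y|%:R - #|dm (pcol s) Y|%:R <= (f \in Y)%:R + (g \in Y)%:R :> R.
Proof.
case: w => [[f g]|] /=; last by rewrite subrr lexx ler0n.
case: ifP => h; last by rewrite subrr lexx ler0n; split=> // ? ? _; rewrite addr_ge0 ?ler0n.
set s' := PState _ _.
have h1 : (#|dm (pcol s) Y| <= #|dm (pcol s') Y|)%N.
  apply/subset_leq_card/subsetP => x; rewrite !inE /= => /andP [-> hx] /=; by case: ifP.
have h2 : (#|dm (pcol s') Y| <= #|dm (pcol s) Y| + ((f \in Y) + (g \in Y)))%N.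
  apply: (@leq_trans #|dm (pcol s) Y :|: ([set f] :&: Y) :|: ([set g] :&: Y)|).
    apply/subset_leq_card/subsetP => x; rewrite !inE /= => /andP [-> hx] /=.
    by move: hx; case: (x == f) => //=; case: (x == g); rewrite ?orbT //= => ->.
  have hc z : (#|[set z] :&: Y| <= (z \in Y))%N.
    case: (boolP (z \in Y)) => hz; first by rewrite (leq_trans (subset_leq_card (subsetIl _ _))) ?cards1.
    rewrite leqn0 cards_eq0; apply/eqP/setP => x; rewrite !inE.
    by case: (x =P z) => [->|]; rewrite ?(negbTE hz).
  apply: leq_trans (leq_card_setU _ _).1 _; rewrite addnA leq_add //.
  by apply: leq_trans (leq_card_setU _ _).1 _; rewrite leq_add.
split=> [|f' g' [<- <-]]; last by rewrite lerBlDr -!natrD ler_nat addnC.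
rewrite subr_ge0 ler_nat h1 lerBlDr -natrD ler_nat (leq_trans h2) // addnC leq_add2r.
by rewrite -[2%N]/(1 + 1)%N leq_add ?leq_b1.
Qed.

Definition ndeg v x : nat := #|[set y | (x, y) \in nonadj v]|.

Lemma ndeg_sum v : \sum_(x in X0) (ndeg v x)%:R = #|nonadj v|%:R :> R.
Proof.
rewrite -natr_sum; congr (_%:R).
have e1 x : ndeg v x = (\sum_y ((x, y) \in nonadj v))%N.
  by rewrite /ndeg -sum1_card big_mkcond /=; apply: eq_bigr => y _; rewrite inE; case: (_ \in _).
rewrite big_mkcond /= (eq_bigr (fun x => \sum_y ((x, y) \in nonadj v)))%N.
  rewrite (pair_bigA _ (fun x y => ((x, y) \in nonadj v) : nat)) /= -sum1_card [RHS]big_mkcond /=.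
  by apply: eq_bigr => -[x y] _; case: (_ \in _).
move=> x _; case: (boolP (x \in X0)) => // xX; apply/esym/eqP; rewrite sum_nat_eq0.
apply/forallP => y; apply/implyP => _; rewrite eqb0 inE /=.
by apply: contra xX => /andP [h _]; exact: subsetP (F_sub v) _ h.
Qed.

Lemma ndeg_le v x : (ndeg v x <= #|F v|)%N.
Proof.
by apply/subset_leq_card/subsetP => y; rewrite !inE /= => /and3P [].
Qed.

(** Colouring [f] and [g] spoils only the pairs having one of them as a coordinate, and there are at
    most [2 * ndeg] of these for each. *)
Lemma removed_pstep c v s w :
  (0 : R) <= #|removed v (pstep c s w)|%:R - #|removed v s|%:R <= 4 * #|F v|%:R + (1 : R) /\
  forall f g, w = Some (f, g) ->
    #|removed v (pstep c s w)|%:R - #|removed v s|%:R <= 2 * (ndeg v f)%:R + 2 * (ndeg v g)%:R :> R.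
Proof.
case: w => [[f g]|] /=; last by rewrite subrr lexx addr_ge0 // mulr_ge0.
case: ifP => h; last first.
  rewrite subrr lexx addr_ge0 ?mulr_ge0 //; split=> // ? ? _; by rewrite addr_ge0 ?mulr_ge0.
set s' := PState _ _.
have h1 : (#|removed v s| <= #|removed v s'|)%N.
  apply/subset_leq_card/subsetP => p; rewrite !inE /= => /andP [-> hx] /=.
  by case/orP: hx => hx; apply/orP; [left|right]; case: ifP.
have row x : (#|[set p in nonadj v | p.1 == x]| <= ndeg v x)%N.
  have -> : ndeg v x = #|(fun y => (x, y)) @: [set y | (x, y) \in nonadj v]|.
    by rewrite card_imset // => y z [].
  apply/subset_leq_card/subsetP => -[y z]; rewrite inE => /andP [hp /eqP /= exy].
  by apply/imsetP; exists z; [rewrite in_set -exy | rewrite exy].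
have col x : (#|[set p in nonadj v | p.2 == x]| <= ndeg v x)%N.
  have -> : ndeg v x = #|(fun y => (y, x)) @: [set y | (x, y) \in nonadj v]|.
    by rewrite card_imset // => y z [].
  apply/subset_leq_card/subsetP => -[y z]; rewrite inE => /andP [hp /eqP /= exy].
  apply/imsetP; exists y; last by rewrite exy.
  move: hp; rewrite !inE /= exy => /and4P [-> -> yx nyx] /=.
  by rewrite eq_sym yx e_sym.
have h2 : (#|removed v s'| <= #|removed v s| + (2 * ndeg v f + 2 * ndeg v g))%N.
  pose A x := [set p in nonadj v | p.1 == x] :|: [set p in nonadj v | p.2 == x].
  have hA x : (#|A x| <= 2 * ndeg v x)%N.
    by rewrite mul2n -addnn; apply: leq_trans (leq_card_setU _ _).1 _; rewrite leq_add.
  apply: (@leq_trans #|removed v s :|: A f :|: A g|).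
    apply/subset_leq_card/subsetP => p; rewrite in_set => /andP [hp hx].
    have eA x : (p \in A x) = (p.1 == x) || (p.2 == x) by rewrite in_setU in_set hp in_set hp.
    rewrite in_setU eA in_setU eA in_set hp.
    move: hx => /=; case: (p.1 == f) => /=; first by rewrite !orbT.
    case: (p.1 == g) => /=; first by rewrite !orbT.
    case: (p.2 == f) => /=; first by rewrite !orbT.
    by case: (p.2 == g) => /=; rewrite ?orbT // => ->.
  apply: leq_trans (leq_card_setU _ _).1 _; rewrite addnA leq_add //.
  by apply: leq_trans (leq_card_setU _ _).1 _; rewrite leq_add.
have h3 : #|removed v s'|%:R - #|removed v s|%:R <= 2 * (ndeg v f)%:R + 2 * (ndeg v g)%:R :> R.
  by rewrite lerBlDr -!natrM -!natrD ler_nat addnC.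
split=> [|f' g' [<- <-]] //.
rewrite subr_ge0 ler_nat h1 /=; apply: (le_trans h3).
have hf : (ndeg v f)%:R <= #|F v|%:R :> R by rewrite ler_nat ndeg_le.
have hg : (ndeg v g)%:R <= #|F v|%:R :> R by rewrite ler_nat ndeg_le.
lra.
Qed.

Lemma gain_pstep c v s w : ppgood (cl : seq C) s \/ (forall x, pcol s x = None -> psec s x = None) ->
  (0 : R) <= #|gain v (pstep c s w)|%:R - #|gain v s|%:R <= (1 : R) /\
  forall p, w = Some p -> p \in nonadj v -> p \notin removed v s ->
    1 <= #|gain v (pstep c s w)|%:R - #|gain v s|%:R :> R.
Proof.
move=> hs; have h4 : forall x, pcol s x = None -> psec s x = None by case: hs => [[]|].
case: w => [[f g]|] /=; last by rewrite subrr lexx ler01.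
case: ifP => h; last first.
  rewrite subrr lexx ler01; split=> // p [<-] hp; rewrite inE hp /= negb_or !negbK => hn.
  by move: hp; rewrite inE => /and4P [/= _ _ n1 n2]; move: h; rewrite /psucc /= n1 n2 hn.
case/and4P: h => /= fg nfg pf pg.
have ng : g \notin gain v s by rewrite inE h4 ?andbF //; exact/eqP.
set s' := PState _ _.
have gE : gain v s' = if (g \in F v) && (f \in F v) then g |: gain v s else gain v s.
  case: (boolP ((g \in F v) && (f \in F v))) => hh; apply/setP => x.
    by rewrite in_setU1 in_set /= in_set; case: (x =P g) => [->|//]; rewrite hh.
  rewrite in_set /= in_set; case: (x =P g) => [->|//].
  by rewrite (negbTE hh) h4 ?andbF //; exact/eqP.
rewrite gE; split.
  case: ifP => _; last by rewrite subrr lexx ler01.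
  by rewrite cardsU1 ng natrD addrK lexx ler01.
move=> p [<-]; rewrite inE => /and4P [/= -> -> _ _] _.
by rewrite cardsU1 ng natrD addrK.
Qed.

(** While at least half of the non-adjacent pairs in [F v] are still free, a draw succeeds for [v]
    with probability at least [#|nonadj v| / (2 * N ^+ 2)]; the lower-tail bound halves the total
    once more. *)
Lemma random_pairs : exists s : pstate,
  [/\ ppgood cl s, forall j, #|dm (pcol s) (Z j)|%:R <= 4 * (size cl)%:R * #|Z j|%:R / N + 4 * d &
      forall v, (size cl)%:R * #|nonadj v|%:R / (4 * N ^+ 2) - 4 * d <= #|gain v s|%:R].
Proof.
pose fU (u : J + I) (s : pstate) : R := match u with
  | inl j => #|dm (pcol s) (Z j)|%:R | inr v => #|removed v s|%:R end.
pose bU (u : J + I) : R := match u with inl _ => 2 | inr v => 4 * #|F v|%:R + 1 end.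
pose pU (u : J + I) (c : C) : R := match u with
  | inl j => 2 * #|Z j|%:R / N | inr v => 4 * #|nonadj v|%:R / N end.
pose fV v (s : pstate) : R := #|gain v s|%:R.
pose pV v (c : C) : R := #|nonadj v|%:R / (2 * N ^+ 2).
have sumc (don : seq C) (z : R) : \sum_(x <- don) z = (size don)%:R * z.
  by rewrite big_const_seq count_predT iter_addr_0 mulr_natl.
have rem0 v : removed v pinit = set0 by apply/setP => p; rewrite !inE /= andbF.
have gain0 v : gain v pinit = set0 by apply/setP => p; rewrite !inE /= andbF.
have dm0 Y : dm (pcol pinit) Y = set0 by apply/setP => p; rewrite !inE /= andbF.
have [||[j|v]|v|don c rest s exs gs hU hV|s [gs hU hV]] :=
  @counter_run pstate C (option (X * X)) (J + I)%type I cl ppgood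
    (fun don c s w => pmu w) pstep pinit d fU bU pU fV (fun _ => 1) pV.
- have z : [set x | pcol pinit x != None] = set0 by apply/setP => x; rewrite !inE.
  by split=> //; rewrite z cards0.
- exact: few.
- by rewrite /bU; lra.
- by rewrite /bU ltr_wpDl // mulr_ge0.
- exact: ltr01.
- have cd : c \notin don.
    by move: cl_uniq; rewrite exs cat_uniq /= negb_or => /and3P [_ /andP [->]].
  have sd : (size don)%:R <= (size cl)%:R :> R by rewrite ler_nat exs size_cat leq_addr.
  split.
  + exact: pmu_ge0.
  + exact: pmu_sum.
  + by move=> w; exact: pstep_good.
  + case=> [j|v].
    * split=> [w _|]; first by case: (dm_pstep c s w (Z j)).
      apply: le_trans (pmu_mean_le (h := fun x => (x \in Z j)%:R) _ _ _) _; rewrite /fU ?subrr //.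
      - by move=> f g; case: (dm_pstep c s (Some (f, g)) (Z j)) => _; exact.
      rewrite /pU; apply: ler_wpM2r; first by rewrite invr_ge0 ltW.
      apply: ler_wpM2l => //; rewrite -natr_sum ler_nat -sum1_card.
      rewrite big_mkcond [X in (_ <= X)%N]big_mkcond /=; apply: leq_sum => x _.
      by case: (x \in X0); case: (x \in Z j).
    * split=> [w _|]; first by case: (removed_pstep c v s w).
      apply: le_trans (pmu_mean_le (h := fun x => 2 * (ndeg v x)%:R) _ _ _) _; rewrite /fU ?subrr //.
      - by move=> x; rewrite mulr_ge0.
      - by move=> f g; case: (removed_pstep c v s (Some (f, g))) => _; exact.
      rewrite -mulr_sumr ndeg_sum /pU; apply: ler_wpM2r; first by rewrite invr_ge0 ltW.
      by rewrite mulrA -natrM.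
  + move=> v; have gs4 : ppgood cl s \/ (forall x, pcol s x = None -> psec s x = None).
      by right; case: gs.
    split=> [w _|]; first by case: (gain_pstep c v w gs4).
    (* At most a quarter of the pairs goes to twice the mean, by [cl_small], and at most a quarter
       to the deviation, by [q_big]. *)
    have hr : #|removed v s|%:R <= #|nonadj v|%:R / 2 :> R.
      have := hU (inr v); rewrite /fU /bU /pU rem0 cards0 add0r sumc => h.
      have h1 : (size don)%:R * (4 * #|nonadj v|%:R / N) <= #|nonadj v|%:R / 8.
        have -> : (size don)%:R * (4 * #|nonadj v|%:R / N) =
           4 * (size don)%:R / N * #|nonadj v|%:R by ring.
        rewrite [X in _ <= X]mulrC ler_wpM2r // ler_pdivrMr //; move: sd cl_small; lra.
      have := q_big v; lra.
    apply: le_trans (pmu_mean_ge (A := nonadj v :\: removed v s) _ _ _ _); rewrite /fV ?subrr //.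
    * have sub : removed v s \subset nonadj v by apply/subsetP => p; rewrite inE => /andP [].
      have -> : #|nonadj v :\: removed v s|%:R = #|nonadj v|%:R - #|removed v s|%:R :> R.
        by rewrite -(cardsID (removed v s) (nonadj v)) (setIidPr sub) natrD addrAC subrr add0r.
      have -> : pV v c = (#|nonadj v|%:R / 2) / N ^+ 2 by rewrite /pV; field; rewrite lt0r_neq0.
      by apply: ler_wpM2r; [rewrite invr_ge0 sqr_ge0 | lra].
    * move=> p; rewrite in_setD => /andP [_]; rewrite inE => /and4P [h1 h2 _ _].
      by split; exact: subsetP (F_sub v) _ _.
    * by move=> p; case: (gain_pstep c v (Some p) gs4) => /andP [].
    * move=> p; rewrite in_setD => /andP [h1 h2].
      by case: (gain_pstep c v (Some p) gs4) => _; exact.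
exists s; split=> // [j|v].
- have := hU (inl j); rewrite /fU /bU /pU dm0 cards0 add0r sumc.
  have -> : 2 * ((size cl)%:R * (2 * #|Z j|%:R / N)) = 4 * (size cl)%:R * #|Z j|%:R / N by ring.
  lra.
- have := hV v; rewrite /fV /pV gain0 cards0 add0r sumc mulr1.
  have -> : (size cl)%:R * (#|nonadj v|%:R / (2 * N ^+ 2)) / 2 =
     (size cl)%:R * #|nonadj v|%:R / (4 * N ^+ 2) by field; rewrite lt0r_neq0.
  by [].
Qed.

End RandomPairs.

(** * Counting with degrees and codegrees *)

Section Counting.

Variables (n t : nat) (X : finType) (ed : X -> {set 'I_n}).
Hypothesis codeg : forall i j, i != j -> (#|[set x | (i \in ed x) && (j \in ed x)]| <= t)%N.

Definition sz x : nat := #|ed x|.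

Lemma szE x : sz x = #|ed x|. Proof. by []. Qed.

Lemma card_meet (A B : {set 'I_n}) : #|A :&: B| = (\sum_(i in A) (i \in B))%N.
Proof.
rewrite -sum1_card big_mkcond [RHS]big_mkcond /=; apply: eq_bigr => i _.
by rewrite inE; case: (i \in A); case: (i \in B).
Qed.

(** Both sides count triples [(i, j, f)] with [i] in [A], [j] in [B] and both on [f]; disjointness
    makes [i] and [j] distinct. [codeg_self] is the same count with [A = B] and the diagonal
    removed. *)
Lemma codeg_prod (A B : {set 'I_n}) : [disjoint A & B] ->
  (\sum_f #|A :&: ed f| * #|B :&: ed f| <= #|A| * #|B| * t)%N.
Proof.
move=> dAB.
have -> : (\sum_f #|A :&: ed f| * #|B :&: ed f| =
   \sum_(i in A) \sum_(j in B) #|[set x | (i \in ed x) && (j \in ed x)]|)%N.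
  under eq_bigr => f _ do rewrite !card_meet big_distrlr /=.
  rewrite exchange_big /=; apply: eq_bigr => i _; rewrite exchange_big /=; apply: eq_bigr => j _.
  rewrite -sum1_card [RHS]big_mkcond /=; apply: eq_bigr => f _; rewrite inE.
  by case: (i \in _); case: (j \in _).
rewrite -mulnA -sum_nat_const; apply: leq_sum => i iA.
rewrite -sum_nat_const; apply: leq_sum => j jB; apply: codeg.
by apply: contraTneq jB => <-; rewrite (disjointFr dAB iA).
Qed.

Lemma codeg_self (A : {set 'I_n}) :
  (\sum_f #|A :&: ed f| * (#|A :&: ed f|).-1 <= #|A| * (#|A|).-1 * t)%N.
Proof.
have -> : (\sum_f #|A :&: ed f| * (#|A :&: ed f|).-1 =
   \sum_(i in A) \sum_(j in A :\ i) #|[set x | (i \in ed x) && (j \in ed x)]|)%N.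
  have e1 f : (#|A :&: ed f| * (#|A :&: ed f|).-1 =
      \sum_(i in A) \sum_(j in A :\ i) (i \in ed f) * (j \in ed f))%N.
    rewrite {1}card_meet big_distrl /=; apply: eq_bigr => i iA.
    rewrite -big_distrr /= -card_meet; case: (boolP (i \in ed f)) => // hi; congr (_ * _)%N.
    have -> : #|(A :\ i) :&: ed f| = #|(A :&: ed f) :\ i|.
      by apply: eq_card => j; rewrite !inE andbA.
    by rewrite [in LHS](cardsD1 i) inE iA hi.
  under eq_bigr => f _ do rewrite e1.
  rewrite exchange_big /=; apply: eq_bigr => i _; rewrite exchange_big /=; apply: eq_bigr => j _.
  rewrite -sum1_card [RHS]big_mkcond /=; apply: eq_bigr => f _; rewrite inE.
  by case: (i \in _); case: (j \in _).
rewrite -mulnA -sum_nat_const; apply: leq_sum => i iA.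
have -> : (#|A|).-1 = #|A :\ i| by rewrite (cardsD1 i A) iA.
rewrite -sum_nat_const; apply: leq_sum => j; rewrite !inE => /andP [ji _]; apply: codeg.
by rewrite eq_sym.
Qed.

Lemma predr_nat (k : nat) : (0 < k)%N -> (k.-1)%:R = k%:R - 1 :> R.
Proof. by case: k => // k _; rewrite -natr1 addrK. Qed.

Lemma mulr_pred (k : nat) : (k * k.-1)%:R = k%:R * (k%:R - 1) :> R.
Proof. by case: k => [|k]; rewrite ?mul0n ?mul0r // natrM predr_nat. Qed.

Definition nbr e : {set X} := [set f | adj ed e f].
Definition upn e : {set X} := [set f in nbr e | (sz e <= sz f)%N].

Lemma deg_sum i (Y : {set X}) : (forall f, f \in Y -> i \in ed f) ->
  \sum_(f in Y) ((sz f)%:R - 1) <= t%:R * (n%:R - 1) :> R.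
Proof.
move=> hY; have n0 : (0 < n)%N := leq_ltn_trans (leq0n i) (ltn_ord i).
have h := @codeg_prod [set i] (~: [set i]) ltac:(by rewrite -setI_eq0 setICr).
rewrite cards1 mul1n cardsC1 card_ord in h.
rewrite -predr_nat // -natrM mulnC.
apply: (@le_trans _ _ (\sum_(f in Y) ((sz f).-1)%:R)).
  apply: ler_sum => f fY; rewrite predr_nat // /sz; apply/card_gt0P; exists i; exact: hY.
rewrite -natr_sum ler_nat (leq_trans _ h) // big_mkcond; apply: leq_sum => f _.
case: ifP => // fY; have hi := hY f fY.
have -> : #|[set i] :&: ed f| = 1%N by rewrite (setIidPl _) ?sub1set // cards1.
by rewrite mul1n /sz (cardsD1 i) hi setIC setDE.
Qed.

Lemma deg_count i (b : R) (Y : {set X}) : (forall f, f \in Y -> i \in ed f /\ b <= (sz f)%:R) ->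
  (b - 1) * #|Y|%:R <= t%:R * (n%:R - 1).
Proof.
move=> hY; apply: le_trans (deg_sum (i := i) (Y := Y) _); last by move=> f /hY [].
rewrite mulr_natr -sumr_const; apply: ler_sum => f /hY [_ h]; by rewrite lerD2r.
Qed.

Lemma nbr_count e (b : R) (Y : {set X}) : 1 < b ->
  (forall f, f \in Y -> adj ed e f /\ b <= (sz f)%:R) ->
  (b - 1) * #|Y|%:R <= (sz e)%:R * (t%:R * (n%:R - 1)).
Proof.
move=> b1 hY.
have h1 : (#|Y| <= \sum_(i in ed e) #|[set f in Y | i \in ed f]|)%N.
  apply: leq_trans (card_bigcup_le _ _); apply/subset_leq_card/subsetP => f fY.
  have [/adjP [_ [i ie fi]] _] := hY f fY.
  by apply/bigcupP; exists i => //; rewrite inE fY.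
apply: (@le_trans _ _ (\sum_(i in ed e) (b - 1) * #|[set f in Y | i \in ed f]|%:R)).
  rewrite -mulr_sumr; apply: ler_wpM2l; first by lra.
  by rewrite -natr_sum ler_nat.
rewrite mulr_natl -sumr_const; apply: ler_sum => i ie.
by apply: (deg_count (i := i)) => f; rewrite inE => /andP [/hY [_ h] ->].
Qed.

Lemma vol_sum (Y : {set X}) :
  \sum_(f in Y) (sz f)%:R * ((sz f)%:R - 1) <= t%:R * (n%:R * (n%:R - 1)) :> R.
Proof.
have := codeg_self [set: 'I_n]; rewrite cardsT card_ord => h.
apply: (@le_trans _ _ (\sum_(f in Y) (sz f * (sz f).-1)%:R)).
  by apply: ler_sum => f _; rewrite mulr_pred.
rewrite -natr_sum -mulr_pred -natrM mulnC ler_nat (leq_trans _ h) // big_mkcond.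
by apply: leq_sum => f _; case: ifP => // _; rewrite setTI.
Qed.

Section KeyInequality.
Variable e : X.
Let r : R := (sz e)%:R.
Let a f : R := #|ed e :&: ed f|%:R.
Let w f : R := a f * ((sz f)%:R - a f) + a f * (a f - 1) / r.
(** The distance from a projective plane: it vanishes when [n = r ^+ 2 - r + 1], the number of
    points of a plane with [r] points on each line. *)
Definition slack : R := n%:R - 1 - (sz e)%:R * ((sz e)%:R - 1).

Let weight_total : (0 < sz e)%N -> \sum_f w f <= t%:R * (r * (n%:R - r) + (r - 1)).
Proof.
move=> re; have r0 : 0 < r by rewrite ltr0n.
have h1 := @codeg_prod (ed e) (~: ed e) ltac:(by rewrite -setI_eq0 setICr).
have h2 := codeg_self (ed e).
rewrite big_split /= -mulr_suml mulrDr; apply: lerD.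
  have -> : \sum_i a i * ((sz i)%:R - a i) = (\sum_f #|ed e :&: ed f| * #|~: ed e :&: ed f|)%:R.
    rewrite natr_sum; apply: eq_bigr => f _; rewrite natrM; congr (_ * _).
    by rewrite /sz -(cardsID (ed e) (ed f)) setIC natrD addrAC subrr add0r setDE setIC.
  have -> : t%:R * (r * (n%:R - r)) = (#|ed e| * #|~: ed e| * t)%:R.
    have -> : #|~: ed e| = (n - sz e)%N by rewrite cardsCs setCK card_ord.
    rewrite !natrM natrB; first by rewrite /r /sz; ring.
    by rewrite -[X in (_ <= X)%N]card_ord max_card.
  by rewrite ler_nat.
rewrite ler_pdivrMr //.
have -> : \sum_i a i * (a i - 1) = (\sum_f #|ed e :&: ed f| * (#|ed e :&: ed f|).-1)%:R.
  by rewrite natr_sum; apply: eq_bigr => f _; rewrite mulr_pred.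
have -> : t%:R * (r - 1) * r = (#|ed e| * (#|ed e|).-1 * t)%:R.
  by rewrite natrM mulr_pred /r /sz; ring.
by rewrite ler_nat.
Qed.

Let a_bounds f : 0 <= a f <= r /\ a f <= (sz f)%:R /\ (adj ed e f -> 1 <= a f).
Proof.
rewrite ler0n ler_nat subset_leq_card ?subsetIl //; split=> //; split.
  by rewrite ler_nat subset_leq_card ?subsetIr.
case/adjP => _ [i h1 h2]; rewrite (ler_nat _ 1); apply/card_gt0P; exists i; by rewrite inE h1.
Qed.

(* Weigh f by [a f * (sz f - a f) + a f * (a f - 1) / r]: the codegrees bound the total,
   and a neighbour at least as large as e weighs at least [r - 1]. *)
Lemma key_inequality (Y : {set X}) : (2 <= sz e)%N ->
  (forall f, f \in Y -> adj ed e f /\ (sz f < sz e)%N) ->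
  (r - 1) * (#|upn e|%:R + 1 - t%:R * n%:R) + \sum_(f in upn e) ((sz f)%:R - r) +
   (\sum_(f in Y) (sz f)%:R * ((sz f)%:R - 1)) / r <= t%:R * slack.
Proof.
move=> re hY; have r2 : 2 <= r by rewrite (ler_nat _ 2).
have r0 : 0 < r by lra.
have := weight_total (ltnW re).
have -> : t%:R * (r * (n%:R - r) + (r - 1)) = (r - 1) * (t%:R * n%:R) + t%:R * slack.
  by rewrite /slack -/r; ring.
have w0 f : 0 <= w f.
  have [/andP [h1 h2] [h3 _]] := a_bounds f; rewrite /w; apply: addr_ge0.
    by apply: mulr_ge0; rewrite ?subr_ge0.
  apply: mulr_ge0; last by rewrite invr_ge0 ltW.
  by rewrite -mulr_pred.
have hsplit : w e + \sum_(f in upn e) w f + \sum_(f in Y) w f <= \sum_f w f.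
  rewrite [X in _ <= X](bigD1 e) //= -addrA lerD2l [X in _ <= X](bigID (fun f => f \in upn e)) /=.
  apply: lerD.
    rewrite [X in _ <= X](eq_bigl (fun f => f \in upn e)) // => f.
    by rewrite andbC; case: (boolP (f \in upn e)) => //; rewrite !inE => /andP [/andP [h _] _]; rewrite eq_sym.
  rewrite [X in _ <= X](bigID (fun f => f \in Y)) /= -[X in X <= _]addr0; apply: lerD; last exact: sumr_ge0.
  rewrite [X in _ <= X](eq_bigl (fun f => f \in Y)) // => f.
  rewrite andbC; case: (boolP (f \in Y)) => // /hY [h1 h2].
  by rewrite eq_sym !inE h1 leqNgt h2 andbT /=; case/andP: h1.
have we : w e = r - 1 by rewrite /w /a setIid -/(sz e) -/r subrr mulr0 add0r mulrAC divff ?mul1r // lt0r_neq0.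
have hF : (r - 1) * #|upn e|%:R + \sum_(f in upn e) ((sz f)%:R - r) <= \sum_(f in upn e) w f.
  rewrite mulr_natr -sumr_const -big_split /=; apply: ler_sum => f.
  rewrite !inE => /andP [af]; rewrite -(ler_nat R) -/r => rf.
  have [/andP [h1 h2] [h3 h4]] := a_bounds f; have {h4} h4 := h4 af.
  (* The middle term is nonnegative as [1 <= a f <= r], and [a f >= 1] lets the first be replaced by
     [sz f - r]. *)
  have e1 : w f = a f * ((sz f)%:R - r) + (a f - 1) * (r - a f) * (r - 1) / r + (r - 1).
    by rewrite /w; field; rewrite lt0r_neq0.
  rewrite e1 addrC lerD2r; apply: (@le_trans _ _ (a f * ((sz f)%:R - r))).
    by rewrite ler_peMl // subr_ge0.
  rewrite lerDl; apply: mulr_ge0; last by rewrite invr_ge0 ltW.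
  by apply: mulr_ge0; [apply: mulr_ge0; rewrite subr_ge0|lra].
have hYs : (\sum_(f in Y) (sz f)%:R * ((sz f)%:R - 1)) / r <= \sum_(f in Y) w f.
  rewrite mulr_suml; apply: ler_sum => f fY; have [af lf] := hY f fY.
  have [/andP [h1 h2] [h3 h4]] := a_bounds f; have {h4} h4 := h4 af.
  have lf' : (sz f)%:R + 1 <= r by rewrite natr1 ler_nat.
  (* The second term is nonnegative: [a f * (r - 1) >= r - 1 >= sz f], because smaller edges have
     size at most [r - 1]. *)
  have -> : w f = (sz f)%:R * ((sz f)%:R - 1) / r +
      ((sz f)%:R - a f) * (a f * (r - 1) - (sz f)%:R + 1) / r by rewrite /w; field; rewrite lt0r_neq0.
  rewrite lerDl; apply: mulr_ge0; last by rewrite invr_ge0 ltW.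
  apply: mulr_ge0; first by rewrite subr_ge0.
  have : (r - 1) <= a f * (r - 1) by apply: ler_peMl => //; lra.
  lra.
lra.
Qed.

End KeyInequality.

End Counting.

(** * Common neighbours and non-adjacent pairs *)

Section Crossing.

Variables (n t : nat) (X : finType) (ed : X -> {set 'I_n}).
Hypothesis codeg : forall i j, i != j -> (#|[set x | (i \in ed x) && (j \in ed x)]| <= t)%N.
Notation sz := (sz ed).
Notation nbr := (nbr ed).
Notation upn := (upn ed).

(** A common neighbour avoiding [i] meets [e] and [f] in points other than [i], so [codeg_prod]
    applies to the two edges without [i]. *)
Lemma common_nbrs e f i (S : {set X}) : ed e :&: ed f = [set i] -> S \subset nbr e ->
  (#|S :&: nbr f| <= #|[set g in S | (i \in ed g) && (g != f)]| + t * ((sz e).-1 * (sz f).-1))%N.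
Proof.
move=> ef SN; have : i \in ed e :&: ed f by rewrite ef set11.
rewrite inE => /andP [ie jf].
set A := ed e :\ i; set B := ed f :\ i.
have dAB : [disjoint A & B].
  rewrite -setI_eq0; apply/eqP/setP => j; rewrite !inE.
  have : (j \in ed e :&: ed f) = (j == i) by rewrite ef inE.
  by rewrite inE; case: (j == i) => //=; case: (j \in ed e) => //= ->.
have cA : #|A| = (sz e).-1 by rewrite szE (cardsD1 i (ed e)) ie.
have cB : #|B| = (sz f).-1 by rewrite szE (cardsD1 i (ed f)) jf.
rewrite -cA -cB mulnC; apply: leq_trans (leq_add (leqnn _) (codeg_prod codeg dAB)).
set S1 := [set g in S | _].
rewrite -(cardsID S1 (S :&: nbr f)); apply: leq_add.
  by apply/subset_leq_card/subsetIr.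
rewrite -sum1_card big_mkcond; apply: leq_sum => g _; case: ifP => // hg.
move: hg; rewrite in_setD in_setI /S1 !inE => /andP [h1 /andP [gS /adjP [fg [j jf' jg]]]].
have := subsetP SN _ gS; rewrite inE => /adjP [_ [j' je' jg']].
rewrite gS /= eq_sym fg andbT in h1.
rewrite muln_gt0; apply/andP; split; apply/card_gt0P.
  by exists j'; rewrite !inE je' jg' !andbT; apply: contraNneq h1 => <-.
by exists j; rewrite !inE jf' jg !andbT; apply: contraNneq h1 => <-.
Qed.

(** An edge meeting [e] in at least two points contributes at least 2 to the sum in [codeg_self]. *)
Lemma multi_meet e (S : {set X}) :
  (#|[set f in S | (1 < #|ed e :&: ed f|)%N]| * 2 <= sz e * (sz e).-1 * t)%N.
Proof.
apply: leq_trans (codeg_self codeg (ed e)).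
rewrite -sum_nat_const big_mkcond; apply: leq_sum => f _; case: ifP => //.
rewrite inE => /andP [_]; case: #|_| => [|[|k]] // _; lia.
Qed.

Definition nonadjacent_pairs (F : {set X}) : {set X * X} :=
  [set p | [&& p.1 \in F, p.2 \in F, p.1 != p.2 & ~~ adj ed p.1 p.2]].

Lemma nonadjacent_pairs_ge (F F1 : {set X}) (m : X -> R) : F1 \subset F ->
  (forall f, f \in F1 -> #|F|%:R - 1 - #|F :&: nbr f|%:R >= m f) ->
  \sum_(f in F1) m f <= #|nonadjacent_pairs F|%:R.
Proof.
move=> F1F hm.
have e1 : (\sum_(f in F1) #|[set g | (f, g) \in nonadjacent_pairs F]| <= #|nonadjacent_pairs F|)%N.
  rewrite -[X in (_ <= X)%N]sum1_card (eq_bigl (fun p => true && ((p.1, p.2) \in nonadjacent_pairs F))) => [|[a b]] //=.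
  rewrite -(pair_big_dep predT (fun f g => (f, g) \in nonadjacent_pairs F) (fun _ _ => 1%N)) /=.
  rewrite big_mkcond; apply: leq_sum => f _; case: ifP => // _.
  by rewrite -sum1_card; apply: eq_leq; apply: eq_bigl => g; rewrite inE.
apply: le_trans (_ : (\sum_(f in F1) #|[set g | (f, g) \in nonadjacent_pairs F]|)%:R <= _); last by rewrite ler_nat.
rewrite natr_sum; apply: ler_sum => f f1; apply: le_trans (hm f f1) _.
have fF := subsetP F1F _ f1.
have -> : [set g | (f, g) \in nonadjacent_pairs F] = (F :\ f) :\: nbr f.
  by apply/setP => g; rewrite !inE /= fF eq_sym; case: (g == f); case: (g \in F); case: (adj _ _ _).
have h1 : (#|F :\ f| <= #|(F :\ f) :\: nbr f| + #|F :&: nbr f|)%N.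
  rewrite -(cardsID (nbr f) (F :\ f)) addnC leq_add2l.
  by apply/subset_leq_card/setSI/subD1set.
have h2 : #|F| = #|F :\ f|.+1 by rewrite (cardsD1 f F) fF.
move: h1; rewrite h2 -(ler_nat R) natrD -natr1; lra.
Qed.

(** At least [K / 2 - g] members [f] meet [e] in one point. Of the other members, [f] misses at
    least [M] less [t * (r - 1)] for each unit by which [f] exceeds [r], and [key_inequality] bounds
    the sum of these excesses. *)
Lemma nonadjacent_upn e (g : R) : (3 <= sz e)%N -> 0 <= g -> 0 <= slack ed e ->
  let r : R := (sz e)%:R in let K := t%:R * n%:R in
  let M := t%:R * slack ed e * (1 - (r - 1)^-1) - g in
  K - g <= #|upn e|%:R -> 0 <= M ->
  (K / 2 - g) * M - t%:R * (r - 1) * (t%:R * slack ed e + (r - 1) * g) <= #|nonadjacent_pairs (upn e)|%:R.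
Proof.
move=> re g0 s0 r K M hF M0.
have r3 : 3 <= r by rewrite (ler_nat _ 3).
set F := upn e; set F1 := [set f in F | #|ed e :&: ed f| == 1%N].
set s := slack ed e in s0 M M0 *.
have t0 : (0 : R) <= t%:R by [].
have hs : s = n%:R - 1 - r * (r - 1) by [].
have KI : \sum_(f in F) ((sz f)%:R - r) <= t%:R * s + (r - 1) * g.
  have := key_inequality codeg (e := e) (Y := set0) (ltnW re).
  rewrite big_set0 mul0r addr0 => /(_ ltac:(by move=> f; rewrite inE)).
  rewrite -/r -/s -/F -/K => h.
  have : 0 <= (r - 1) * (#|F|%:R + 1 - K + g) by apply: mulr_ge0; lra.
  move: h; rewrite !(mulrDr (r - 1)); lra.
have FN f : f \in F -> adj ed e f by rewrite !inE => /andP [].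
have Fsz f : f \in F -> r <= (sz f)%:R by rewrite !inE => /andP [_]; rewrite ler_nat.
have hF1 : K / 2 - g <= #|F1|%:R.
  have h := multi_meet e F.
  have h2 : #|F| = (#|F1| + #|[set f in F | (1 < #|ed e :&: ed f|)%N]|)%N.
    rewrite -(cardsID F1 F); congr addn; first by rewrite (setIidPr _) //; apply/subsetP => f; rewrite inE => /andP [].
    apply: eq_card => f; rewrite in_setD [f \in F1]in_set [RHS]in_set.
    case: (boolP (f \in F)) => [fF|_]; rewrite ?andbF //= andbT.
    have := FN _ fF; case/adjP => _ [i h3 h4].
    have : (0 < #|ed e :&: ed f|)%N by apply/card_gt0P; exists i; rewrite inE h3.
    by case: #|_| => [|[|]].
  move: h; rewrite -(ler_nat R) !natrM -/(sz e) -[X in _ <= X * _]natrM mulr_pred -/r => h.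
  have : (#|F|%:R : R) = #|F1|%:R + #|[set f in F | (1 < #|ed e :&: ed f|)%N]|%:R by rewrite h2 natrD.
  have : r * (r - 1) * t%:R <= K.
    rewrite /K mulrC; apply: ler_wpM2l => //; lra.
  lra.
pose m f := M - t%:R * (r - 1) * ((sz f)%:R - r).
have hm : \sum_(f in F1) m f <= #|nonadjacent_pairs F|%:R.
  apply: nonadjacent_pairs_ge; first by apply/subsetP => f; rewrite inE => /andP [].
  move=> f; rewrite inE => /andP [fF /cards1P [i hi]].
  have := common_nbrs hi (S := F) ltac:(by apply/subsetP => x /FN; rewrite inE).
  have : i \in ed e :&: ed f by rewrite hi set11.
  rewrite inE => /andP [ie jf].
  set D := [set _ in F | _] => hc.
  (* The edges [e] and [f] also pass through [i] and have size at least [r]; counting them accounts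
     for the 2. *)
  have hd : (r - 1) * (#|D|%:R + 2) <= t%:R * (n%:R - 1).
    have eF : e \in F = false by rewrite !inE adj_irr.
    have ef : (e == f) = false by apply/negbTE; have /adjP [] := FN _ fF.
    have cD : #|e |: (f |: D)|%:R = #|D|%:R + 2 :> R.
      rewrite !cardsU1 in_setU1 ef [e \in D]in_set eF [f \in D]in_set eqxx !andbF /= !natrD; lra.
    rewrite -cD; apply: (deg_count codeg (i := i)) => x.
    rewrite in_setU1 in_setU1 [x \in D]in_set => /or3P [/eqP ->|/eqP ->|/and3P [h1 h2 _]] //.
      by split=> //; exact: Fsz.
    by split=> //; exact: Fsz.
  have s1 : (sz e).-1%:R = r - 1 by rewrite predr_nat // (ltnW (ltnW re)).
  have s2 : (sz f).-1%:R = (sz f)%:R - 1 :> R.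
    by rewrite predr_nat //; apply/card_gt0P; exists i.
  move: hc; rewrite -(ler_nat R) natrD !natrM s1 s2 => hc.
  have hd2 : #|D|%:R + 2 <= t%:R * s * (r - 1)^-1 + t%:R * r.
    have -> : t%:R * s * (r - 1)^-1 + t%:R * r = t%:R * (n%:R - 1) / (r - 1).
      by rewrite hs; field; lra.
    rewrite ler_pdivlMr; last by lra.
    by rewrite mulrC.
  (* Since [n - 1 = slack + r * (r - 1)], all terms cancel except those with [slack], [g] and the
     excess of [f]. *)
  have e3 : m f = K - g - (t%:R * s * (r - 1)^-1 + t%:R * r) - t%:R * (r - 1) * ((sz f)%:R - 1).
    by rewrite /m /M /K hs; field; lra.
  rewrite e3; move: hF; rewrite -/F -mulrA; lra.
apply: le_trans hm; rewrite /m sumrB -mulr_sumr.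
rewrite sumr_const -[M *+ _]mulr_natl; apply: lerB.
  by apply: ler_wpM2r.
apply: ler_wpM2l; first by apply: mulr_ge0; lra.
apply: le_trans KI; rewrite big_mkcond [X in _ <= X]big_mkcond /=; apply: ler_sum => f _.
rewrite /F1 inE; case: (boolP (f \in F)) => //= fF; case: ifP => // _; rewrite subr_ge0; exact: Fsz.
Qed.

(** The threshold is the bound of [common_nbrs] for edges meeting [v] in one point, so an exception
    must meet [v] at least twice, and [multi_meet] applies. *)
Lemma window_crowded v (S : {set X}) (b1 b2 : R) : 1 < b1 -> S \subset nbr v ->
  (forall f, f \in S -> b1 <= (sz f)%:R <= b2) ->
  #|[set f in S | t%:R * n%:R / (b1 - 1) + t%:R * ((sz v)%:R * b2) < #|S :&: nbr f|%:R]|%:R <=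
    t%:R * (sz v)%:R ^+ 2 / 2 :> R.
Proof.
move=> b1_gt1 SN hS.
set P := [set f in S | _].
have h1 : (#|P| <= #|[set f in S | (1 < #|ed v :&: ed f|)%N]|)%N.
  apply/subset_leq_card/subsetP => f; rewrite [f \in P]in_set => /andP [fS hf].
  rewrite inE fS ltnNge /=; apply/negP => h.
  have := subsetP SN _ fS; rewrite inE => /adjP [_ [i iv jf]].
  have hi : ed v :&: ed f = [set i].
    by apply/eqP; rewrite eq_sym eqEcard sub1set inE iv jf /= cards1.
  have := common_nbrs hi SN; rewrite -(ler_nat R) natrD natrM.
  set D := [set _ in S | _] => hc.
  have hd : (b1 - 1) * #|D|%:R <= t%:R * (n%:R - 1).
    apply: (deg_count codeg (i := i)) => x; rewrite inE => /and3P [/hS /andP [h2 _] h3 _]; by split.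
  have hd2 : #|D|%:R <= t%:R * n%:R / (b1 - 1).
    rewrite ler_pdivlMr; last by lra.
    have := ler0n R t; lra.
  have h3 : t%:R * ((sz v).-1 * (sz f).-1)%:R <= t%:R * ((sz v)%:R * b2).
    apply: ler_wpM2l => //; rewrite natrM; apply: ler_pM; rewrite ?ler_nat ?leq_pred //.
    by have /andP [_] := hS _ fS; apply: le_trans; rewrite ler_nat leq_pred.
  by move: hf; lra.
have h2 := multi_meet v S.
have h3 : (#|P| * 2 <= t * (sz v * sz v))%N.
  apply: leq_trans (leq_trans h2 _); first by rewrite leq_mul2r h1 orbT.
  by rewrite mulnC !leq_mul // leq_pred.
move: h3; rewrite -(ler_nat R) !natrM expr2; lra.
Qed.

End Crossing.

(** * Partial colourings *)

Section PartialColorings.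

Variables (X C : finType) (e : rel X).
Hypothesis e_sym : symmetric e.
Implicit Types (phi psi : X -> option C) (v : X).

Definition dom phi : {set X} := [set x | phi x != None].
Definition proper phi := forall x y, e x y -> phi x <> None -> phi x <> phi y.
Definition extends phi psi := forall x, phi x <> None -> psi x = phi x.
Definition seen phi v : {set C} := [set c | [exists w, e v w && (phi w == Some c)]].

(* [doubled phi v D]: deleting [D] from the coloured neighbours of [v] loses no colour. *)
Definition doubled phi v (D : {set X}) :=
  forall w, w \in D -> e v w /\ exists w', [/\ e v w', w' \notin D, phi w <> None & phi w' = phi w].

Lemma in_dom phi x : (x \in dom phi) = (phi x != None).
Proof. by rewrite inE. Qed.

Lemma domP phi x : reflect (phi x <> None) (x \in dom phi).
Proof. by rewrite in_dom; apply: (iffP idP) => [/eqP|/eqP]. Qed.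

Lemma seenP phi v c : reflect (exists2 w, e v w & phi w = Some c) (c \in seen phi v).
Proof.
rewrite inE; apply: (iffP existsP) => [[w /andP [h1 /eqP h2]]|[w h1 h2]]; exists w => //.
by rewrite h1 h2 eqxx.
Qed.

Lemma extends_trans phi psi chi : extends phi psi -> extends psi chi -> extends phi chi.
Proof. by move=> h1 h2 x hx; rewrite h2 h1. Qed.

Lemma doubled_extends phi psi v D : extends phi psi -> doubled phi v D -> doubled psi v D.
Proof.
move=> hx hD w /hD [h1 [w' [h2 h3 h4 h5]]]; split=> //; exists w'.
by split; rewrite ?(hx w) // (hx w') // h5.
Qed.

(** Every colour seen at [v] still occurs outside [D]. This is how doubled vertices become
    savings. *)
Lemma card_seen phi v (D U : {set X}) : doubled phi v D ->
  (forall w, e v w -> w \in dom phi -> w \in U) -> D \subset U ->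
  (#|seen phi v| + #|D| <= #|U|)%N.
Proof.
move=> hD hU DU.
rewrite -(cardsID D U) (setIidPr DU) addnC leq_add2l.
pose f (w : X) : option C := phi w.
have : [set Some c | c in seen phi v] \subset [set f w | w in U :\: D].
  apply/subsetP => _ /imsetP [c /seenP [w h1 h2] ->].
  have hw : w \in dom phi by rewrite in_dom h2.
  case: (boolP (w \in D)) => wD.
    have [_ [w' [h3 h4 h5 h6]]] := hD w wD.
    apply/imsetP; exists w'; last by rewrite /f h6.
    by rewrite inE h4 hU // in_dom h6 h2.
  by apply/imsetP; exists w; rewrite ?inE ?wD ?hU.
move/subset_leq_card; rewrite card_imset; last by move=> a b [].
by move=> h; apply: leq_trans h (leq_imset_card _ _).
Qed.

Definition color_one phi v c : X -> option C := fun x => if x == v then Some c else phi x.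

Lemma color_one_proper phi v c : irreflexive e -> proper phi -> phi v = None -> c \notin seen phi v ->
  proper (color_one phi v c).
Proof.
move=> irr hp hv hc x y exy; rewrite /color_one.
case: (x =P v) => [xv|_]; case: (y =P v) => [yv|_].
- by move: exy; rewrite xv yv irr.
- move=> _ h; move/negP: hc; apply; apply/seenP; exists y => //; by rewrite -xv.
- move=> _ h; move/negP: hc; apply; apply/seenP; exists x => //; by rewrite -yv e_sym.
- exact: hp.
Qed.

Lemma greedy (rk : X -> nat) phi (A : {set X}) : irreflexive e -> proper phi ->
  (forall psi v, proper psi -> extends phi psi -> v \in A -> v \notin dom psi ->
     (forall x, x \in dom psi -> x \in dom phi \/ (x \in A /\ rk v <= rk x)%N) ->
     (#|seen psi v| < #|C|)%N) ->
  exists psi, [/\ proper psi, extends phi psi & dom psi = dom phi :|: A].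
Proof.
move=> irr pr hs.
(* The fourth clause encodes the decreasing order: nothing newly coloured ranks below an uncoloured
   vertex of [A]. *)
pose inv psi := [/\ proper psi, extends phi psi,
  forall x, x \in dom psi -> x \in dom phi \/ x \in A &
  forall x v, x \in dom psi -> x \notin dom phi -> v \in A -> v \notin dom psi -> (rk v <= rk x)%N].
suff [psi [h1 h2 h3 _] h4] : exists2 psi, inv psi & A \subset dom psi.
  exists psi; split=> //; apply/setP => x; rewrite in_setU; apply/idP/orP => [/h3 //|[/domP h|]].
    by apply/domP; rewrite h2.
  exact: (subsetP h4).
have start : inv phi by split=> // [x ->|x v ->]; [left|].
move: {2}#|A :\: dom phi| (leqnn #|A :\: dom phi|) => k.
move: (phi) start => chi start; elim: k chi start => [|k IH] chi start hk.
  exists chi => //; by rewrite -setD_eq0 -cards_eq0 -leqn0.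
case: (boolP (A \subset dom chi)) => hA; first by exists chi.
have [v0 hv0] : exists v, v \in A :\: dom chi by apply/set0Pn; rewrite setD_eq0.
case: (@arg_maxnP _ v0 (fun v => v \in A :\: dom chi) rk hv0) => v; rewrite inE => /andP [hv vA] vmax.
have [c1 c2 c3 c4] := start.
have hv' : chi v = None by apply/eqP; move: hv; rewrite in_dom negbK.
have /subsetPn [c _ hc] : ~~ ([set: C] \subset seen chi v).
  apply: contraL (hs chi v c1 c2 vA hv _) => [h|x hx].
    by rewrite -leqNgt -cardsT subset_leq_card.
  case: (boolP (x \in dom phi)) => hx0; [by left|right]; split; last exact: c4 hx hx0 vA hv.
  by case: (c3 _ hx) => // h; rewrite h in hx0.
have hd x : (x \in dom (color_one chi v c)) = (x == v) || (x \in dom chi).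
  by rewrite !in_dom /color_one; case: (x =P v).
apply: (IH (color_one chi v c)).
  split.
  - exact: color_one_proper.
  - move=> x hx; rewrite /color_one; case: (x =P v) => [xv|_]; last exact: c2.
    by have := c2 _ hx; rewrite xv hv' => h; move: hx; rewrite xv -h.
  - by move=> x; rewrite hd => /orP [/eqP ->|/c3]; [right|].
  - move=> x w; rewrite !hd negb_or => /orP [/eqP ->|hx] hx0 wA /andP [wv wd].
      by apply: vmax; rewrite inE wd.
    exact: c4 hx hx0 wA wd.
rewrite -ltnS; apply: leq_trans hk; apply: proper_card; apply/properP; split.
  by apply/subsetP => x; rewrite !in_setD hd negb_or => /andP [/andP [_ ->] ->].
by exists v; rewrite in_setD ?hd ?eqxx // hv vA.
Qed.

End PartialColorings.

(** * Sizes far below the square root of n *)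

(* [rho], [sig]: density of the random precolouring and of the repeated colours it
   yields; [kap]: threshold for a nearly full neighbourhood; sizes above [R1] are
   treated by windows. *)
Definition kap : R := (1 / 10) ^+ 5.
Definition rho : R := (1 / 10) ^+ 6.
Definition sig : R := (1 / 10) ^+ 22.
Definition R1 : R := 10 ^+ 26.

Section Windows.

Variables (n t : nat) (X C : finType) (ed : X -> {set 'I_n}).
Hypothesis codeg : forall i j, i != j -> (#|[set x | (i \in ed x) && (j \in ed x)]| <= t)%N.
Hypothesis t_gt0 : (0 < t)%N.
Hypothesis n_gt1 : (1 < n)%N.
Hypothesis cardC : #|C| = (t * n)%N.
Hypothesis cardX : (#|X| <= n * n)%N.
Let K : R := t%:R * n%:R.
Notation sz := (sz ed).
Notation nbr := (nbr ed).
Notation upn := (upn ed).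
Notation e := (adj ed).

Lemma K_gt0 : 0 < K.
Proof. by rewrite /K -natrM ltr0n muln_gt0 t_gt0 ltnW. Qed.

Lemma cardC_K : #|C|%:R = K :> R.
Proof. by rewrite cardC natrM. Qed.

Lemma nbr_count_K v (b : R) (Y : {set X}) : 1 < b ->
  (forall f, f \in Y -> e v f /\ b <= (sz f)%:R) -> (b - 1) * #|Y|%:R <= (sz v)%:R * K.
Proof.
move=> b1 hY; apply: le_trans (nbr_count codeg b1 hY) _.
apply: ler_wpM2l => //; rewrite /K; apply: ler_wpM2l => //; lra.
Qed.

Definition window (lo hi : R) v : {set X} := [set f in nbr v | lo <= (sz f)%:R < hi].

Lemma in_window lo hi v f : (f \in window lo hi v) = [&& e v f, lo <= (sz f)%:R & (sz f)%:R < hi].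
Proof. by rewrite /window inE [f \in nbr v]inE. Qed.


Lemma key_K v (Y : {set X}) : (2 <= sz v)%N ->
  (forall f, f \in Y -> e v f /\ (sz f < sz v)%N) ->
  ((sz v)%:R - 1) * (#|upn v|%:R + 1 - K) + \sum_(f in upn v) ((sz f)%:R - (sz v)%:R) +
   (\sum_(f in Y) (sz f)%:R * ((sz f)%:R - 1)) / (sz v)%:R <= K - t%:R.
Proof.
move=> v2 hY; apply: le_trans (key_inequality codeg v2 hY) _.
have r2 : (2 : R) <= (sz v)%:R by rewrite (ler_nat _ 2).
have -> : K - t%:R = t%:R * (n%:R - 1) by rewrite /K mulrBr mulr1.
apply: ler_wpM2l => //; rewrite /slack.
have : 0 <= (sz v)%:R * ((sz v)%:R - 1) :> R by apply: mulr_ge0; lra.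
lra.
Qed.

(** A larger edge exceeds [sz v] by more than half of [sz v], while in a nearly full neighbourhood
    the total excess is at most about [kap * sz v * K]. So few are larger. *)
Lemma upn_mostly_low v (b : R) : R1 <= (sz v)%:R -> b / 2 <= (sz v)%:R < b ->
  (1 - kap) * K <= #|upn v|%:R ->
  8 / 10 * K <= #|[set f in upn v | (sz f)%:R < 3 / 2 * b]|%:R.
Proof.
move=> vR /andP [bv vb] hU.
have K0 := K_gt0.
have R10 : 10 ^+ 4 <= R1 by rewrite /R1; lra.
have v2 : (2 <= sz v)%N by rewrite -(ler_nat R); lra.
have := key_K (v := v) (Y := set0) v2 ltac:(by move=> f; rewrite inE).
rewrite big_set0 mul0r addr0; set r : R := (sz v)%:R in vR bv vb *.
set S := \sum_(f in _) _ => h.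
set P := [set f in upn v | _]; set Q := upn v :\: P.
have PQ : #|upn v|%:R = #|P|%:R + #|Q|%:R :> R.
  rewrite -natrD -(cardsID P (upn v)) (setIidPr _) //; by apply/subsetP => f; rewrite inE => /andP [].
have hQ : r / 2 * #|Q|%:R <= S.
  rewrite mulr_natr -sumr_const /S big_mkcond [X in _ <= X]big_mkcond /=; apply: ler_sum => f _.
  rewrite [f \in Q]in_setD [f \in P]in_set.
  case: (boolP (f \in upn v)) => [|_]; last by rewrite andbF.
  rewrite andbT /= => fu; have : r <= (sz f)%:R by move: fu; rewrite inE => /andP [_]; rewrite ler_nat.
  case: ltP => /= [|h1] h2; last by move: vb h1; lra_above K.
  by rewrite subr_ge0.
have h2 : (r - 1) * (- kap * K) <= (r - 1) * (#|upn v|%:R + 1 - K).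
  by apply: ler_wpM2l; move: hU R10 vR; lra_above K.
have h3 : r / 2 * #|Q|%:R <= K + r * kap * K.
  have : 0 <= kap * K by rewrite mulr_ge0 // ?ltW // /kap; lra_above K.
  have : (0 : R) <= t%:R by [].
  by move: h h2 hQ; lra_above K.
have kap_small : kap <= 1 / 10 ^+ 3 by rewrite /kap; lra_above K.
have h4 : #|Q|%:R <= K / 10.
  have r0 : 0 < r / 2 by move: R10 vR; lra_above K.
  rewrite -(ler_pM2l r0); apply: le_trans h3 _.
  have : 0 <= K * (r * (1 / 20 - kap) - 1); last by lra_above K.
  apply: mulr_ge0; first by move: K0; lra_above K.
  have : r * (1 / 100) <= r * (1 / 20 - kap) by apply: ler_wpM2l; move: kap_small R10 vR; lra_above K.
  by move: R10 vR; lra_above K.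
have : kap * K <= 1 / 10 * K by apply: ler_wpM2r; move: kap_small K0; lra_above K.
by move: hU PQ h4; lra_above K.
Qed.

(** If the neighbourhood is not nearly full, the gap [kap * K] absorbs [Y']. Otherwise [key_K] with
    [Y] shows that each smaller neighbour of comparable size costs the larger ones at least 1/10; as
    only a fraction [2 * rho] of [Y] is coloured, [Y'] is paid for, and [D] covers the remaining
    excess. *)
Lemma seen_bound (phi : X -> option C) v (b : R) (Y Y' : {set X}) :
  R1 <= (sz v)%:R -> b / 2 <= (sz v)%:R < b ->
  (forall f, f \in Y -> [/\ e v f, (sz f < sz v)%N & 3 / 8 * b <= (sz f)%:R]) ->
  Y' \subset Y ->
  (forall w, e v w -> w \in dom phi -> w \in upn v :|: Y') ->
  #|Y'|%:R <= 2 * rho * #|Y|%:R + 8 * eps * K ->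
  ((1 - kap) * K <= #|upn v|%:R -> exists2 D, doubled e phi v D & sig * K <= #|D|%:R) ->
  #|seen e phi v|%:R <= (1 - sig / 2) * K.
Proof.
move=> vR /andP [bv vb] hY YY hcol hY' hD.
have K0 := K_gt0.
have R10 : 10 ^+ 23 <= R1 / 10 by rewrite /R1; lra.
have b1 : 10 ^+ 4 <= R1 by rewrite /R1; lra.
have v2 : (2 <= sz v)%N by rewrite -(ler_nat R); lra.
set r : R := (sz v)%:R in vR bv vb.
have r_big : 10 ^+ 23 * (sig / 10) <= (r - 1) * (sig / 10).
  by apply: ler_wpM2r; rewrite ?/sig; move: R10 vR; lra_above K.
have r4 : 1000 <= r by move: R10 vR; lra_above K.
move=> {vR R10 b1}.
have [e1 e2 e3] : [/\ 8 * rho + 8 * eps + sig / 2 <= kap, eps * 50 <= sig & 0 < sig].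
  by rewrite /rho /eps /sig /kap; split; lra_above K.
have epsK : eps * K * 50 <= sig * K by rewrite mulrAC; apply: ler_wpM2r; move: e2 K0; lra_above K.
have [rho0 rho1] : 0 <= 2 * rho /\ 2 * rho <= 1 / 10 by rewrite /rho; split; lra_above K.
have cardU : #|upn v :|: Y'|%:R <= #|upn v|%:R + #|Y'|%:R :> R.
  by rewrite -natrD ler_nat (leq_card_setU _ _).1.
case: (lerP ((1 - kap) * K) #|upn v|%:R) => hU; last first.
  have := card_seen (D := set0) (U := upn v :|: Y') _ hcol (sub0set _).
  rewrite cards0 addn0 => /(_ ltac:(by move=> w; rewrite inE)); rewrite -(ler_nat R) => h.
  have hYc : #|Y|%:R <= 3 * K.
    have b2 : 0 < 3 / 8 * b - 1 by move: vb r4; lra_above K.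
    rewrite -(ler_pM2l b2); apply: le_trans (nbr_count_K (v := v) (b := 3 / 8 * b) _ _) _; first by move: vb r4; lra_above K.
      by move=> f /hY [].
    by rewrite -/r [X in _ <= X]mulrA; apply: ler_wpM2r; move: K0 vb r4; lra_above K.
  have : 2 * rho * #|Y|%:R <= 2 * rho * (3 * K) by apply: ler_wpM2l.
  have : (8 * rho + 8 * eps + sig / 2) * K <= kap * K by apply: ler_wpM2r; move: e1 K0; lra_above K.
  have : 0 <= rho * K by apply: mulr_ge0; move: rho0 K0; lra_above K.
  by move: hU h hY' cardU; lra_above K.
have {hD} [D hD Dge] := hD hU.
have DU : D \subset upn v :|: Y'.
  by apply/subsetP => w /hD [h1 [w' [_ _ h2 _]]]; apply: hcol => //; apply/domP.
have := card_seen hD hcol DU; rewrite -(ler_nat R) natrD => hs.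
have := key_K (v := v) (Y := Y) v2 ltac:(by move=> f /hY []).
rewrite -/r; set S1 := \sum_(f in upn v) _; set S2 := \sum_(f in Y) _ => h.
have hS1 : 0 <= S1.
  by apply: sumr_ge0 => f; rewrite inE => /andP [_]; rewrite -(ler_nat R) -subr_ge0.
have hS2 : (r - 1) * (#|Y|%:R / 10) <= S2 / r.
  rewrite ler_pdivlMr; last by move: bv vb; lra_above K.
  have -> : (r - 1) * (#|Y|%:R / 10) * r = (r * (r - 1) / 10) * #|Y|%:R by lra_above K.
  rewrite mulr_natr -sumr_const; apply: ler_sum => f /hY [_ _ hf].
  have h1 : 3 / 8 * r <= (sz f)%:R by lra.
  have h2 : (r - 1) / 3 <= (sz f)%:R - 1 by move: h1 r4; lra_above K.
  apply: le_trans (_ : (3 / 8 * r) * ((r - 1) / 3) <= _); last first.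
    by apply: ler_pM => //; move: h1 h2 r4; lra_above K.
  have : 0 <= r * (r - 1) by apply: mulr_ge0; move: r4; lra_above K.
  by lra_above K.
have h5 : #|upn v|%:R + 1 - K + #|Y|%:R / 10 <= sig / 10 * K.
  have r1 : 0 < r - 1 by move: r4; lra_above K.
  rewrite -(ler_pM2l r1) mulrDr; have : K <= (r - 1) * (sig / 10 * K).
    rewrite mulrA -[X in X <= _]mul1r; apply: ler_wpM2r; first exact: ltW.
    by apply: le_trans r_big; rewrite /sig; lra_above K.
  have : (0 : R) <= t%:R by [].
  by move: h hS1 hS2; lra_above K.
have : 2 * rho * #|Y|%:R <= 1 / 10 * #|Y|%:R by apply: ler_wpM2r => //; lra.
have : 0 <= sig * K by apply: mulr_ge0; move: e3 K0; lra_above K.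
by move: hs Dge cardU h5 hY' epsK; lra_above K.
Qed.

End Windows.

(** The number of events in the union bounds of the random steps. *)
Lemma family_count (X : finType) (n : nat) : (1 < n)%N -> (#|X| <= n * n)%N ->
  (#|X| * 2 + #|X| + #|X| * #|X| + #|X| <= n ^ 6)%N.
Proof.
move=> n1 h; have h5 : (#|X| * #|X| <= (n * n) * (n * n))%N by rewrite leq_mul.
have -> : (n ^ 6 = (n * n) * ((n * n) * (n * n)))%N by rewrite !expnS expn0; lia.
have h7 : (4 <= n * n)%N by rewrite (leq_mul (m1 := 2) (m2 := 2)).
have : (4 * ((n * n) * (n * n)) <= (n * n) * ((n * n) * (n * n)))%N by rewrite leq_mul.
have : (4 * (n * n) <= (n * n) * (n * n))%N by rewrite leq_mul.
by move: (n * n)%N h h5 => m; move: (m * m)%N (#|X|) => ? ?; lia.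
Qed.

Section WindowStep.

Variables (n t : nat) (X C : finType) (ed : X -> {set 'I_n}).
Hypothesis codeg : forall i j, i != j -> (#|[set x | (i \in ed x) && (j \in ed x)]| <= t)%N.
Hypothesis t_gt0 : (0 < t)%N.
Hypothesis n_gt1 : (1 < n)%N.
Hypothesis cardC : #|C| = (t * n)%N.
Hypothesis cardX : (#|X| <= n * n)%N.
Let K : R := t%:R * n%:R.
Notation sz := (sz ed).
Notation nbr := (nbr ed).
Notation upn := (upn ed).
Notation e := (adj ed).
Notation window := (window ed).

(* The last clause is the reserve that pays for the overshoot when the sizes in
   [b/2, b) are coloured greedily. *)
Definition partial_inv (b : R) (phi : X -> option C) : Prop :=
  [/\ proper e phi, forall x, b <= (sz x)%:R -> x \in dom phi,
      forall x, x \in dom phi -> 3 / 4 * b <= (sz x)%:R &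
      forall v, (sz v)%:R < b ->
       (forall hi, hi = (sz v)%:R \/ hi = b ->
          #|window (3 / 4 * b) hi v :&: dom phi|%:R <= rho * #|window (3 / 4 * b) hi v|%:R + 4 * eps * K) /\
       (2 / 5 * K <= #|window (3 / 4 * b) (3 / 2 * b) v|%:R ->
          exists2 D, doubled e phi v D & sig * K <= #|D|%:R)].

(** The coloured neighbours have size at least [b], at most [sz v * K / (b - 1)] of them, or belong
    to the sparse precoloured part of [[3/4 b, b)]. Such vertices thus keep the long lists that the
    next precolouring needs. *)
Lemma few_seen (b : R) phi v : R1 <= b -> partial_inv b phi -> (sz v)%:R < 3 / 4 * b ->
  #|seen e phi v|%:R <= (sz v)%:R * K / (b - 1) + 3 * rho * K + 4 * eps * K.
Proof.
move=> bR [h1 h2 h3 h4] hv; have K0 : 0 < K := K_gt0 t_gt0 n_gt1.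
have b3 : 100 <= b by move: bR; rewrite /R1; lra.
have vb : (sz v)%:R < b by lra.
have [/(_ b (or_intror erefl)) hB _] := h4 v vb.
pose P := [set f in nbr v | b <= (sz f)%:R].
have hP : #|P|%:R <= (sz v)%:R * K / (b - 1).
  rewrite ler_pdivlMr; last by lra.
  rewrite mulrC; apply: (nbr_count_K codeg); first by lra.
  by move=> f; rewrite /P inE [f \in nbr v]inE => /andP [].
have hW : #|window (3 / 4 * b) b v|%:R <= 3 * K.
  have b2 : 0 < 3 / 4 * b - 1 by move: b3; lra_above K.
  rewrite -(ler_pM2l b2); apply: le_trans (nbr_count_K codeg (v := v) (b := 3 / 4 * b) _ _) _; first by move: b3; lra_above K.
    by move=> f; rewrite in_window => /and3P [].
  rewrite -/K [X in _ <= X]mulrA; apply: ler_wpM2r; move: hv b3 K0; lra_above K.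
have := card_seen (e := e) (phi := phi) (v := v) (D := set0) (U := P :|: (window (3 / 4 * b) b v :&: dom phi)) _ _ (sub0set _).
rewrite cards0 addn0 => /(_ ltac:(by move=> w; rewrite inE)) hs.
have {hs} hs : (#|seen e phi v| <= #|P :|: (window (3 / 4 * b) b v :&: dom phi)|)%N.
  apply: hs => w vw wd; rewrite in_setU in_setI wd andbT in_window vw /= h3 //= /P inE [w \in nbr v]inE vw /=.
  by case: lerP.
have := leq_trans hs (leq_card_setU _ _).1; rewrite -(ler_nat R) natrD => {}hs.
have rho0 : 0 <= rho by rewrite /rho; lra_above K.
have : rho * #|window (3 / 4 * b) b v|%:R <= rho * (3 * K) by apply: ler_wpM2l.
by move: hB hP hs; lra_above K.
Qed.

(** Sizes in [[3/8 b, 3/4 b)] are precoloured first, then all sizes in [[b/2, b)] are completed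
    greedily. The precoloured range straddles [b / 2]: it helps the current greedy phase and is the
    reserve for the next. *)
Lemma window_step (b : R) phi : 2 * R1 <= b -> b ^+ 2 <= n%:R / 200 ^+ 2 ->
  n%:R ^+ 6 * exp (- (eps * K)) < 1 ->
  partial_inv b phi -> exists psi, partial_inv (b / 2) psi.
Proof.
move=> bR bn few inv; have [h1 h2 h3 h4] := inv; have K0 : 0 < K := K_gt0 t_gt0 n_gt1.
have b3 : 10 ^+ 6 <= b by move: bR; rewrite /R1; lra.
have R1_pos : 2 <= R1 by rewrite /R1; lra.
have [rho0 eps0] : 0 <= rho <= (1 / 10) ^+ 3 /\ 0 <= eps <= (1 / 10) ^+ 3 by rewrite /rho /eps; split; lra_above K.
have {rho0} [rho0 rho1] := andP rho0; have {eps0} [eps0 eps1] := andP eps0.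
pose W := [set x | 3 / 8 * b <= (sz x)%:R < 3 / 4 * b].
pose I := [set x | (sz x)%:R < b].
pose L a := ~: seen e phi a.
have nbE v : nb e W v = window (3 / 4 * (b / 2)) (3 / 2 * (b / 2)) v.
  apply/setP => w; rewrite in_window inE [w \in W]inE andbC.
  have -> : 3 / 4 * (b / 2) = 3 / 8 * b by lra_above K.
  by have -> : 3 / 2 * (b / 2) = 3 / 4 * b by lra_above K.
have phiW x : x \in W -> phi x = None.
  rewrite inE => /andP [_ hx]; apply/eqP; apply: contraTT hx; rewrite -in_dom => /h3; by rewrite leNgt.
have nb3 v : v \in I -> #|nb e W v|%:R <= 3 * K.
  rewrite inE => vb; have b2 : 0 < 3 / 8 * b - 1 by move: b3; lra_above K.
  rewrite -(ler_pM2l b2); apply: le_trans (nbr_count_K codeg (v := v) (b := 3 / 8 * b) _ _) _; first by move: b3; lra_above K.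
    by move=> f; rewrite inE [f \in W]inE => /andP [/andP [? _] ?].
  rewrite -/K [X in _ <= X]mulrA; apply: ler_wpM2r; move: b3 vb K0; lra_above K.
have KC : #|C|%:R = K := cardC_K cardC.
have L10 a : a \in W -> K / 10 <= #|L a|%:R.
  rewrite inE => /andP [_ ha].
  have := few_seen (ltac:(move: bR b3; lra_above K) : R1 <= b) inv ha.
  have : (sz a)%:R * K / (b - 1) <= 8 / 10 * K.
    rewrite ler_pdivrMr; last by move: b3; lra_above K.
    by rewrite [X in _ <= X]mulrAC; apply: ler_wpM2r; move: b3 ha K0; lra_above K.
  have : #|seen e phi a|%:R + #|L a|%:R = K by rewrite -KC -natrD cardsC.
  have : 3 * rho * K <= 1 / 50 * K by apply: ler_wpM2r; move: rho1 K0; lra_above K.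
  have : 4 * eps * K <= 1 / 50 * K by apply: ler_wpM2r; move: eps1 K0; lra_above K.
  move=> {few inv h1 h2 h3 h4}; move: K0; lra_above K.
pose Z (j : X * bool) := window (3 / 4 * (b / 2)) (if j.2 then (sz j.1)%:R else b / 2) j.1.
have few' : (#|{: (X * bool + X) + X * X}|%:R + #|X|%:R) * exp (- (eps * K)) < 1.
  apply: le_lt_trans few; apply: ler_wpM2r; first exact/ltW/exp_gt0.
  rewrite -natrD -natrX ler_nat !card_sum !card_prod card_bool.
  exact: family_count.
have WI : W \subset I by apply/subsetP => x; rewrite !inE => /andP [_ h]; move: b3 h; lra_above K.
have [phi1 [[p1 p2] pZ pD]] := activation (adj_sym ed) (adj_irr ed) Z K0 (ltac:(by rewrite KC) : #|C|%:R <= K) WI L10 nb3 few'.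
(* With [b ^+ 2 <= n / 200 ^+ 2], products of two sizes below [b] times [t] are tiny against [K];
   this makes both bounds of [window_crowded] small. *)
have few_crowded v : v \in I -> #|crowded e W K v|%:R <= 7 / 10 ^+ 5 * K.
  rewrite inE => vb.
  have SN : nb e W v \subset nbr v by apply/subsetP => f; rewrite !inE => /andP [].
  have hS f : f \in nb e W v -> 3 / 8 * b <= (sz f)%:R <= 3 / 4 * b.
    by rewrite inE [f \in W]inE => /andP [/andP [-> /ltW ->]].
  have := window_crowded codeg (ltac:(move: b3; lra_above K) : 1 < 3 / 8 * b) SN hS; rewrite -/K => hw.
  have v0 : 0 <= (sz v)%:R :> R by [].
  have t0 : 0 <= t%:R :> R by [].
  have tb : t%:R * (b ^+ 2) <= K / 200 ^+ 2 by rewrite /K -mulrA; apply: ler_wpM2l.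
  have vbb : (sz v)%:R * (3 / 4 * b) <= 3 / 4 * b ^+ 2.
    by rewrite expr2 mulrA [X in _ <= X]mulrA; apply: ler_wpM2r; move: vb b3; lra_above K.
  have vv : (sz v)%:R ^+ 2 <= b ^+ 2 :> R by rewrite !expr2; apply: ler_pM; move: v0 vb; lra_above K.
  apply: le_trans (_ : t%:R * (sz v)%:R ^+ 2 / 2 <= _).
    apply: le_trans hw; rewrite ler_nat; apply/subset_leq_card/subsetP => a.
    rewrite [a \in crowded e W K v]inE => /andP [av ha]; rewrite inE av /=; apply: le_lt_trans (lt_le_trans ha _).
      have : K / (3 / 8 * b - 1) <= 1 / 10 ^+ 5 * K.
        rewrite ler_pdivrMr; last by move: b3; lra_above K.
        by rewrite [X in _ <= X]mulrAC -[X in X <= _]mul1r; apply: ler_wpM2r; move: K0 b3; lra_above K.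
      have : t%:R * ((sz v)%:R * (3 / 4 * b)) <= t%:R * (3 / 4 * b ^+ 2) by apply: ler_wpM2l.
      by move: tb K0; lra_above K.
    rewrite ler_nat; apply/subset_leq_card/subsetP => x; rewrite in_setI => /andP [x1 x2].
    rewrite in_setI x1 inE; by move: x2; rewrite inE => /andP [].
  have : t%:R * (sz v)%:R ^+ 2 <= t%:R * b ^+ 2 by apply: ler_wpM2l.
  by move: tb K0; lra_above K.
pose chi x := if phi1 x is Some c then Some c else phi x.
have chi_dom x : (x \in dom chi) = (x \in dom phi1) || (x \in dom phi).
  by rewrite !in_dom /chi; case: (phi1 x).
have d1W x : x \in dom phi1 -> x \in W.
  by rewrite in_dom; case E: (phi1 x) => [c|] // _; have [] := p1 _ _ E.
have chi_ext : extends phi chi.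
  move=> x hx; rewrite /chi; case E: (phi1 x) => [c|] //.
  by have [xW _] := p1 _ _ E; have := phiW x xW.
have chi_ext1 : extends phi1 chi by move=> x; rewrite /chi; case: (phi1 x).
have chi_pr : proper e chi.
  move=> x y xy; rewrite /chi; case E: (phi1 x) => [c|]; case E': (phi1 y) => [c'|].
  - by move=> _; rewrite -E -E'; apply: p2 => //; rewrite E.
  - move=> _ E2; have [_] := p1 _ _ E; rewrite inE => /negP; apply; apply/seenP; by exists y.
  - move=> _ E2; have [_] := p1 _ _ E'; rewrite inE => /negP; apply; apply/seenP; by exists x => //; rewrite adj_sym.
  - exact: h1.
pose A := [set x | b / 2 <= (sz x)%:R < b].
have dmZ v (hi : R) : hi = (sz v)%:R \/ hi = b / 2 ->
    #|window (3 / 4 * (b / 2)) hi v :&: dom phi1|%:R <=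
      rho * #|window (3 / 4 * (b / 2)) hi v|%:R + 4 * eps * K.
  move=> hhi; have [j Zj] : exists j, Z j = window (3 / 4 * (b / 2)) hi v.
    by case: hhi => ->; [exists (v, true)|exists (v, false)].
  have := pZ j; rewrite Zj; set S := window _ _ _.
  have -> : dm phi1 S = S :&: dom phi1 by apply/setP => x; rewrite !inE.
  have : (2 * al + 2 * al2) * #|S|%:R <= rho * #|S|%:R.
    by apply: ler_wpM2r => //; rewrite /al /al2 /rho; lra_above K.
  move=> {few few' inv h1 h2 h3 h4}; lra_above K.
have D1 v : (sz v)%:R < b -> 2 / 5 * K <= #|window (3 / 4 * (b / 2)) (3 / 2 * (b / 2)) v|%:R ->
    exists2 D, doubled e chi v D & sig * K <= #|D|%:R.
  move=> vb; rewrite -nbE => hw; have vI : v \in I by rewrite inE.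
  have [D [DN hD hdup]] := pD v vI hw (few_crowded v vI).
  exists D => //; apply: (doubled_extends chi_ext1) => w wD.
  have := subsetP DN _ wD; rewrite inE => /andP [_ ->]; split=> //.
  have [w' [q1 q2 q3 q4]] := hdup w wD; exists w'; split=> //.
  by move: q1; rewrite inE => /andP [].
have [psi [r1 r2 r3]] : exists psi, [/\ proper e psi, extends chi psi & dom psi = dom chi :|: A].
  apply: (greedy (adj_sym ed) (rk := sz) (adj_irr ed) chi_pr) => psi v q1 q2 vA vd q3.
  move: vA; rewrite inE => vA; have [vA1 vA2] := andP vA.
  have vR1 : R1 <= (sz v)%:R by move: bR vA1; lra_above K.
  pose Y := window (3 / 4 * (b / 2)) (sz v)%:R v.
  pose Yb := window (3 / 4 * b) (sz v)%:R v.
  have YbY : Yb \subset Y.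
    by apply/subsetP => f; rewrite /Yb /Y !in_window => /and3P [-> q4 ->]; rewrite andbT /=; move: q4 b3; lra_above K.
  rewrite -(ltr_nat R) KC; apply: (@le_lt_trans _ _ ((1 - sig / 2) * K)); last first.
    by rewrite -[X in _ < X]mul1r ltr_pM2r // /sig; lra_above K.
  apply: (seen_bound codeg t_gt0 n_gt1 vR1 vA (Y := Y) (Y' := Y :&: dom chi)).
  - move=> f; rewrite /Y in_window ltr_nat => /and3P [? q4 ->]; split=> //; move: q4; lra_above K.
  - exact: subsetIl.
  - move=> w vw wd; rewrite in_setU in_setI /Y in_window vw ltr_nat /= [w \in upn v]inE [w \in nbr v]inE vw /=.
    case: leqP => //= wv; case: (q3 w wd) => [wc|[_]]; last by rewrite leqNgt wv.
    rewrite wc !andbT /=; move: wc; rewrite chi_dom => /orP [/d1W|/h3 q4]; last by move: q4 b3; lra_above K.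
    by rewrite inE => /andP [q4 _]; move: q4; lra_above K.
  - have [/(_ _ (or_introl erefl)) q4 _] := h4 v vA2.
    have q5 := dmZ v _ (or_introl erefl).
    have q6 : #|Y :&: dom chi|%:R <= #|Y :&: dom phi1|%:R + #|Yb :&: dom phi|%:R :> R.
      rewrite -natrD ler_nat; apply: leq_trans (leq_card_setU _ _).1; apply/subset_leq_card/subsetP => x.
      rewrite in_setI in_setU !in_setI chi_dom => /andP [xY /orP [xd|xd]]; rewrite xY xd ?orbT //=.
      apply/orP; right; rewrite andbT /Yb in_window h3 //=.
      by move: xY; rewrite in_window => /and3P [-> _ ->].
    have q7 : #|Yb|%:R <= #|Y|%:R :> R by rewrite ler_nat subset_leq_card.
    have : rho * #|Yb|%:R <= rho * #|Y|%:R by apply: ler_wpM2l.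
    by rewrite -/K; move: q4 q5 q6; rewrite -/Y -/Yb; lra_above K.
  - move=> q4; have q5 := upn_mostly_low codeg t_gt0 n_gt1 vR1 vA q4.
    (* The [8/10 * K] low neighbours are shared by the new and the old precoloured range, so one of
       them has at least [2/5 * K], the threshold of the reserve. *)
    have q6 : (#|[set f in upn v | (((sz f)%:R : R) < 3 / 2 * b)%R]| <=
       #|window (3 / 4 * (b / 2))%R (3 / 2 * (b / 2))%R v| + #|window (3 / 4 * b)%R (3 / 2 * b)%R v|)%N.
      apply: leq_trans (leq_card_setU _ _).1; apply/subset_leq_card/subsetP => f.
      rewrite inE => /andP [fu f2]; move: fu; rewrite inE [f \in nbr v]inE => /andP [vf].
      rewrite -(ler_nat R) => f1; rewrite in_setU !in_window vf f2 /= andbT.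
      case: (lerP (3 / 4 * b) (sz f)%:R) => f3; first by rewrite orbT.
      by apply/orP; left; apply/andP; split; move: f1 f3 vA1 b3; lra_above K.
    move: q6; rewrite -(ler_nat R) natrD => q6.
    case: (lerP (2 / 5 * K) #|window (3 / 4 * b) (3 / 2 * b) v|%:R) => q7.
      have [_ /(_ q7) [D hD1 hD2]] := h4 v vA2; exists D => //.
      by apply: doubled_extends hD1; exact: extends_trans q2.
    have [|D hD1 hD2] := D1 v vA2; first by rewrite -/K in q5; move: q5 q6 q7; lra_above K.
    by exists D => //; apply: doubled_extends hD1.
exists psi; split=> //.
- move=> x hx; rewrite r3 in_setU chi_dom [x \in A]inE hx /=.
  by case: (ltP (sz x)%:R b) => hxb; rewrite ?orbT // h2 // orbT.
- move=> x; rewrite r3 in_setU chi_dom => /orP [/orP [/d1W|/h3 hx]|].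
  + by rewrite inE => /andP [q _]; move: q; lra_above K.
  + by move: hx b3; lra_above K.
  + by rewrite inE => /andP [q _]; move: q b3; lra_above K.
move=> v vb; split; last first.
  move=> q1; have [|D hD1 hD2] := D1 v _ q1; first by move: vb b3; lra_above K.
  by exists D => //; exact: doubled_extends hD1.
move=> hi hhi; have := dmZ v hi hhi.
have -> // : window (3 / 4 * (b / 2)) hi v :&: dom psi = window (3 / 4 * (b / 2)) hi v :&: dom phi1.
apply/setP => x; rewrite !in_setI; case: (boolP (x \in window _ _ _)) => //=.
rewrite in_window => /and3P [_ _ q2].
have q3 : (sz x)%:R < b / 2 by case: hhi q2 => -> q2; move: q2 vb; lra_above K.
rewrite r3 in_setU chi_dom [x \in A]inE [b / 2 <= _]leNgt q3 /= orbF.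
case: (boolP (x \in dom phi)) => [/h3 q4|]; last by rewrite orbF.
move=> {few few' inv h1 h2 h3 h4}; lra.
Qed.

End WindowStep.

(** * Reaching bounded sizes and colouring the rest *)

Section Finish.

Variables (n t : nat) (X C : finType) (ed : X -> {set 'I_n}).
Hypothesis codeg : forall i j, i != j -> (#|[set x | (i \in ed x) && (j \in ed x)]| <= t)%N.
Hypothesis deg : forall i, (#|[set x | i \in ed x]| <= n)%N.
Hypothesis t_gt1 : (1 < t)%N.
Hypothesis n_gt1 : (1 < n)%N.
Hypothesis cardC : #|C| = (t * n)%N.
Hypothesis cardX : (#|X| <= n * n)%N.
Let K : R := t%:R * n%:R.
Let t_gt0 : (0 < t)%N := ltnW t_gt1.
Notation sz := (sz ed).
Notation nbr := (nbr ed).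
Notation upn := (upn ed).
Notation e := (adj ed).
Notation window := (window ed).
Notation partial_inv := (partial_inv t ed).

Lemma iterate_windows (j : nat) (b : R) (phi : X -> option C) : 2 * R1 <= b -> b <= 2 ^+ j * R1 ->
  b ^+ 2 <= n%:R / 200 ^+ 2 -> n%:R ^+ 6 * exp (- (eps * K)) < 1 -> partial_inv b phi ->
  exists b' (psi : X -> option C), [/\ 2 * R1 <= b', b' < 4 * R1 & partial_inv b' psi].
Proof.
elim: j b phi => [|j IH] b phi bR bj bn few inv.
  by move: bR bj; rewrite /R1; lra.
case: (ltP b (4 * R1)) => hb; first by exists b, phi.
have R0 : 0 < R1 by rewrite /R1; lra.
have [psi hpsi] := window_step codeg t_gt0 n_gt1 cardC cardX bR bn few inv.
apply: (IH (b / 2) psi) => //; [lra|by move: bj; rewrite exprS -mulrA; lra|].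
apply: le_trans bn; rewrite !expr2; apply: ler_pM; move: bR R0; lra_above t_gt0.
Qed.

(** Sizes below [3/4 * b] are handled by [few_seen]. For the others [seen_bound] applies, and their
    low larger neighbours all lie in the one window that carries the reserve. *)
Lemma uncolored_seen (b : R) (phi : X -> option C) v : 2 * R1 <= b -> partial_inv b phi ->
  v \notin dom phi -> #|seen e phi v|%:R <= (1 - sig / 2) * K /\
  ((sz v)%:R < b / 20 -> #|seen e phi v|%:R <= 1 / 10 * K).
Proof.
move=> bR inv vd; have K0 : 0 < K := K_gt0 t_gt0 n_gt1; have [h1 h2 h3 h4] := inv.
have vb : (sz v)%:R < b by rewrite ltNge; apply/negP => /h2; rewrite (negbTE vd).
have R1b : R1 <= b by move: bR; rewrite /R1; lra.
have b3 : 10 ^+ 3 <= b by move: bR; rewrite /R1; lra.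
have [rho1 eps1 sig1] : [/\ 3 * rho + 4 * eps <= 1 / 100, 0 <= sig & sig <= 1 / 100].
  by rewrite /rho /eps /sig; split; lra_above t_gt0.
have small : 3 * rho * K + 4 * eps * K <= 1 / 100 * K by rewrite -mulrDl; apply: ler_wpM2r; move: rho1 K0; lra_above t_gt0.
have sigK : sig * K <= 1 / 100 * K by apply: ler_wpM2r; move: sig1 K0; lra_above t_gt0.
have ratio (c : R) : (sz v)%:R <= c * b -> 0 <= c -> (sz v)%:R * K / (b - 1) <= (11 / 10 * c) * K.
  move=> hc c0; rewrite ler_pdivrMr; last by move: b3; lra_above t_gt0.
  rewrite [X in _ <= X]mulrAC; apply: ler_wpM2r; first by move: K0; lra_above t_gt0.
  apply: le_trans hc _; have : 0 <= c * (b - 11) by apply: mulr_ge0; move: b3 c0; lra_above t_gt0.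
  by lra_above t_gt0.
split; last first.
  move=> v20; have hv : (sz v)%:R < 3 / 4 * b by move: vb v20; lra_above t_gt0.
  have := few_seen codeg t_gt0 n_gt1 R1b inv hv; rewrite -/K.
  have := ratio (1 / 20) ltac:(move: v20; lra_above t_gt0) ltac:(lra_above t_gt0).
  move=> {inv h1 h2 h3 h4}; move: K0 small; lra_above t_gt0.
case: (ltP (sz v)%:R (3 / 4 * b)) => hv.
  have := few_seen codeg t_gt0 n_gt1 R1b inv hv; rewrite -/K.
  have := ratio (3 / 4) ltac:(move: hv; lra_above t_gt0) ltac:(lra_above t_gt0).
  move=> {inv h1 h2 h3 h4}; move: K0 small sigK; lra_above t_gt0.
have vR : R1 <= (sz v)%:R by move: bR hv; rewrite /R1; lra_above t_gt0.
have vbb : b / 2 <= (sz v)%:R < b by rewrite vb andbT; move: vb hv; lra_above t_gt0.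
pose Y := window (3 / 4 * b) (sz v)%:R v.
apply: (seen_bound codeg t_gt0 n_gt1 vR vbb (Y := Y) (Y' := Y :&: dom phi)).
- move=> f; rewrite /Y in_window ltr_nat => /and3P [? ? ->]; split=> //; lra.
- exact: subsetIl.
- move=> w vw wd; rewrite in_setU in_setI /Y in_window vw ltr_nat /= [w \in upn v]inE [w \in nbr v]inE vw /=.
  by case: leqP => //= wv; rewrite wd h3.
- have [/(_ _ (or_introl erefl)) q4 _] := h4 v vb; rewrite -/Y -/K in q4; rewrite -/K.
  have : 0 <= rho * #|Y|%:R by rewrite mulr_ge0 // /rho; lra_above t_gt0.
  have : 0 <= eps * K by apply: mulr_ge0; rewrite ?/eps; move: K0; lra_above t_gt0.
  move=> {inv h1 h2 h3 h4}; move: q4; lra_above t_gt0.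
- move=> q4; have q5 := upn_mostly_low codeg t_gt0 n_gt1 vR vbb q4.
  have [_ q6] := h4 v vb; apply: q6; rewrite -/K.
  have q7 : #|[set f in upn v | (sz f)%:R < 3 / 2 * b]|%:R <= #|window (3 / 4 * b) (3 / 2 * b) v|%:R :> R.
    rewrite ler_nat; apply/subset_leq_card/subsetP => f.
    rewrite inE => /andP [fu f2]; move: fu; rewrite inE [f \in nbr v]inE => /andP [vf].
    by rewrite -(ler_nat R) => f1; rewrite in_window vf f2 andbT /=; move: hv f1; lra_above t_gt0.
  move: q5; rewrite -/K; move=> {inv h1 h2 h3 h4}; move: K0 q7; lra_above t_gt0.
Qed.

Lemma card_nbr v : (#|nbr v| <= sz v * n.-1)%N.
Proof.
apply: (card_le_union (D := ed v) (F := fun i => [set x | i \in ed x] :\ v)) => [x|i iv].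
  by rewrite inE => /adjP [vx [i iv ix]]; exists i => //; rewrite !inE ix eq_sym vx.
have := deg i; rewrite (cardsD1 v) inE iv add1n => h.
by rewrite -ltnS (prednK (ltnW n_gt1)).
Qed.

(** An uncoloured edge has at most [t] vertices, hence at most [t * (n - 1)] neighbours, fewer than
    the colours. *)
Lemma finish_large_t (b : R) (phi : X -> option C) : b <= t%:R -> partial_inv b phi ->
  exists psi : X -> option C, proper e psi /\ forall x, x \in dom psi.
Proof.
move=> bt [h1 h2 h3 h4].
have [psi [r1 r2 r3]] : exists psi, [/\ proper e psi, extends phi psi & dom psi = dom phi :|: setT].
  apply: (greedy (adj_sym ed) (rk := sz) (adj_irr ed) h1) => psi v q1 q2 _ vd _.
  have vd' : v \notin dom phi.
    by apply: contra vd => /domP h; apply/domP; rewrite q2.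
  have vb : (sz v <= t)%N.
    rewrite -(ler_nat R); apply/ltW; apply: lt_le_trans bt; rewrite ltNge; apply/negP => /h2.
    by rewrite (negbTE vd').
  have := card_seen (e := e) (phi := psi) (v := v) (D := set0) (U := nbr v) _ _ (sub0set _).
  rewrite cards0 addn0 => h; apply: leq_ltn_trans (h _ _) _ => [w|w vw _|]; rewrite ?inE //.
  rewrite cardC; apply: leq_ltn_trans (card_nbr v) _.
  apply: leq_ltn_trans (_ : (t * n.-1 < _)%N); first by rewrite leq_mul2r vb orbT.
  by rewrite ltn_pmul2l // prednK // ltnW.
by exists psi; split=> // x; rewrite r3 in_setU in_setT orbT.
Qed.

End Finish.

(** If [t >= 4 * R1] then [b <= t] and plain greedy suffices. Otherwise sizes and codegrees are
    bounded, and the colours unseen by each edge serve as lists. *)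
Lemma finish : exists N : nat, forall (n t : nat) (X C : finType) (ed : X -> {set 'I_n}),
  (N <= n)%N -> (1 < t)%N -> (1 < n)%N ->
  (forall i j, i != j -> (#|[set x | (i \in ed x) && (j \in ed x)]| <= t)%N) ->
  (forall i, (#|[set x | i \in ed x]| <= n)%N) ->
  #|C| = (t * n)%N -> (#|X| <= n * n)%N ->
  forall (b : R) (phi : X -> option C), 2 * R1 <= b -> b < 4 * R1 -> partial_inv t ed b phi ->
  exists psi : X -> option C, proper (adj ed) psi /\ forall x, x \in dom psi.
Proof.
have [Rm hRm] := nat_ge (4 * R1); have {hRm} hRm := hRm Rm (leqnn _).
have sig0 : 0 < sig by rewrite /sig; lra.
have [N hN] := bounded_list_coloring Rm (ltac:(lra) : 0 < sig / 2).
exists N => n t X C ed Nn t1 n1 codeg deg cardC cardX b phi bR b4 inv.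
have t0 := ltnW t1; have n0 := ltnW n1.
case: (lerP (4 * R1) t%:R) => tR.
  by apply: (finish_large_t deg t1 n1 cardC (b := b) _ inv); move: b4 tR; clear; lra.
pose K : R := t%:R * n%:R; have K0 : 0 < K := K_gt0 t0 n1.
(* Here [t >= 2] enters: with lists of size [9/10 * K], the [n] edges at a vertex give a colour
   degree of at most 5/9. *)
have K2 : 2 * n%:R <= K by apply: ler_wpM2r => //; rewrite (ler_nat _ 2).
have tRm : (t <= Rm)%N by rewrite -(ler_nat R); move: hRm tR; clear; lra.
have [h1 h2 h3 _] := inv.
pose W := ~: dom phi; pose L x := ~: seen (adj ed) phi x.
have Wb x : x \in W -> (sz ed x)%:R < b.
  by rewrite in_setC => hx; rewrite ltNge; apply/negP => /h2; rewrite (negbTE hx).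
have KC : #|C|%:R = K := cardC_K cardC.
have Lsz x : x \in W -> sig / 2 * K <= #|L x|%:R /\ ((sz ed x)%:R < b / 20 -> 9 / 10 * K <= #|L x|%:R).
  rewrite in_setC => hx; have [q1 q2] := uncolored_seen codeg t1 n1 bR inv hx.
  have q3 : #|seen (adj ed) phi x|%:R + #|L x|%:R = K by rewrite -KC -natrD cardsC.
  rewrite -/K in q1 q2; move=> {inv h1 h2 h3}; split; first by move: q3 q1; clear; lra.
  by move=> /q2; move: q3; clear; lra.
have Lpos x : x \in W -> 0 < #|L x|%:R :> R.
  by move=> /Lsz [q _]; apply: lt_le_trans q; rewrite mulr_gt0 //; move: sig0; clear; lra.
have b3 : 20 * (40 / sig + 1) <= b.
  have -> : 40 / sig = 40 * 10 ^+ 22 by rewrite /sig; field.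
  by move: bR; rewrite /R1; clear; lra.
have [||||||psi [psi1 psi2]] := hN n X C ed W L Nn cardX.
- by rewrite cardC leq_mul2r tRm orbT.
- by move=> x /Wb q; rewrite -(ler_nat R); move: q; rewrite /sz; move: hRm b4; clear; lra.
- by move=> i; apply: leq_trans (deg i); apply/subset_leq_card/subsetP => x; rewrite !inE => /andP [].
- move=> i j ij; apply: leq_trans tRm; apply: leq_trans (codeg i j ij).
  by apply/subset_leq_card/subsetP => x; rewrite !inE => /andP [].
- move=> x /Lsz [q _]; apply: le_trans q; apply: ler_wpM2l; first by move: sig0; clear; lra.
  by have := ler0n R n; move: K2; clear; lra.
- move=> i c.
  (* The edges with possibly short lists have size at least [b / 20], so few pass through [i]; they
     add at most 1/20, and [56/100 + 1/20 < 2/3]. *)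
  pose B := [set x in W | (i \in ed x) && (b / 20 <= (sz ed x)%:R)].
  have hB : #|B|%:R <= sig / 40 * K.
    have b2 : 0 < b / 20 - 1 by have : 0 < 40 / sig by [apply: divr_gt0]; move: b3; clear; lra.
    have := deg_count codeg (i := i) (b := b / 20) (Y := B) _.
    move/(_ ltac:(by move=> f; rewrite inE => /and3P [])) => hB.
    rewrite -(ler_pM2l b2); apply: le_trans hB _.
    apply: (@le_trans _ _ (1 * K)); first by have := ler0n R t; rewrite /K; clear; lra.
    rewrite [X in _ <= X]mulrA; apply: ler_wpM2r; first by move: K0; clear; lra.
    have : 40 / sig * (sig / 40) = 1 by field; move: sig0; clear; lra.
    have : 40 / sig * (sig / 40) <= (b / 20 - 1) * (sig / 40) by apply: ler_wpM2r; move: b3 sig0; clear; lra.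
    by clear; lra.
  apply: (@le_trans _ _ (\sum_(x | i \in ed x) (9 / 10 * K)^-1 + \sum_(x in B) (sig / 2 * K)^-1)).
    rewrite big_mkcond [X in _ <= X + _]big_mkcond [X in _ <= _ + X]big_mkcond -big_split /=.
    apply: ler_sum => x _.
    have q1 : 0 <= (9 / 10 * K)^-1 by rewrite invr_ge0; move: K0; clear; lra.
    have q2 : 0 <= (sig / 2 * K)^-1 by rewrite invr_ge0; apply: mulr_ge0; move: K0 sig0; clear; lra.
    case: (boolP (_ && _)) => [/and3P [xW ix _]|_]; last first.
      by apply: addr_ge0; case: ifP.
    have [l1 l2] := Lsz x xW; rewrite ix [x \in B]inE xW ix /=.
    case: (lerP (b / 20) (sz ed x)%:R) => hx.
      apply: (@le_trans _ _ (sig / 2 * K)^-1); last by move: q1; clear; lra.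
      by rewrite lef_pV2 // posrE ?Lpos // mulr_gt0 //; move: sig0; clear; lra.
    by rewrite addr0 lef_pV2 ?posrE ?Lpos ?l2 // mulr_gt0 //; clear; lra.
  rewrite !sumr_const -[X in X + _]mulr_natl -[X in _ + X]mulr_natl.
  have q1 : #|[pred x | i \in ed x]|%:R / (9 / 10 * K) <= 56 / 100.
    rewrite ler_pdivrMr; last by rewrite mulr_gt0 //; clear; lra.
    have : #|[pred x | i \in ed x]|%:R <= n%:R :> R by rewrite ler_nat; apply: leq_trans (deg i); rewrite cardsE.
    move: K0 K2; clear; lra.
  have q2 : #|B|%:R / (sig / 2 * K) <= 1 / 20.
    rewrite ler_pdivrMr; last by rewrite mulr_gt0 //; move: sig0; clear; lra.
    move: hB; clear; lra.
  lra.
exists (fun x => if phi x is Some c then Some c else psi x); split.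
  move=> x y xy; case E: (phi x) => [c|]; case E': (phi y) => [c'|].
  - by move=> _; rewrite -E -E'; apply: h1 => //; rewrite E.
  - have yW : y \in W by rewrite in_setC in_dom E'.
    have [c1 cL ->] := psi1 y yW; move=> _ [Ec]; move: cL; rewrite inE => /negP; apply.
    by apply/seenP; exists x; [rewrite adj_sym|rewrite E Ec].
  - have xW : x \in W by rewrite in_setC in_dom E.
    have [c1 cL ->] := psi1 x xW; move=> _ [Ec]; move: cL; rewrite inE => /negP; apply.
    by apply/seenP; exists y => //; rewrite E' Ec.
  - by move=> _; apply: psi2 => //; rewrite in_setC in_dom ?E ?E'.
move=> x; rewrite in_dom; case E: (phi x) => [c|] //.
have xW : x \in W by rewrite in_setC in_dom E.
by have [c1 _ ->] := psi1 x xW.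
Qed.

(** * Sizes of order square root of n *)

Lemma nat_half (y : R) : 1 <= y -> exists m : nat, y / 2 <= m%:R /\ m%:R <= y.
Proof.
move=> y1; have /andP [h1 h2] := truncn_itv (ltac:(lra) : 0 <= y).
exists (Num.truncn y); split=> //; move: h1 h2; rewrite -natr1 => h1 h2.
have : (0 < Num.truncn y)%N by rewrite -(ltr_nat R); lra.
by rewrite -(ler_nat R 1); lra.
Qed.

Lemma uniq_seq_of_size (C : finType) (m : nat) : (m <= #|C|)%N -> exists2 cl : seq C, uniq cl & size cl = m.
Proof.
move=> h; exists (take m (enum C)); first by rewrite take_uniq ?enum_uniq.
by rewrite size_takel // -cardT.
Qed.

Section Top.

Variables (n t : nat) (X C : finType) (ed : X -> {set 'I_n}) (z : R).
Hypothesis codeg : forall i j, i != j -> (#|[set x | (i \in ed x) && (j \in ed x)]| <= t)%N.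
Hypothesis t_gt0 : (0 < t)%N.
Hypothesis n_gt1 : (1 < n)%N.
Hypothesis cardC : #|C| = (t * n)%N.
Hypothesis cardX : (#|X| <= n * n)%N.
Hypothesis z_big : 10 ^+ 40 <= z.
Hypothesis nz : n%:R <= (z + 1) ^+ 2.
Hypothesis zn : z ^+ 2 <= n%:R.
Let K : R := t%:R * n%:R.
Notation sz := (sz ed).
Notation nbr := (nbr ed).
Notation upn := (upn ed).
Notation e := (adj ed).
Notation window := (window ed).

Lemma z15 : 10 ^+ 16 <= z. Proof. by move: z_big; lra. Qed.

Lemma gain_doubled (I : finType) (F : I -> {set X}) (X0 : {set X}) (cl : seq C) s v w :
  F v \subset nbr w -> ppgood e X0 cl s -> doubled e (pcol s) w (gain F v s).
Proof.
move=> Fw [g1 g2 g3 g4 g5] x; rewrite inE => /andP [xF].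
case E: (psec s x) => [y|] // yF; have [h1 h2 h3] := g3 _ _ E.
have := subsetP Fw _ xF; rewrite inE => ->; split=> //.
exists y; split=> //; first by have := subsetP Fw _ yF; rewrite inE.
by rewrite inE h3 andbF.
Qed.

(** An edge of size [c * z] uses about [c ^+ 2 * n] of the volume [t * n * (n - 1)] of [vol_sum].
    The factor [1 + 1 / 10 ^+ 10] absorbs rounding in [z]. *)
Lemma volume2 (c1 c2 : R) (Y1 Y2 : {set X}) : [disjoint Y1 & Y2] ->
  1 / 10 ^+ 3 <= c1 -> 1 / 10 ^+ 3 <= c2 ->
  (forall f, f \in Y1 -> c1 * z <= (sz f)%:R) -> (forall f, f \in Y2 -> c2 * z <= (sz f)%:R) ->
  c1 ^+ 2 * #|Y1|%:R + c2 ^+ 2 * #|Y2|%:R <= (1 + 1 / 10 ^+ 10) * K.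
Proof.
move=> dY hc1 hc2 h1 h2; have K0 : 0 < K := K_gt0 t_gt0 n_gt1.
have z0 := z15; pose eta : R := 1 / 10 ^+ 12.
have step (c : R) (Y : {set X}) : 1 / 10 ^+ 3 <= c -> (forall f, f \in Y -> c * z <= (sz f)%:R) ->
    (1 - eta) * (z * z) * (c ^+ 2 * #|Y|%:R) <= \sum_(f in Y) (sz f)%:R * ((sz f)%:R - 1).
  move=> hc hY; have cz : 10 ^+ 12 <= c * z.
    apply: le_trans (_ : 1 / 10 ^+ 3 * z <= _); [by lra|apply: ler_wpM2r; lra].
  rewrite mulrA mulr_natr -sumr_const; apply: ler_sum => f /hY hf.
  apply: (@le_trans _ _ ((c * z) * (c * z - 1))); last by apply: ler_pM; lra.
  have : 0 <= c * z * (eta * (c * z) - 1) by apply: mulr_ge0; rewrite /eta; lra.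
  by rewrite expr2; lra.
have := lerD (step c1 Y1 hc1 h1) (step c2 Y2 hc2 h2).
rewrite -mulrDr; set A := _ + c2 ^+ 2 * _.
have -> : \sum_(f in Y1) (sz f)%:R * ((sz f)%:R - 1) + \sum_(f in Y2) (sz f)%:R * ((sz f)%:R - 1) =
    \sum_(f in Y1 :|: Y2) (sz f)%:R * ((sz f)%:R - 1) :> R by rewrite -bigU //; apply: eq_bigl => f; rewrite !inE.
move=> h; have := le_trans h (vol_sum codeg _).
have : t%:R * (n%:R * (n%:R - 1)) <= K * ((1 + eta) * (z * z)).
  rewrite mulrA; apply: ler_pM => //; [exact: ltW|by rewrite subr_ge0 (ler_nat _ 1) ltnW|].
  have : 0 <= z * (eta * z - 3) by apply: mulr_ge0; rewrite /eta; lra.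
  by move: nz; rewrite !expr2; lra.
move=> h3 h4; have {h h3 h4} h := le_trans h4 h3.
have zz : 0 < z * z by apply: mulr_gt0; lra.
have {}h : (1 - eta) * A <= (1 + eta) * K.
  by rewrite -(ler_pM2r zz); move: h; lra.
have : 0 <= eta * K by apply: mulr_ge0; rewrite /eta; lra.
rewrite /eta in h *; lra.
Qed.

Lemma volume1 (c : R) (Y : {set X}) : 1 / 10 ^+ 3 <= c ->
  (forall f, f \in Y -> c * z <= (sz f)%:R) -> c ^+ 2 * #|Y|%:R <= (1 + 1 / 10 ^+ 10) * K.
Proof.
move=> hc hY; have := volume2 (Y1 := Y) (Y2 := set0) _ hc hc hY _.
rewrite cards0 mulr0 addr0; apply; first by rewrite -setI_eq0 setI0.
by move=> f; rewrite inE.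
Qed.

End Top.

(** * Close to a blown-up projective plane *)

Section Dense.

Variables (n t : nat) (X C : finType) (ed : X -> {set 'I_n}) (z : R).
Hypothesis codeg : forall i j, i != j -> (#|[set x | (i \in ed x) && (j \in ed x)]| <= t)%N.
Hypothesis t_gt0 : (0 < t)%N.
Hypothesis n_gt1 : (1 < n)%N.
Hypothesis cardC : #|C| = (t * n)%N.
Hypothesis cardX : (#|X| <= n * n)%N.
Hypothesis z_big : 10 ^+ 40 <= z.
Hypothesis nz : n%:R <= (z + 1) ^+ 2.
Hypothesis zn : z ^+ 2 <= n%:R.
Let K : R := t%:R * n%:R.
Notation sz := (sz ed).
Notation nbr := (nbr ed).
Notation upn := (upn ed).
Notation e := (adj ed).
Notation window := (window ed).

Variable e1 : X.
Hypothesis e1_big : (1 - 1 / 10 ^+ 7) * z <= (sz e1)%:R.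
Hypothesis e1_full : (1 - 1 / 10 ^+ 8) * K <= #|upn e1|%:R.

(* The vertices at which greedy colouring in decreasing order of size may fail. *)
Definition exact_bad v := (z / 200 <= (sz v)%:R) && (t * n <= #|upn v|)%N.

Lemma upn_ge v f : f \in upn v -> (sz v)%:R <= (sz f)%:R :> R.
Proof. by rewrite inE => /andP [_]; rewrite ler_nat. Qed.

(** The edges of [upn e1] alone use up all but a few parts in [10 ^+ 7] of the volume. *)
Lemma mid_few (Y : {set X}) :
  (forall f, f \in Y -> 3 / 800 * z <= (sz f)%:R < (1 - 1 / 10 ^+ 7) * z) -> #|Y|%:R <= 3 / 100 * K.
Proof.
move=> hY; have K0 : 0 < K := K_gt0 t_gt0 n_gt1; have [hb hf] := (e1_big, e1_full).
have : (1 - 1 / 10 ^+ 7) ^+ 2 * #|upn e1|%:R + (3 / 800) ^+ 2 * #|Y|%:R <= (1 + 1 / 10 ^+ 10) * K.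
  apply: (volume2 codeg t_gt0 n_gt1 z_big nz); try lra.
  - rewrite disjoint_subset; apply/subsetP => f fu; rewrite inE; apply/negP => /hY /andP [_ h2].
    by have := upn_ge fu; lra.
  - by move=> f /upn_ge h; apply: le_trans h.
  - by move=> f /hY /andP [].
have : (1 - 1 / 10 ^+ 7) ^+ 2 * ((1 - 1 / 10 ^+ 8) * K) <= (1 - 1 / 10 ^+ 7) ^+ 2 * #|upn e1|%:R.
  by apply: ler_wpM2l => //; lra.
lra.
Qed.

(** By [mid_few], at least 97/100 of [K] of the larger neighbours have size nearly [z]; that many
    edges of this size can meet [v] only if [v] is almost as large. *)
Lemma exact_bad_size v : exact_bad v -> 96 / 100 * z <= (sz v)%:R.
Proof.
move=> /andP [hv hU]; have K0 : 0 < K := K_gt0 t_gt0 n_gt1; have z0 := z15 z_big.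
have {hU} hU : K <= #|upn v|%:R by rewrite /K -natrM ler_nat.
pose Q := [set f in upn v | (1 - 1 / 10 ^+ 7) * z <= (sz f)%:R].
have h1 : #|upn v :\: Q|%:R <= 3 / 100 * K.
  apply: mid_few => f; rewrite in_setD [f \in Q]in_set => /andP [h2 fu].
  have := upn_ge fu; move: h2; rewrite fu /= -ltNge => -> h; rewrite andbT; lra.
have h2 : #|upn v|%:R = #|Q|%:R + #|upn v :\: Q|%:R :> R.
  by rewrite -natrD -(cardsID Q (upn v)) (setIidPr _) //; apply/subsetP => f; rewrite inE => /andP [].
have h3 := nbr_count_K codeg (v := v) (b := (1 - 1 / 10 ^+ 7) * z) (Y := Q) ltac:(lra).
rewrite -/K in h3; have {}h3 : ((1 - 1 / 10 ^+ 7) * z - 1) * #|Q|%:R <= (sz v)%:R * K.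
  apply: h3 => f; rewrite inE => /andP [fu ?]; split=> //.
  by move: fu; rewrite inE [f \in nbr v]inE => /andP [].
rewrite -(ler_pM2r K0); apply: le_trans h3.
apply: le_trans (_ : ((1 - 1 / 10 ^+ 7) * z - 1) * (97 / 100 * K) <= _).
  by rewrite [X in _ <= X]mulrA; apply: ler_wpM2r; move: z0 K0; lra_above e1_full.
by apply: ler_wpM2l; move: hU h1 h2 z0; lra_above e1_full.
Qed.

(** All from [key_inequality], whose two terms are nonnegative here. The bound 9/100 reflects
    [1 - (96/100) ^+ 2 < 8/100]. *)
Lemma exact_bad_slack v : exact_bad v ->
  [/\ (sz v)%:R - 1 + \sum_(f in upn v) ((sz f)%:R - (sz v)%:R) <= t%:R * slack ed v,
      ((sz v)%:R - 1) * (#|upn v|%:R + 1 - K) <= t%:R * slack ed v &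
      t%:R * slack ed v <= 9 / 100 * K].
Proof.
move=> hv; have hr := exact_bad_size hv; have /andP [_ hU] := hv.
have K0 : 0 < K := K_gt0 t_gt0 n_gt1; have z0 := z15 z_big.
have {hU} hU : K <= #|upn v|%:R by rewrite /K -natrM ler_nat.
have v2 : (2 <= sz v)%N by rewrite -(ler_nat R); lra.
have := key_inequality codeg (e := v) (Y := set0) v2 ltac:(by move=> f; rewrite inE).
rewrite big_set0 mul0r addr0 -/K; set S := \sum_(f in _) _ => h.
have S0 : 0 <= S by apply: sumr_ge0 => f fu; rewrite subr_ge0 upn_ge.
have h1 : 0 <= ((sz v)%:R - 1) * (#|upn v|%:R - K) by apply: mulr_ge0; move: hU hr z0; lra_above e1_full.
split; [by lra|by lra|].
rewrite /slack /K mulrCA; apply: ler_wpM2l => //.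
have h2 : 96 / 100 * z * (96 / 100 * z - 1) <= (sz v)%:R * ((sz v)%:R - 1) by apply: ler_pM; move: hr z0; lra_above e1_full.
have h3 : 10 ^+ 6 * z <= z * z by apply: ler_wpM2r; move: z0; lra_above e1_full.
by move: nz zn; rewrite !expr2; move: z0 h2 h3; lra_above e1_full.
Qed.

(** Each strictly larger member of [upn v] adds at least 1 to a total excess of at most
    [9/100 * K]. *)
Lemma exact_bad_level v : exact_bad v ->
  91 / 100 * K <= #|[set f in upn v | sz f == sz v]|%:R.
Proof.
move=> hv; have [h1 _ h2] := exact_bad_slack hv; have hr := exact_bad_size hv.
have /andP [_ hU] := hv; have {hU} hU : K <= #|upn v|%:R by rewrite /K -natrM ler_nat.
have z0 := z15 z_big; set P := [set f in _ | _].
have h3 : #|upn v|%:R = #|P|%:R + #|upn v :\: P|%:R :> R.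
  by rewrite -natrD -(cardsID P (upn v)) (setIidPr _) //; apply/subsetP => f; rewrite inE => /andP [].
have : #|upn v :\: P|%:R <= \sum_(f in upn v) ((sz f)%:R - (sz v)%:R) :> R.
  rewrite -sum1_card natr_sum big_mkcond [X in _ <= X]big_mkcond /=; apply: ler_sum => f _.
  rewrite in_setD [f \in P]in_set; case: (boolP (f \in upn v)) => [fu|]; last by rewrite andbF.
  have : (sz v <= sz f)%N by move: fu; rewrite inE => /andP [].
  rewrite andbT /=; case: (ltngtP (sz f) (sz v)) => //= [h _|-> _]; last by rewrite subrr.
  have : (sz v).+1%:R <= (sz f)%:R :> R by rewrite ler_nat.
  by rewrite -natr1; lra_above e1_full.
lra.
Qed.

(** The level of the smaller one and [upn] of the larger one are disjoint and would together exceed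
    the volume. *)
Lemma exact_bad_unique v w : exact_bad v -> exact_bad w -> sz v = sz w.
Proof.
wlog: v w / (sz v < sz w)%N => [hw hv h'|vw hv hw].
  by case: (ltngtP (sz v) (sz w)) => // h; [|apply/esym]; apply: hw.
have K0 : 0 < K := K_gt0 t_gt0 n_gt1.
have /andP [_ hU] := hw; have {hU} hU : K <= #|upn w|%:R by rewrite /K -natrM ler_nat.
have h1 := exact_bad_level hv; have h2 := exact_bad_size hv; have h3 := exact_bad_size hw.
set P := [set f in _ | _] in h1.
have : (96 / 100) ^+ 2 * #|P|%:R + (96 / 100) ^+ 2 * #|upn w|%:R <= (1 + 1 / 10 ^+ 10) * K.
  apply: (volume2 codeg t_gt0 n_gt1 z_big nz); try lra.
  - rewrite disjoint_subset; apply/subsetP => f; rewrite inE => /andP [_ /eqP fv]; rewrite !inE fv.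
    by rewrite negb_and -ltnNge vw orbT.
  - by move=> f; rewrite inE => /andP [/upn_ge ? _]; lra.
  - by move=> f /upn_ge ?; lra.
move=> h; exfalso; move: K0 hU h1 h; lra_above e1_full.
Qed.

Lemma exact_bad_above v : exact_bad v -> #|[set f | (sz v < sz f)%N]|%:R <= 2 / 10 * K.
Proof.
move=> hv; have K0 : 0 < K := K_gt0 t_gt0 n_gt1.
have h1 := exact_bad_level hv; have h2 := exact_bad_size hv.
set P := [set f in _ | _] in h1; set Q := [set f | _].
have : (96 / 100) ^+ 2 * #|P|%:R + (96 / 100) ^+ 2 * #|Q|%:R <= (1 + 1 / 10 ^+ 10) * K.
  apply: (volume2 codeg t_gt0 n_gt1 z_big nz); try lra.
  - rewrite disjoint_subset; apply/subsetP => f; rewrite inE => /andP [_ /eqP fv]; rewrite !inE fv.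
    by rewrite ltnn.
  - by move=> f; rewrite inE => /andP [/upn_ge ? _]; lra.
  - by move=> f; rewrite inE -(ltr_nat R); lra.
lra.
Qed.

(** No reserve has to be prepared: by [mid_few] no window below holds [2/5 * K] edges, so that
    clause of [partial_inv] is vacuous. *)
Lemma inv_of_greedy (phi : X -> option C) : proper e phi ->
  (forall x, x \in dom phi -> z / 200 <= (sz x)%:R) ->
  (forall psi v, proper e psi -> extends phi psi -> z / 200 <= (sz v)%:R -> v \notin dom psi ->
     (forall x, x \in dom psi -> x \in dom phi \/ (sz v <= sz x)%N) -> (#|seen e psi v| < #|C|)%N) ->
  exists psi, @partial_inv n t X C ed (z / 200) psi.
Proof.
move=> hp hd hs; have K0 : 0 < K := K_gt0 t_gt0 n_gt1; have z0 := z15 z_big.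
pose A := [set x | z / 200 <= (sz x)%:R].
have [psi [r1 r2 r3]] : exists psi, [/\ proper e psi, extends phi psi & dom psi = dom phi :|: A].
  apply: (greedy (adj_sym ed) (rk := sz) (adj_irr ed) hp) => psi v q1 q2 vA vd q3.
  apply: (hs psi v) => //; first by move: vA; rewrite inE.
  by move=> x /q3 [?|[_ ?]]; [left|right].
have psid x : x \in dom psi -> z / 200 <= (sz x)%:R.
  by rewrite r3 in_setU [x \in A]inE => /orP [/hd|].
exists psi; split=> //.
- by move=> x hx; rewrite r3 in_setU [x \in A]inE hx orbT.
- by move=> x /psid; lra.
move=> v vb; split=> [hi hhi|hw].
  have -> : window (3 / 4 * (z / 200)) hi v :&: dom psi = set0.
    apply/setP => x; rewrite in_setI in_window in_set0; apply/negbTE/negP => /andP [/and3P [_ _ h2] /psid].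
    by case: hhi h2 => ->; move: vb; lra_above e1_full.
  rewrite cards0; have : 0 <= rho * #|window (3 / 4 * (z / 200)) hi v|%:R by rewrite mulr_ge0 // /rho; lra_above e1_full.
  have : 0 <= 4 * eps * K by apply: mulr_ge0; rewrite ?/eps; move: K0; lra_above e1_full.
  by rewrite -/K; lra_above e1_full.
have := mid_few (Y := window (3 / 4 * (z / 200)) (3 / 2 * (z / 200)) v) _.
rewrite -/K in hw; suff hm f : f \in window (3 / 4 * (z / 200)) (3 / 2 * (z / 200)) v ->
  3 / 800 * z <= (sz f)%:R < (1 - 1 / 10 ^+ 7) * z by move=> /(_ hm); move: K0 hw; lra_above e1_full.
by rewrite in_window => /and3P [_ h1 h2]; apply/andP; split; lra.
Qed.



Hypothesis few : n%:R ^+ 6 * exp (- ((z + 1) / 10 ^+ 5)) < 1.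

Lemma plain_greedy : (forall v, ~~ exact_bad v) -> exists phi : X -> option C, @partial_inv n t X C ed (z / 200) phi.
Proof.
move=> good; apply: (inv_of_greedy (phi := fun=> None)) => //.
- by move=> x; rewrite in_dom eqxx.
- move=> psi v q1 _ vb vd q3.
  have := card_seen (e := e) (phi := psi) (v := v) (D := set0) (U := upn v) _ _ (sub0set _).
  rewrite cards0 addn0 => h; apply: leq_ltn_trans (h _ _) _ => [w|w vw wd|]; first by rewrite inE.
    by case: (q3 w wd) => [|hw]; [rewrite in_dom eqxx|rewrite inE [w \in nbr v]inE vw].
  by rewrite cardC ltnNge; have := good v; rewrite /exact_bad vb.
Qed.

(** All bad vertices have the size [r1] of [v1]. Smaller ones are safe as they are not bad, larger
    ones because few edges are larger and few were paired. At size [r1] the pairs save at least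
    [ts / 2000], whereas the excess is at most [ts / (r1 - 1)]. *)
Lemma paired_greedy v1 : exact_bad v1 -> exists phi : X -> option C, @partial_inv n t X C ed (z / 200) phi.
Proof.
move=> bad1; have K0 : 0 < K := K_gt0 t_gt0 n_gt1; have z0 := z15 z_big.
have KC : #|C|%:R = K := cardC_K cardC.
have r_big := exact_bad_size bad1.
pose r1 := sz v1; rewrite -/r1 in r_big.
have bad_r v : exact_bad v -> sz v = r1.
  by move=> hv; exact: (exact_bad_unique hv bad1).
pose X0 := [set x | (r1 <= sz x)%N].
have X0K : #|X0|%:R <= 2 * K.
  have : (96 / 100) ^+ 2 * #|X0|%:R <= (1 + 1 / 10 ^+ 10) * K.
    apply: (volume1 codeg t_gt0 n_gt1 z_big nz); first by lra.
    by move=> f; rewrite inE -(ler_nat R) => h; lra.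
  have : (0 : R) <= #|X0|%:R by []. lra.
have zK : z <= K.
  have h3 : 1 * z <= z * z by apply: ler_wpM2r; lra.
  have h4 : z * z <= n%:R by rewrite -expr2; exact: zn.
  have : 1 * n%:R <= K by apply: ler_wpM2r => //; rewrite (ler_nat _ 1).
  lra.
pose B := {v : X | exact_bad v}.
pose F (u : B) := upn (val u).
have [m [m1 m2]] := nat_half (ltac:(lra) : 1 <= K / 16).
have mC : (m <= #|C|)%N by rewrite -(ler_nat R) KC; lra.
have [cl cl_uniq cl_size] := uniq_seq_of_size mC.
have F_sub u : F u \subset X0.
  by apply/subsetP => f /upn_ge; rewrite inE -(bad_r _ (valP u)) -(ler_nat R).
(* [ts] may be as small as order [z], so deviations must be a small multiple of [z]; this still
   beats the [n ^ 6] events. *)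
pose d := (z + 1) / 10 ^+ 5.
pose q (u : B) : R := K * (t%:R * slack ed (val u)) / 3.
have slack_big (u : B) : 95 / 100 * z <= t%:R * slack ed (val u).
  have [h1 _ _] := exact_bad_slack (valP u).
  have : 0 <= \sum_(f in upn (val u)) ((sz f)%:R - (sz (val u))%:R) :> R.
    by apply: sumr_ge0 => f /upn_ge; rewrite subr_ge0.
  by move: h1; rewrite (bad_r _ (valP u)); move: z0 r_big; lra_above few.
have q_le (u : B) : q u <= #|nonadj e F u|%:R.
  have bu := valP u; have su := slack_big u; have ru := bad_r _ bu; have /andP [_ hU] := bu.
  have {hU} hU : K <= #|upn (val u)|%:R by rewrite /K -natrM ler_nat.
  have s0 : 0 <= slack ed (val u).
    have t0 : 0 < t%:R :> R by rewrite ltr0n.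
    by rewrite -(pmulr_rge0 _ t0); move: z0 su; lra_above few.
  have v3 : (3 <= sz (val u))%N by rewrite ru -(ler_nat R); move: z0 r_big; lra_above few.
  have := nonadjacent_upn codeg v3 (lexx 0) s0; cbv zeta.
  rewrite ru -/K !subr0 mulr0 addr0 => h.
  set ts := t%:R * slack _ _ in su h *.
  have i1 : (r1%:R - 1)^-1 <= 1 / 100 :> R.
    by rewrite -[1 / 100]invrK lef_pV2 ?posrE ?invr_gt0; move: r_big z0; lra_above few.
  have i0 : 0 <= (r1%:R - 1)^-1 :> R by rewrite invr_ge0; move: r_big z0; lra_above few.
  have ts0 : 0 <= ts by move: su z0; lra_above few.
  have {h} h := h hU ltac:(apply: mulr_ge0; move: ts0 i1; lra_above few).
  apply: le_trans h; rewrite /q -/ts.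
  have h2 : 99 / 100 * ts <= ts * (1 - (r1%:R - 1)^-1).
    by rewrite [X in X <= _]mulrC; apply: ler_wpM2l; move: ts0 i1; lra_above few.
  have h3 : K / 2 * (99 / 100 * ts) <= K / 2 * (ts * (1 - (r1%:R - 1)^-1)) by apply: ler_wpM2l; move: K0 h2; lra_above few.
  have h4 : t%:R * (r1%:R - 1) * ts <= K / 100 * ts.
    apply: ler_wpM2r => //; rewrite /K -mulrA; apply: ler_wpM2l => //.
    have h5 : r1%:R * (r1%:R - 1) <= n%:R :> R.
      by move: s0; rewrite /slack ru; lra_above few.
    have : 100 * (r1%:R - 1) <= r1%:R * (r1%:R - 1) :> R by apply: ler_wpM2r; move: r_big z0; lra_above few.
    by move: h5; lra_above few.
  have : 0 <= K * ts by apply: mulr_ge0; move: K0 ts0; lra_above few.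
  by move: h3 h4; lra_above few.
have q_big u : (8 * #|F u|%:R + 2) * d <= #|nonadj e F u|%:R / 4.
  apply: le_trans (_ : q u / 4 <= _); last by have := q_le u; lra_above few.
  have su := slack_big u; rewrite /q; set ts := t%:R * slack _ _ in su *.
  have hF : #|F u|%:R <= 2 * K by apply: le_trans X0K; rewrite ler_nat subset_leq_card.
  apply: le_trans (_ : (18 * K) * (ts / 10 ^+ 4) <= _).
    by have F0 := ler0n R #|F u|; apply: ler_pM; rewrite /d; move: F0 hF zK z0 su; lra_above few.
  have : 0 <= K * ts by apply: mulr_ge0; move: K0 su z0; lra_above few.
  by lra_above few.
have fewB : (#|{: void + B}|%:R + #|{: B}|%:R) * exp (- d) < 1.
  apply: le_lt_trans few; apply: ler_wpM2r; first exact/ltW/exp_gt0.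
  rewrite -natrD -natrX ler_nat card_sum card_void add0n.
  have h : (#|{: B}| <= #|X|)%N by rewrite card_sig; exact: max_card.
  apply: leq_trans (family_count n_gt1 cardX).
  apply: (@leq_trans (#|X| * 2)%N); first by rewrite muln2 -addnn leq_add.
  by rewrite -!addnA leq_addr.
have [|s [g _ gain_big]] := random_pairs (J := void) (fun=> set0) (adj_sym ed) (adj_irr ed) (ltac:(move: K0; lra_above few) : 0 < 2 * K)
  X0K F_sub cl_uniq _ q_big fewB.
  by rewrite cl_size; move: m2; lra_above few.
have [g1 g2 g3 g4 g5] := g.
have dX0 x : x \in dom (pcol s) -> (r1 <= sz x)%N.
  by rewrite in_dom; case E: (pcol s x) => [c|] // _; have [] := g1 _ _ E; rewrite inE.
apply: (inv_of_greedy (phi := pcol s)) => //.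
  by move=> x /dX0; rewrite -(ler_nat R); lra.
move=> psi v q1 q2 vb vd q3.
have seen_le (D U : {set X}) : doubled e psi v D -> (forall w, e v w -> w \in dom psi -> w \in U) ->
    D \subset U -> #|seen e psi v|%:R + #|D|%:R <= #|U|%:R :> R.
  by move=> h1 h2 h3; rewrite -natrD ler_nat; exact: card_seen h1 h2 h3.
have seen0 (U : {set X}) : (forall w, e v w -> w \in dom psi -> w \in U) -> #|seen e psi v|%:R <= #|U|%:R :> R.
  move=> h; have := seen_le set0 U; rewrite cards0 addr0; apply=> //; last exact: sub0set.
  by move=> w; rewrite inE.
rewrite -(ltr_nat R) KC.
case: (ltngtP (sz v) r1) => hv.
- have hU : (#|upn v| < t * n)%N.
    rewrite ltnNge; apply/negP => h; have : exact_bad v by rewrite /exact_bad vb.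
    by move/bad_r => h'; move: hv; rewrite h' ltnn.
  rewrite -(ltr_nat R) natrM -/K in hU; apply: le_lt_trans hU; apply: seen0 => w vw wd.
  rewrite inE [w \in nbr v]inE vw /=; case: (q3 w wd) => // /dX0 h; exact: leq_trans (ltnW hv) h.
- have above : #|[set f | (r1 < sz f)%N]|%:R <= 2 / 10 * K.
    exact: (exact_bad_above bad1).
  have : #|seen e psi v|%:R <= #|[set f | (r1 < sz f)%N] :|: dom (pcol s)|%:R :> R.
    apply: seen0 => w vw wd; rewrite in_setU; case: (q3 w wd) => [->|h]; first by rewrite orbT.
    by rewrite inE (leq_trans hv h).
  have : #|[set f | (r1 < sz f)%N] :|: dom (pcol s)|%:R <= #|[set f | (r1 < sz f)%N]|%:R + #|dom (pcol s)|%:R :> R.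
    by rewrite -natrD ler_nat (leq_card_setU _ _).1.
  have : #|dom (pcol s)|%:R <= 2 * m%:R :> R by rewrite -natrM ler_nat -cl_size.
  by move: above m2 K0; lra_above few.
have colU w : e v w -> w \in dom psi -> w \in upn v.
  move=> vw wd; rewrite inE [w \in nbr v]inE vw /= hv; case: (q3 w wd) => [/dX0 //|]; by rewrite hv.
case: (leqP (t * n) #|upn v|) => hU; last first.
  by rewrite -(ltr_nat R) natrM -/K in hU; apply: le_lt_trans hU; exact: seen0.
have bv : exact_bad v by rewrite /exact_bad vb.
pose u : B := exist _ v bv.
have dbl : doubled e psi v (gain F u s).
  apply: (doubled_extends q2); apply: gain_doubled g.
  by apply/subsetP => f; rewrite [f \in F u]inE => /andP [].
have gU : gain F u s \subset upn v by apply/subsetP => f; rewrite inE => /andP [].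
have := seen_le _ _ dbl colU gU.
have := gain_big u; have := q_le u; have su := slack_big u.
rewrite cl_size /q; set ts := t%:R * slack _ _ in su *; set Q : R := #|nonadj e F u|%:R; set G : R := #|gain F u s|%:R.
move=> hQ hG hs.
have [_ h2 _] := exact_bad_slack bv.
rewrite hv -/r1 -/K -[t%:R * slack _ _]/ts in h2.
have ts0 : 0 <= ts by move: su z0; lra_above few.
have KK : 0 < 4 * (2 * K) ^+ 2 by apply: mulr_gt0 => //; apply/exprn_gt0/mulr_gt0.
move: hQ hG => {q_le q_big gain_big slack_big fewB} hQ hG.
have hG2 : ts / 2000 <= G.
  apply: le_trans hG; have : ts / 1600 <= m%:R * Q / (4 * (2 * K) ^+ 2).
    rewrite ler_pdivlMr //; apply: le_trans (_ : (K / 32) * (K * ts / 3) <= _).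
      have : 0 <= K * K * ts by apply: mulr_ge0; [apply: mulr_ge0; exact: ltW|].
      by rewrite exprMn !expr2; lra_above few.
    have Kts : 0 <= K * ts by apply: mulr_ge0 => //; exact: ltW.
    by apply: ler_pM; move: m1 hQ K0 Kts; lra_above few.
  by rewrite /d; move: su z0 ts0; lra_above few.
have : #|upn v|%:R + 1 - K <= ts / 2000.
  have r1pos : 0 < r1%:R - 1 :> R by move: r_big z0; lra_above few.
  rewrite -(ler_pM2l r1pos); apply: le_trans h2 _.
  have : 2000 * (ts / 2000) <= (r1%:R - 1) * (ts / 2000) by apply: ler_wpM2r; move: r_big z0 ts0; lra_above few.
  by lra_above few.
by move: hG2 hs; lra_above few.
Qed.

Lemma top_dense : exists phi : X -> option C, @partial_inv n t X C ed (z / 200) phi.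
Proof.
case: (boolP [exists v, exact_bad v]) => [/existsP [v]|]; first exact: paired_greedy.
by rewrite negb_exists => /forallP; exact: plain_greedy.
Qed.

End Dense.

(** * Linear slack at every full neighbourhood *)

Section Sparse.

Variables (n t : nat) (X C : finType) (ed : X -> {set 'I_n}) (z : R).
Hypothesis codeg : forall i j, i != j -> (#|[set x | (i \in ed x) && (j \in ed x)]| <= t)%N.
Hypothesis t_gt0 : (0 < t)%N.
Hypothesis n_gt1 : (1 < n)%N.
Hypothesis cardC : #|C| = (t * n)%N.
Hypothesis cardX : (#|X| <= n * n)%N.
Hypothesis z_big : 10 ^+ 40 <= z.
Hypothesis nz : n%:R <= (z + 1) ^+ 2.
Hypothesis zn : z ^+ 2 <= n%:R.
Let K : R := t%:R * n%:R.
Notation sz := (sz ed).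
Notation nbr := (nbr ed).
Notation upn := (upn ed).
Notation e := (adj ed).
Notation window := (window ed).


(* As no large vertex is full, every full one has slack of order n. *)
Notation full v := ((1 - 1 / 10 ^+ 8) * K <= #|upn v|%:R).
Hypothesis sparse : forall v, (1 - 1 / 10 ^+ 7) * z <= (sz v)%:R -> ~~ full v.
Let d : R := 1 / 10 ^+ 30 * K.
Hypothesis few : n%:R ^+ 6 * exp (- d) < 1.

Let b0 : R := z / 200.
Let low v := window (3 / 4 * b0) (3 / 2 * b0) v.

(** One random run serves two purposes: [true] marks full neighbourhoods of edges coloured in this
    phase, [false] the windows whose reserve [partial_inv] demands for later. *)
Let relevant (p : X * bool) : bool :=
  if p.2 then (b0 <= (sz p.1)%:R) && full p.1 else ((sz p.1)%:R < b0) && (2 / 5 * K <= #|low p.1|%:R).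
Let family (p : X * bool) := if p.2 then upn p.1 else low p.1.

Lemma large_K : z <= K.
Proof.
have z0 := z15 z_big.
have h3 : 1 * z <= z * z by apply: ler_wpM2r; lra.
have h4 : z * z <= n%:R by rewrite -expr2; exact: zn.
have : 1 * n%:R <= K by apply: ler_wpM2r => //; rewrite (ler_nat _ 1).
lra.
Qed.

Lemma upn_pairs v : b0 <= (sz v)%:R -> full v -> 1 / 10 ^+ 8 * K * K <= #|nonadjacent_pairs ed (upn v)|%:R.
Proof.
move=> vb hU; have K0 : 0 < K := K_gt0 t_gt0 n_gt1; have z0 := z15 z_big; have zK := large_K.
have rz : (sz v)%:R < (1 - 1 / 10 ^+ 7) * z by rewrite ltNge; apply/negP => /sparse; rewrite hU.
have b0_big : 10 ^+ 12 <= b0 by rewrite /b0; lra.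
have v3 : (3 <= sz v)%N by rewrite -(ler_nat R); lra.
have slack_big : 19 / 10 * (1 / 10 ^+ 7) * n%:R <= slack ed v.
  rewrite /slack; set r : R := (sz v)%:R in vb rz *.
  have h1 : r * (r - 1) <= ((1 - 1 / 10 ^+ 7) * z) * ((1 - 1 / 10 ^+ 7) * z) by apply: ler_pM; move: rz b0_big vb; lra_above family.
  have h2 : 10 ^+ 15 * z <= z * z by apply: ler_wpM2r; move: z0; lra_above family.
  by move: nz zn; rewrite !expr2; lra.
have s0 : 0 <= slack ed v by apply: le_trans slack_big; rewrite mulr_ge0 //; lra.
have t0 : 0 <= t%:R :> R by [].
have g0 : 0 <= 1 / 10 ^+ 8 * K by apply: mulr_ge0; move: K0; lra_above family.
have := nonadjacent_upn codeg v3 g0 s0; cbv zeta; rewrite -/K.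
set r : R := (sz v)%:R in vb rz *; set ts := t%:R * slack ed v.
have ts_big : 19 / 10 * (1 / 10 ^+ 7) * K <= ts.
  by rewrite /K mulrCA; apply: ler_wpM2l.
have rr : r * (r - 1) <= n%:R by move: s0; rewrite /slack -/r; lra_above family.
have ts_le : ts <= K.
  rewrite /ts /K; apply: ler_wpM2l => //; rewrite /slack -/r.
  have : 0 <= r * (r - 1) by apply: mulr_ge0; move: b0_big vb; lra_above family.
  by lra_above family.
have i1 : (r - 1)^-1 <= 1 / 100.
  by rewrite -[1 / 100]invrK lef_pV2 ?posrE ?invr_gt0; move: vb b0_big; lra_above family.
have i0 : 0 <= (r - 1)^-1 by rewrite invr_ge0; move: b0_big vb; lra_above family.
have M1 : 18 / 10 * (1 / 10 ^+ 7) * K <= ts * (1 - (r - 1)^-1).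
  apply: le_trans (_ : 99 / 100 * ts <= _); first by move: K0 ts_big; lra_above family.
  by rewrite [X in X <= _]mulrC; apply: ler_wpM2l; move: i1 K0 ts_big; lra_above family.
set M := ts * _ in M1 *.
have hM : 0 <= M - 1 / 10 ^+ 8 * K by move: K0 M1; lra_above family.
have hU' : K - 1 / 10 ^+ 8 * K <= #|upn v|%:R by move: hU; lra_above family.
move=> /(_ hU' hM); apply: le_trans.
have h1 : (49 / 100 * K) * (17 / 10 * (1 / 10 ^+ 7) * K) <= (K / 2 - 1 / 10 ^+ 8 * K) * (M - 1 / 10 ^+ 8 * K).
  by apply: ler_pM; move: K0 M1; lra_above family.
have h2 : t%:R * (r - 1) * ts <= 1 / 10 ^+ 10 * K * K.
  apply: ler_pM => //; [by apply: mulr_ge0; move: t0 vb b0_big; lra_above family|by move: ts_big K0; lra_above family|].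
  rewrite /K mulrCA; apply: ler_wpM2l => //.
  have : 10 ^+ 11 * (r - 1) <= r * (r - 1) by apply: ler_wpM2r; move: vb b0_big; lra_above family.
  by move: rr vb b0_big; lra_above family.
have h3 : t%:R * (r - 1) * ((r - 1) * (1 / 10 ^+ 8 * K)) <= 1 / 10 ^+ 8 * K * K.
  have -> : t%:R * (r - 1) * ((r - 1) * (1 / 10 ^+ 8 * K)) = t%:R * ((r - 1) * (r - 1)) * (1 / 10 ^+ 8 * K) by ring.
  rewrite [X in _ <= X]mulrC; apply: ler_wpM2r => //; apply: ler_wpM2l => //.
  have : 0 <= 1 * (r - 1) by move: vb b0_big; lra_above family.
  by move: rr; lra_above family.
have KK : 0 <= K * K by apply: mulr_ge0; exact: ltW.
by rewrite mulrDr; move: KK h1 h2 h3; lra_above family.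
Qed.

(** By [window_crowded], most members have at most [K / 100] neighbours inside a set of at least
    [2/5 * K]. *)
Lemma low_pairs v : (sz v)%:R < b0 -> 2 / 5 * K <= #|low v|%:R -> 1 / 10 * K * K <= #|nonadjacent_pairs ed (low v)|%:R.
Proof.
move=> vb hU; have K0 : 0 < K := K_gt0 t_gt0 n_gt1; have z0 := z15 z_big; have zK := large_K.
have b0_big : 10 ^+ 12 <= b0 by rewrite /b0; lra.
have SN : low v \subset nbr v by apply/subsetP => f; rewrite inE => /andP [].
have hS f : f \in low v -> 3 / 4 * b0 <= (sz f)%:R <= 3 / 2 * b0.
  by rewrite in_window => /and3P [_ -> /ltW ->].
have := window_crowded codeg (ltac:(lra) : 1 < 3 / 4 * b0) SN hS; rewrite -/K.
set thr := K / _ + _; set P := [set f in _ | _] => hP.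
have v0 : 0 <= (sz v)%:R :> R by [].
have t0 : 0 <= t%:R :> R by [].
have tb : t%:R * (b0 * b0) <= K / 200 ^+ 2.
  rewrite /K -mulrA; apply: ler_wpM2l => //; move: zn; rewrite /b0 expr2; lra_above family.
have thr_le : thr <= 1 / 100 * K.
  have h1 : K / (3 / 4 * b0 - 1) <= 1 / 10 ^+ 5 * K.
    rewrite ler_pdivrMr; last by move: b0_big; lra_above family.
    by rewrite [X in _ <= X]mulrAC -[X in X <= _]mul1r; apply: ler_wpM2r; move: b0_big K0; lra_above family.
  have : t%:R * ((sz v)%:R * (3 / 2 * b0)) <= t%:R * (b0 * (3 / 2 * b0)).
    by apply: ler_wpM2l => //; apply: ler_wpM2r; move: vb b0_big; lra_above family.
  rewrite /thr; move: K0 tb h1; lra_above family.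
have P_le : #|P|%:R <= 1 / 100 * K.
  have : t%:R * (sz v)%:R ^+ 2 <= t%:R * (b0 * b0).
    by rewrite expr2; apply: ler_wpM2l => //; apply: ler_pM; move: vb v0; lra_above family.
  by move: K0 hP tb; lra_above family.
have h1 : #|low v|%:R = #|P|%:R + #|low v :\: P|%:R :> R.
  by rewrite -natrD -(cardsID P (low v)) (setIidPr _) //; apply/subsetP => f; rewrite inE => /andP [].
have := @nonadjacent_pairs_ge n X ed (low v) (low v :\: P) (fun=> 38 / 100 * K) (subsetDl _ _) _.
rewrite sumr_const -[X in X <= _]mulr_natl => h; apply: le_trans (h _).
  apply: le_trans (_ : 39 / 100 * K * (38 / 100 * K) <= _).
    have : 0 <= K * K by apply: mulr_ge0; exact: ltW.
    by lra_above family.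
  by apply: ler_wpM2r; move: hU P_le h1 K0; lra_above family.
move=> f; rewrite in_setD [f \in P]in_set => /andP [h2 fl].
move: h2; rewrite fl /= -leNgt => h2.
have h3 : #|low v :&: nbr f|%:R <= 1 / 100 * K by apply: le_trans thr_le.
by move: hU z0 zK thr_le h2; lra_above family.
Qed.

Lemma family_sub p : family p \subset nbr p.1.
Proof. by case: p => v []; apply/subsetP => f; rewrite inE => /andP []. Qed.

(** Pairs are drawn from all sizes at least [3/4 * b0]; the volume bound keeps this set below
    [10 ^+ 5 * K], so quadratically many good pairs yield linear gains. *)
Lemma reserve : exists phi : X -> option C,
  [/\ proper e phi, (forall x, x \in dom phi -> 3 / 4 * b0 <= (sz x)%:R),
      #|dom phi|%:R <= 1 / 2 * (1 / 10 ^+ 8) * K,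
      (forall v hi, hi = (sz v)%:R \/ hi = b0 -> #|window (3 / 4 * b0) hi v :&: dom phi|%:R <=
          rho * (1 / 10 ^+ 2) * #|window (3 / 4 * b0) hi v|%:R + 4 * d) &
      (forall v, (b0 <= (sz v)%:R -> full v -> exists2 D, doubled e phi v D & 9 / 10 ^+ 29 * K <= #|D|%:R) /\
        ((sz v)%:R < b0 -> 2 / 5 * K <= #|low v|%:R -> exists2 D, doubled e phi v D & sig * K <= #|D|%:R))].
Proof.
have K0 : 0 < K := K_gt0 t_gt0 n_gt1; have z0 := z15 z_big; have zK := large_K.
have zb := z_big.
have b0_big : 10 ^+ 12 <= b0 by rewrite /b0; lra.
have KK : 0 < K * K by apply: mulr_gt0.
have KC : #|C|%:R = K := cardC_K cardC.
pose X0 := [set x | 3 / 4 * b0 <= (sz x)%:R].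
have X0K : #|X0|%:R <= 10 ^+ 5 * K.
  have : (3 / 800) ^+ 2 * #|X0|%:R <= (1 + 1 / 10 ^+ 10) * K.
    apply: (volume1 codeg t_gt0 n_gt1 z_big nz); first by lra.
    by move=> f; rewrite inE /b0 => h; lra.
  lra.
pose B := {p : X * bool | relevant p}.
pose F (u : B) := family (val u).
have F_sub u : F u \subset X0.
  case: u => [[v [] /= hu]]; apply/subsetP => f; rewrite /F /family /= => fF.
    have := upn_ge fF; move: hu; rewrite /relevant /= inE => /andP [h _]; lra.
  by move: fF; rewrite in_window inE => /and3P [].
(* At most [2 * m] edges get coloured, half of the gap [1 / 10 ^+ 8 * K] that is left at vertices
   that are not full. *)
have [m [m1 m2]] := nat_half (ltac:(lra) : 1 <= 1 / 4 * (1 / 10 ^+ 8) * K).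
have mC : (m <= #|C|)%N by rewrite -(ler_nat R) KC; move: K0 m2; lra_above family.
have [cl cl_uniq cl_size] := uniq_seq_of_size mC.
have q_rel v b : relevant (v, b) -> 1 / 10 ^+ 8 * K * K <= #|nonadjacent_pairs ed (family (v, b))|%:R.
  case: b => /andP [h1 h2]; first exact: upn_pairs.
  by apply: le_trans (low_pairs h1 h2); move: KK; lra_above family.
have nonadjE u : nonadj e F u = nonadjacent_pairs ed (family (val u)) by [].
have q_big u : (8 * #|F u|%:R + 2) * d <= #|nonadj e F u|%:R / 4.
  rewrite nonadjE; case: u => -[v b] hu /=; have hq := q_rel v b hu.
  have hF : #|F (exist _ (v, b) hu)|%:R <= 10 ^+ 5 * K by apply: le_trans X0K; rewrite ler_nat subset_leq_card.
  have F0 := ler0n R #|F (exist _ (v, b) hu)|.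
  apply: le_trans (_ : (10 ^+ 6 * K) * (1 / 10 ^+ 30 * K) <= _); last by move: KK hq; lra_above family.
  by apply: ler_pM; rewrite /d; lra.
pose Z (j : X * bool) := window (3 / 4 * b0) (if j.2 then (sz j.1)%:R else b0) j.1.
have fewB : (#|{: (X * bool) + B}|%:R + #|{: B}|%:R) * exp (- d) < 1.
  apply: le_lt_trans few; apply: ler_wpM2r; first exact/ltW/exp_gt0.
  rewrite -natrD -natrX ler_nat card_sum card_prod card_bool.
  have h : (#|{: B}| <= #|X| * 2)%N.
    by rewrite card_sig; apply: leq_trans (max_card _) _; rewrite card_prod card_bool.
  have h2 : (0 < n * n)%N by rewrite muln_gt0 ltnW.
  have h4 : (6 * (n * n) <= n ^ 6)%N.
    have h7 : (4 <= n * n)%N by rewrite (leq_mul (m1 := 2) (m2 := 2)).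
    have -> : (n ^ 6 = (n * n) * ((n * n) * (n * n)))%N by rewrite !expnS expn0 !mulnA muln1.
    rewrite mulnC leq_mul2l; apply/orP; right; apply: leq_trans (_ : 4 * 4 <= _)%N => //; exact: leq_mul.
  apply: leq_trans h4; apply: (@leq_trans (6 * #|X|)%N); last by rewrite leq_mul2l cardX orbT.
  by move: h; rewrite -[#|{: B}|]/(#|{: B}|); move: (#|{: B}|) (#|X|) => ? ?; lia.
have [|s [g Zs gain_big]] := random_pairs Z (adj_sym ed) (adj_irr ed) (ltac:(lra) : 0 < 10 ^+ 5 * K)
  X0K F_sub cl_uniq _ q_big fewB.
  by rewrite cl_size; lra.
have [g1 g2 g3 g4 g5] := g; rewrite cl_size in gain_big Zs g5.
have gain_le u (c : R) : 0 <= c -> c * K * K <= #|nonadj e F u|%:R -> c * (1 / 10 ^+ 20) * K - 4 * d <= #|gain F u s|%:R.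
  move=> c0 hc; apply: le_trans (gain_big u); rewrite lerD2r ler_pdivlMr; last first.
    by apply: mulr_gt0 => //; apply/exprn_gt0/mulr_gt0; lra.
  apply: le_trans (_ : (1 / 4 * (1 / 10 ^+ 8) * K / 2) * (c * K * K) <= _).
    have : 0 <= c * K * (K * K) by apply: mulr_ge0; [apply: mulr_ge0; lra|lra].
    by rewrite (expr2 (10 ^+ 5 * K)); lra.
  have : 0 <= c * K * K by apply: mulr_ge0; [apply: mulr_ge0|]; lra.
  by move=> ?; apply: ler_pM; lra.
exists (pcol s); split.
- exact: g2.
- by move=> x; rewrite in_dom; case E: (pcol s x) => [c|] // _; have [] := g1 _ _ E; rewrite inE.
- have : #|dom (pcol s)|%:R <= 2 * m%:R :> R by rewrite -natrM ler_nat.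
  lra.
- move=> v hi hhi; have [j Zj] : exists j, Z j = window (3 / 4 * b0) hi v.
    by case: hhi => ->; [exists (v, true)|exists (v, false)].
  have := Zs j; rewrite Zj; set S := window _ _ _.
  have -> : dm (pcol s) S = S :&: dom (pcol s) by apply/setP => x; rewrite !inE.
  have : 4 * m%:R * #|S|%:R / (10 ^+ 5 * K) <= rho * (1 / 10 ^+ 2) * #|S|%:R.
    rewrite ler_pdivrMr; last by lra.
    have : m%:R * #|S|%:R <= 1 / 4 * (1 / 10 ^+ 8) * K * #|S|%:R by apply: ler_wpM2r.
    have : 0 <= K * #|S|%:R by apply: mulr_ge0 => //; exact: ltW.
    rewrite /rho; lra.
  lra.
move=> v; split=> h1 h2.
  have rel : relevant (v, true) by rewrite /relevant /= h1.
  exists (gain F (exist _ (v, true) rel) s); first by apply: gain_doubled g; exact: (family_sub (v, true)).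
  have := gain_le (exist _ (v, true) rel) (1 / 10 ^+ 8) ltac:(lra) (q_rel v true rel).
  rewrite /d; lra.
have rel : relevant (v, false) by rewrite /relevant /= h1.
exists (gain F (exist _ (v, false) rel) s); first by apply: gain_doubled g; exact: (family_sub (v, false)).
have := gain_le (exist _ (v, false) rel) (1 / 10) ltac:(lra) (low_pairs h1 h2).
rewrite /d /sig; lra.
Qed.


(** As in [seen_bound]: smaller coloured neighbours are paid for by the term with [Y] in [key_K],
    the remaining excess by [D]. *)
Lemma full_seen (phi psi : X -> option C) v : b0 <= (sz v)%:R -> full v ->
  (exists2 D, doubled e psi v D & 9 / 10 ^+ 29 * K <= #|D|%:R) ->
  (#|window (3 / 4 * b0) (sz v)%:R v :&: dom phi|%:R <=
          rho * (1 / 10 ^+ 2) * #|window (3 / 4 * b0) (sz v)%:R v|%:R + 4 * d) ->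
  (forall w, e v w -> w \in dom psi -> w \in upn v :|: (window (3 / 4 * b0) (sz v)%:R v :&: dom phi)) ->
  #|seen e psi v|%:R < K.
Proof.
move=> vb hU [D dD hD] hY' hcol; have K0 : 0 < K := K_gt0 t_gt0 n_gt1; have z0 := z_big.
have rz : (sz v)%:R < (1 - 1 / 10 ^+ 7) * z by rewrite ltNge; apply/negP => /sparse; rewrite hU.
set r : R := (sz v)%:R in vb rz hY' hcol *; set Y := window _ _ v in hY' hcol *.
have r_big : 10 ^+ 30 + 1 <= r by move: vb; rewrite /b0; lra.
have v2 : (2 <= sz v)%N by rewrite -(ler_nat R); lra.
have hY f : f \in Y -> e v f /\ (sz f < sz v)%N by rewrite /Y in_window ltr_nat => /and3P [].
have := key_K codeg v2 hY; rewrite -/r -/K; set S1 := \sum_(f in upn v) _; set S2 := \sum_(f in Y) _ => h.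
have hS1 : 0 <= S1 by apply: sumr_ge0 => f /upn_ge; rewrite subr_ge0.
have hS2 : (r - 1) * (1 / 10 ^+ 5 * #|Y|%:R) <= S2 / r.
  rewrite ler_pdivlMr; last by lra.
  have -> : (r - 1) * (1 / 10 ^+ 5 * #|Y|%:R) * r = (r * (r - 1) / 10 ^+ 5) * #|Y|%:R by ring.
  rewrite mulr_natr -sumr_const; apply: ler_sum => f; rewrite /Y in_window => /and3P [_ hf _].
  apply: (@le_trans _ _ ((3 / 800 * z) * (3 / 800 * z - 1))); last by apply: ler_pM; move: hf; rewrite /b0; lra.
  have h1 : r * (r - 1) <= z * z by apply: ler_pM; lra.
  have h2 : 10 ^+ 15 * z <= z * z by apply: ler_wpM2r; lra.
  lra.
have h5 : #|upn v|%:R + 1 - K + 1 / 10 ^+ 5 * #|Y|%:R <= 1 / 10 ^+ 30 * K.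
  have r1 : 0 < r - 1 by lra.
  rewrite -(ler_pM2l r1) mulrDr; have : K <= (r - 1) * (1 / 10 ^+ 30 * K).
    rewrite mulrA -[X in X <= _]mul1r; apply: ler_wpM2r; lra.
  have : (0 : R) <= t%:R by [].
  lra.
have DU : D \subset upn v :|: (Y :&: dom phi).
  by apply/subsetP => w /dD [h1 [w' [_ _ h2 _]]]; apply: hcol => //; apply/domP.
have := card_seen dD hcol DU; rewrite -(ler_nat R) natrD => hs.
have cardU : #|upn v :|: (Y :&: dom phi)|%:R <= #|upn v|%:R + #|Y :&: dom phi|%:R :> R.
  by rewrite -natrD ler_nat (leq_card_setU _ _).1.
have Y0 := ler0n R #|Y|; rewrite /rho /d in hY'.
lra.
Qed.

Lemma top_sparse : exists phi : X -> option C, @partial_inv n t X C ed b0 phi.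
Proof.
have K0 : 0 < K := K_gt0 t_gt0 n_gt1; have z0 := z15 z_big.
have KC : #|C|%:R = K := cardC_K cardC.
have [phi [p1 p2 p3 p4 p5]] := reserve.
pose A := [set x | b0 <= (sz x)%:R].
have [psi [r1 r2 r3]] : exists psi, [/\ proper e psi, extends phi psi & dom psi = dom phi :|: A].
  apply: (greedy (adj_sym ed) (rk := sz) (adj_irr ed) p1) => psi v q1 q2 vA vd q3.
  have vb : b0 <= (sz v)%:R by move: vA; rewrite inE.
  rewrite -(ltr_nat R) KC; case: (boolP (full v)) => hU.
    have [/(_ vb hU) [D dD hD] _] := p5 v.
    apply: (full_seen (phi := phi) vb hU).
    - by exists D => //; exact: doubled_extends dD.
    - by apply: p4; left.
    - move=> w vw wd; rewrite in_setU in_setI in_window vw ltr_nat [w \in upn v]inE [w \in nbr v]inE vw /=.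
      case: leqP => //= wv; case: (q3 w wd) => [wc|[_]]; last by rewrite leqNgt wv.
      by rewrite wc p2.
  have := card_seen (e := e) (phi := psi) (v := v) (D := set0) (U := upn v :|: dom phi) _ _ (sub0set _).
  rewrite cards0 addn0 => hs.
  have {}hs : (#|seen e psi v| <= #|upn v :|: dom phi|)%N.
    apply: hs => [w|w vw wd]; first by rewrite inE.
    rewrite in_setU; case: (q3 w wd) => [->|[_ h]]; first by rewrite orbT.
    by rewrite inE [w \in nbr v]inE vw h.
  have := leq_trans hs (leq_card_setU _ _).1; rewrite -(ler_nat R) natrD.
  by move: hU; rewrite -ltNge; lra.
exists psi; split=> //.
- by move=> x hx; rewrite r3 in_setU [x \in A]inE hx orbT.
- by move=> x; rewrite r3 in_setU [x \in A]inE => /orP [/p2|] //; rewrite /b0; lra.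
move=> v vb; split=> [hi hhi|hw].
  have -> : window (3 / 4 * b0) hi v :&: dom psi = window (3 / 4 * b0) hi v :&: dom phi.
    apply/setP => x; rewrite !in_setI; case: (boolP (x \in window _ _ _)) => //=.
    rewrite in_window r3 in_setU [x \in A]inE => /and3P [_ _ q2].
    have q3 : (sz x)%:R < b0 by case: hhi q2 => -> q2; lra.
    by rewrite [b0 <= _]leNgt q3 orbF.
  apply: le_trans (p4 v hi hhi) _; have : 0 <= rho * #|window (3 / 4 * b0) hi v|%:R by rewrite mulr_ge0 // /rho; lra.
  rewrite /d /eps -/K; lra.
have [_ /(_ vb hw) [D dD hD]] := p5 v.
by exists D => //; exact: doubled_extends dD.
Qed.

End Sparse.

(** * The upper bound *)

Lemma nat_sqrt (n : nat) : exists z : nat, (z ^ 2 <= n < z.+1 ^ 2)%N.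
Proof.
elim: n => [|n [z /andP [h1 h2]]]; first by exists 0%N.
case: (ltnP n.+1 (z.+1 ^ 2)) => h; [exists z|exists z.+1]; rewrite h ?(leqW h1) //=.
by apply: leq_ltn_trans h2 _; rewrite ltn_exp2r.
Qed.

(** The dichotomy is whether some edge of size nearly [z] has a nearly full neighbourhood. Either
    way sizes from [b0 = z / 200] on get coloured, and [b0 ^+ 2 <= n / 200 ^+ 2] is what the windows
    require. *)
Lemma edge_coloring : exists N : nat, forall (n t : nat) (X C : finType) (ed : X -> {set 'I_n}),
  (N <= n)%N -> (1 < t)%N ->
  (forall i j, i != j -> (#|[set x | (i \in ed x) && (j \in ed x)]| <= t)%N) ->
  (forall i, (#|[set x | i \in ed x]| <= n)%N) ->
  #|C| = (t * n)%N -> (#|X| <= n * n)%N ->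
  exists psi : X -> option C, proper (adj ed) psi /\ forall x, x \in dom psi.
Proof.
have [N1 hN1] := finish.
have [N2 hN2] := exp_beats_poly 6 (ltac:(rewrite /eps; lra) : 0 < eps).
have [N3 hN3] := exp_beats_poly 6 (ltac:(lra) : (0 : R) < 1 / 10 ^+ 30).
have [N4 hN4] := exp_beats_poly 6 (ltac:(lra) : (0 : R) < 1 / 10 ^+ 5).
have [N5 hN5] := nat_ge ((10 ^+ 40 + 1) ^+ 2).
exists (N1 + N2 + N3 + N4 + N5 + 2)%N => n t X C ed hn t1 codeg deg cardC cardX.
have [n1 l1 l2 l3 [l4 l5]] : [/\ (1 < n)%N, (N1 <= n)%N, (N2 <= n)%N, (N3 <= n)%N & (N4 <= n)%N /\ (N5 <= n)%N].
  by split; try split; lia.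
have t0 := ltnW t1; pose K : R := t%:R * n%:R; have K0 : 0 < K := K_gt0 t0 n1.
have [k /andP [k1 k2]] := nat_sqrt n; pose z : R := k%:R.
have zn : z ^+ 2 <= n%:R by rewrite /z -natrX ler_nat.
have nz' : n%:R < (z + 1) ^+ 2 by rewrite /z natr1 -natrX ltr_nat.
have nz := ltW nz'.
have z0 : 0 <= z by rewrite /z.
have z_big : 10 ^+ 40 <= z.
  rewrite leNgt; apply/negP => h; have := hN5 n l5; apply/negP; rewrite -ltNge.
  by apply: lt_le_trans nz' _; rewrite !expr2; apply: ler_pM; lra.
have nK : n%:R <= K.
  by rewrite -[X in X <= _]mul1r; apply: ler_wpM2r => //; rewrite (ler_nat _ 1).
have n1R : 1 <= n%:R :> R by rewrite (ler_nat _ 1) ltnW.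
have nKK : n%:R <= K ^+ 2.
  by rewrite expr2 -[X in X <= _]mul1r; apply: ler_pM; lra.
have few2 := hN2 n K l2 (ltW K0) nKK.
have few3 := hN3 n K l3 (ltW K0) nKK.
have few4 : n%:R ^+ 6 * exp (- ((z + 1) / 10 ^+ 5)) < 1.
  have -> : (z + 1) / 10 ^+ 5 = 1 / 10 ^+ 5 * (z + 1) by ring.
  by apply: hN4 => //; lra.
have [phi inv] : exists phi : X -> option C, partial_inv t ed (z / 200) phi.
  case: (boolP [exists v, ((1 - 1 / 10 ^+ 7) * z <= (sz ed v)%:R) && ((1 - 1 / 10 ^+ 8) * K <= #|upn ed v|%:R)]).
    by case/existsP => v /andP [v1 v2]; exact: (top_dense codeg t0 n1 cardC cardX z_big nz zn v1 v2 few4).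
  rewrite negb_exists => /forallP h.
  apply: (top_sparse codeg t0 n1 cardC cardX z_big nz zn _ few3) => v v1.
  by have := h v; rewrite v1.
have [j hj] := nat_ge (z / 200); have {}hj := hj j (leqnn _).
have [|||b [psi [b1 b2 b3]]] := iterate_windows codeg t1 n1 cardC cardX (j := j) _ _ _ few2 inv.
- by move: z_big; rewrite /R1; lra.
- apply: le_trans hj _; apply: (@le_trans _ _ (2 ^+ j)).
    by rewrite -natrX ler_nat ltnW // ltn_expl.
  by rewrite ler_peMr ?exprn_ge0 // /R1; lra.
- by move: zn; rewrite !expr2; lra.
exact: (hN1 n t X C ed l1 t1 n1 codeg deg cardC cardX b psi b1 b2 b3).
Qed.

Local Close Scope ring_scope.

Lemma chromatic_le (T : finType) (U : {set T}) (r : rel T) (k : nat) : colorable U r k -> chromatic U r <= k.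
Proof. by rewrite /chromatic; case: ex_minnP => m _ h /h. Qed.

Lemma chromatic_upper : exists n0 : nat, forall n t : nat, n0 <= n -> 2 <= t ->
     forall (T : finType) (V : 'I_n -> {set T}),
       (forall i, #|V i| <= n) ->
       (forall i j, i != j -> #|V i :&: V j| <= t) ->
       chromatic (union_vertices V) (union_adj V) <= t * n.
Proof.
have [N hN] := edge_coloring; exists N.+1 => n t Nn t2 T V Vn Vt.
pose X := {x : T | x \in union_vertices V}.
pose ed (x : X) := [set i | val x \in V i].
have card_val (A : {set X}) (B : {set T}) : (forall x, x \in A -> val x \in B) -> #|A| <= #|B|.
  move=> h; rewrite -(card_imset _ val_inj); apply/subset_leq_card/subsetP => _ /imsetP [x xA ->].
  exact: h.
have n_gt0 : 0 < n by apply: leq_trans Nn.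
have C_gt0 : 0 < t * n by rewrite muln_gt0 n_gt0 (ltnW t2).
have [||||psi [psi1 psi2]] := hN n t X 'I_(t * n) ed (ltnW Nn) t2.
- by move=> i j ij; apply: leq_trans (Vt i j ij); apply: card_val => x; rewrite !inE.
- by move=> i; apply: leq_trans (Vn i); apply: card_val => x; rewrite !inE.
- by rewrite card_ord.
- have h : #|union_vertices V| <= #|[set: 'I_n]| * n.
    by apply: (card_le_union (F := V)) => // x /bigcupP [i _ xi]; exists i.
  rewrite cardsT card_ord in h; rewrite -cardsT; apply: leq_trans h.
  by apply: card_val => x _; exact: valP.
apply: chromatic_le; apply/existsP.
(* The default colour is used only outside the union; on it [insub] succeeds and [psi] is
   defined. *)
pose f (x : T) : 'I_(t * n) := odflt (Ordinal C_gt0) (obind psi (insub x : option X)).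
exists [ffun x => f x]; apply/forallP => x; apply/implyP => xU; apply/forallP => y; apply/implyP => yU.
apply/implyP => /andP [xy /andP [_ /existsP [i /andP [xi yi]]]]; rewrite !ffunE /f.
rewrite (insubT (fun x => x \in union_vertices V) xU) (insubT (fun x => x \in union_vertices V) yU) /=.
set x' := Sub x xU; set y' := Sub y yU.
have axy : adj ed x' y'.
  by apply/adjP; split=> //; exists i; rewrite inE.
have hx := psi2 x'; have hy := psi2 y'; have := psi1 x' y' axy.
move: hx hy; rewrite !in_dom; case: (psi x') => [c|] // _; case: (psi y') => [c'|] // _ h /=.
by apply/eqP => cc; apply: h => //; rewrite cc.
Qed.

(** * Sharpness *)

Section ProjectivePlane.

Variable F : finFieldType.

(* Affine points (x, y), one point at infinity for each slope, and the vertical one;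
   dually: lines y = a x + b, vertical lines x = c, and the line at infinity. *)
Definition plane : finType := (F * F + F + unit)%type.

Definition incident (p l : plane) : bool :=
  match p, l with
  | inl (inl (x, y)), inl (inl (a, b)) => y == a * x + b
  | inl (inl (x, y)), inl (inr c) => x == c
  | inl (inr s), inl (inl (a, b)) => s == a
  | inl (inr _), inr _ | inr _, inl (inr _) | inr _, inr _ => true
  | _, _ => false
  end%R.

(** The points may coincide, so this also gives a line through every point. *)
Lemma join_exists p q : exists l, incident p l && incident q l.
Proof.
case: p => [[[x y]|s]|[]]; case: q => [[[x' y']|s']|[]]; last 1 [by exists (inr tt)].
- case: (eqVneq x x') => [<-|xx]; first by exists (inl (inr x)); rewrite /= eqxx.
  have d : (x - x' != 0)%R by rewrite subr_eq0.
  pose a := ((y - y') / (x - x'))%R; exists (inl (inl (a, y - a * x)%R)).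
  by apply/andP; split; apply/eqP; rewrite /a; field.
- by exists (inl (inl (s', y - s' * x)%R)); rewrite /= eqxx andbT; apply/eqP; ring.
- by exists (inl (inr x)); rewrite /= eqxx.
- by exists (inl (inl (s, y' - s * x')%R)); rewrite /= eqxx; apply/eqP; ring.
- by exists (inr tt).
- by exists (inr tt).
- by exists (inl (inr x')); rewrite /= eqxx.
- by exists (inr tt).
Qed.

Lemma meet_unique p q l l' :
  incident p l -> incident q l -> incident p l' -> incident q l' -> l != l' -> p = q.
Proof.
move=> h1 h2 h3 h4 /eqP ll.
case: l ll h1 h2 => [[[a b]|c]|[]]; case: l' h3 h4 => [[[a' b']|c']|[]];
  case: p => [[[x y]|s]|[]] //=; case: q => [[[x' y']|s']|[]] //=.
- move=> /eqP h1 /eqP h2 ll /eqP h3 /eqP h4.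
  have : ((a - a') * (x - x') = 0)%R.
    have -> : ((a - a') * (x - x') = (a * x + b) - (a' * x + b') - ((a * x' + b) - (a' * x' + b')))%R by ring.
    by rewrite -h1 -h2 -h3 -h4 !subrr.
  move/eqP; rewrite mulf_eq0 !subr_eq0 => /orP [/eqP aa|/eqP xx]; last by rewrite h3 h4 xx.
  case: ll; rewrite aa; congr (inl (inl (_, _))); apply: (addrI (a * x)%R); by rewrite -h3 h1 aa.
- by move=> /eqP h1 /eqP h2 ll /eqP h3 /eqP h4; case: ll; move: h1 h3; rewrite -h2 -h4 => -> /addrI ->.
- by move=> /eqP h1 /eqP h2 ll /eqP h3 /eqP h4; case: ll; move: h2 h4; rewrite -h1 -h3 => -> /addrI ->.
- by move=> /eqP -> /eqP ->.
- by move=> /eqP h1 /eqP h2 _ /eqP h3 /eqP h4; rewrite h3 h4 h1 h2.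
- by move=> _ _ _ /eqP -> /eqP ->.
- by move=> /eqP h1 /eqP h2 _ /eqP h3 /eqP h4; rewrite h1 h2 h3 h4.
- by move=> /eqP h1 _ ll /eqP h3; case: ll; rewrite -h1 -h3.
- by move=> /eqP h1 _ ll /eqP h3; case: ll; rewrite -h1 -h3.
- by move=> _ /eqP h1 ll _ /eqP h3; case: ll; rewrite -h1 -h3.
- by move=> /eqP -> /eqP ->.
Qed.

Lemma card_line l : #|[set p | incident p l]| <= #|F|.+1.
Proof.
pose g (u : option F) : plane := match l, u with
  | inl (inl (a, b)), Some x => inl (inl (x, a * x + b)%R)
  | inl (inl (a, b)), None => inl (inr a)
  | inl (inr c), Some y => inl (inl (c, y))
  | inr _, Some s => inl (inr s)
  | _, None => inr tt end.
rewrite -card_option -cardsT; apply: (@leq_trans #|g @: [set: option F]|); last exact: leq_imset_card.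
apply/subset_leq_card/subsetP => p; rewrite inE /g => h; apply/imsetP.
case: l @g h => [[[a b]|c]|[]]; case: p => [[[x y]|s]|[]] //=.
- by move=> /eqP ->; exists (Some x); rewrite ?in_setT.
- by move=> /eqP ->; exists None; rewrite ?in_setT.
- by move=> /eqP ->; exists (Some y); rewrite ?in_setT.
- by exists None; rewrite ?in_setT.
- by exists (Some s); rewrite ?in_setT.
- by exists None; rewrite ?in_setT.
Qed.

Lemma card_plane : #|plane| = #|F| ^ 2 + #|F| + 1.
Proof. by rewrite !card_sum card_prod card_unit -mulnn. Qed.

End ProjectivePlane.

Lemma card_colorable (T : finType) (U : {set T}) (r : rel T) (k : nat) :
  is_complete U r -> colorable U r k -> #|U| <= k.
Proof.
move=> hU /existsP [f hf]; rewrite -(card_ord k) -(card_in_imset (f := f)); first exact: max_card.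
move=> x y xU yU fxy; apply/eqP; apply: contraT => xy.
have /forallP/(_ x)/implyP/(_ xU)/forallP/(_ y)/implyP/(_ yU)/implyP := hf.
by rewrite xy hU // fxy eqxx => /(_ isT).
Qed.

Lemma chromatic_complete (T : finType) (U : {set T}) (r : rel T) : U = setT -> is_complete U r -> chromatic U r = #|U|.
Proof.
move=> UT hU; rewrite /chromatic; case: ex_minnP => m hm mmin; apply/eqP; rewrite eqn_leq.
rewrite (card_colorable hU hm) andbT; apply: mmin; apply/existsP.
rewrite UT cardsT; exists [ffun x => enum_rank x]; apply/forallP => x; apply/implyP => _.
apply/forallP => y; apply/implyP => _; apply/implyP => /andP [xy _]; rewrite !ffunE.
by apply: contra xy => /eqP /enum_rank_inj ->.
Qed.

Lemma chromatic_sharp (p t : nat) : prime p -> t <= p ->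
  exists (T : finType) (V : 'I_(p ^ 2 + p + 1) -> {set T}),
         [/\ (forall i, #|V i| <= p ^ 2 + p + 1),
             (forall i j, i != j -> #|V i :&: V j| <= t),
             #|union_vertices V| = t * (p ^ 2 + p + 1),
             is_complete (union_vertices V) (union_adj V) &
             chromatic (union_vertices V) (union_adj V) = t * (p ^ 2 + p + 1)].
Proof.
move=> pp tp; pose P := plane 'F_p.
have cF : #|'F_p| = p by rewrite card_Fp.
have cP : #|P| = p ^ 2 + p + 1 by rewrite card_plane cF.
pose line (i : 'I_(p ^ 2 + p + 1)) : P := enum_val (cast_ord (esym cP) i).
have line_inj : injective line by move=> i j /enum_val_inj /cast_ord_inj.
have line_onto l : exists i, line i = l.
  by exists (cast_ord cP (enum_rank l)); rewrite /line cast_ordK enum_rankK.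
pose V i : {set P * 'I_t} := [set x | incident x.1 (line i)].
have VE i : V i = setX [set q | incident q (line i)] [set: 'I_t].
  by apply/setP => x; rewrite !inE andbT.
have full : union_vertices V = setT.
  apply/setP => x; rewrite in_setT; have [l /andP [h _]] := join_exists x.1 x.1.
  by have [i il] := line_onto l; apply/bigcupP; exists i; rewrite // inE il.
have cU : #|union_vertices V| = t * (p ^ 2 + p + 1).
  by rewrite full cardsT card_prod card_ord mulnC -cP.
have cmpl : is_complete (union_vertices V) (union_adj V).
  move=> x y _ _ xy; rewrite /union_adj xy /=; have [l /andP [h1 h2]] := join_exists x.1 y.1.
  by have [i il] := line_onto l; apply/existsP; exists i; rewrite !inE il h1.
exists (P * 'I_t)%type, V; split=> //.
- move=> i; rewrite VE cardsX cardsT card_ord.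
  (* [(p + 1) * t <= (p + 1) * p], one less than the bound; this is where [t <= p] is needed. *)
  apply: leq_trans (leq_mul (card_line (line i)) tp) _; rewrite cF mulSn -mulnn; lia.
- move=> i j ij; rewrite -[X in _ <= X](card_ord t) -cardsT.
  (* Distinct lines share at most one point, so a common element is determined by its copy
     number. *)
  rewrite -(card_in_imset (f := snd) (D := V i :&: V j)); first exact/subset_leq_card/subsetT.
  move=> [q a] [q' a']; rewrite !inE /= => /andP [h1 h2] /andP [h3 h4] ->; congr (_, _).
  by apply: (meet_unique h1 h3 h2 h4); apply: contra ij => /eqP /line_inj ->.
- by rewrite chromatic_complete.
Qed.

Theorem theorem1p2 :
  (exists n0 : nat, forall n t : nat, n0 <= n -> 2 <= t ->
     forall (T : finType) (V : 'I_n -> {set T}),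
       (forall i, #|V i| <= n) ->
       (forall i j, i != j -> #|V i :&: V j| <= t) ->
       chromatic (union_vertices V) (union_adj V) <= t * n)
  /\
  (forall m : nat, exists k : nat, m <= k /\
     forall n t : nat, n = k ^ 2 + k + 1 -> t <= k ->
       exists (T : finType) (V : 'I_n -> {set T}),
         [/\ (forall i, #|V i| <= n),
             (forall i j, i != j -> #|V i :&: V j| <= t),
             #|union_vertices V| = t * n,
             is_complete (union_vertices V) (union_adj V) &
             chromatic (union_vertices V) (union_adj V) = t * n]).
Proof.
split; first exact: chromatic_upper.
move=> m; have [p mp pp] := prime_above m; exists p; split; first exact: ltnW.
by move=> n t -> tp; exact: chromatic_sharp.
Qed.
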